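(* Let $u_d\in L^2(Q_T)$ and $\eta>0$. Let $(\overline u,\overline p)\in U_0\times W$ be a solution to the variational problem $$\mathcal{A}\big((\overline u,\overline p),(\varphi,\phi)\big)=\int_{Q_T}u_d\,\phi\,\mathrm{d}\boldsymbol{x}\,\mathrm{d}t\qquad\forall(\varphi,\phi)\in W\times U_0,$$ where $$\mathcal{A}\big((u,p),(\varphi,\phi)\big):=a(u,\varphi)+\frac1\eta\int_{Q_T}\kappa\nabla p\cdot\nabla\varphi\,\mathrm{d}\boldsymbol{x}\,\mathrm{d}t+\int_{Q_T}u\,\phi\,\mathrm{d}\boldsymbol{x}\,\mathrm{d}t-a(\phi,p).$$ Then $(\overline u,\overline p)\in U_0\times U_T$. Moreover, $\overline u=u^\ast$ in $U_0$ and $\overline p=p^\ast$ in $U_T$, where $u^\ast\in U_0$ and $p^\ast\in U_T$ are the optimal state and adjoint, i.e. the elements associated with the unique minimizer $f^\ast\in W'$ of the optimal control functional $J$ by $$a(u^\ast,\varphi)=\langle f^\ast,\varphi\rangle\ \ \forall\varphi\in W,\qquad a'(p^\ast,\phi)=\int_{Q_T}(u^\ast-u_d)\phi\,\mathrm{d}\boldsymbol{x}\,\mathrm{d}t\ \ \forall\phi\in W,\qquad p^\ast+\eta\,z(f^\ast)=0_W.$$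
   Context: Setting. $\Omega\subset\mathbb{R}^m$ ($m=1,2$ or $3$) is an open bounded domain with Lipschitz boundary, $T>0$, and $Q_T:=\Omega\times(0,T)$. For each $t\in[0,T]$, $\Omega$ is partitioned into two subdomains $\Omega_1(t),\Omega_2(t)$ separated by an interface $\Gamma(t)$, which is transported by a velocity field $\mathbf{v}\in C([0,T],\mathbf{C}^2(\overline\Omega))$ with $\nabla\cdot\mathbf{v}(\boldsymbol{x},t)=0$ for all $(\boldsymbol{x},t)\in\Omega\times[0,T]$. $Q_1,Q_2$ denote the two corresponding subdomains of $Q_T$ separated by $\Gamma^\ast:=\bigcup_{t\in(0,T)}\Gamma(t)\times\{t\}$, which is assumed to be a $C^2$-regular hypersurface in $\mathbb{R}^{m+1}$. The coefficient $\kappa$ equals a constant $\kappa_1>0$ in $Q_1$ and a constant $\kappa_2>0$ in $Q_2$. $\nabla$ is the gradient in the spatial variable $\boldsymbol{x}$ only. Spaces. $H^{1,0}(Q_T)$ is the space of $w\in L^2(Q_T)$ whose first-order spatial weak derivatives lie in $L^2(Q_T)$, with norm $\|w\|_{H^{1,0}(Q_T)}^2=\sum_{|\boldsymbol\alpha|\le1}\|\partial_{\boldsymbol{x}}^{\boldsymbol\alpha}w\|_{L^2(Q_T)}^2$. $W$ is the closure of $C_0^1(Q_T)$ in this norm, equipped with the equivalent norm $\|w\|_W^2:=\int_{Q_T}\kappa|\nabla w|^2\,\mathrm{d}\boldsymbol{x}\,\mathrm{d}t$. $W'$ is the dual of $W$ with dual norm $\|\cdot\|_{W'}$, and $\langle\cdot,\cdot\rangle$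 is the duality pairing between $W'$ and $W$. For $w\in W$, $\partial_tw(\xi):=-\int_{Q_T}w\,\partial_t\xi\,\mathrm{d}\boldsymbol{x}\,\mathrm{d}t$ for $\xi\in C_0^1(Q_T)$. $U:=\{w\in W\mid\partial_tw\in W'\}$ with norm $\|w\|_U^2=\|w\|_W^2+\|\partial_tw\|_{W'}^2$; elements of $U$ have traces at $t=0$ and $t=T$ in $L^2(\Omega)$ ($U$ coincides with $\{w\in L^2((0,T),H^1_0(\Omega))\mid\partial_tw\in L^2((0,T),H^{-1}(\Omega))\}$). $U_0:=\{w\in U\mid w(\cdot,0)=0\}$ and $U_T:=\{w\in U\mid w(\cdot,T)=0\}$. Forms. For $u\in U_0$, $p\in U_T$ and $\varphi,\phi\in W$, $$a(u,\varphi):=\langle\partial_tu,\varphi\rangle+\int_{Q_T}(\mathbf{v}\cdot\nabla u)\varphi+\kappa\nabla u\cdot\nabla\varphi\,\mathrm{d}\boldsymbol{x}\,\mathrm{d}t,$$ $$a'(p,\phi):=-\langle\partial_tp,\phi\rangle+\int_{Q_T}-(\mathbf{v}\cdot\nabla p)\phi+\kappa\nabla p\cdot\nabla\phi\,\mathrm{d}\boldsymbol{x}\,\mathrm{d}t.$$ For every $f\in W'$ there is a unique $u(f)\in U_0$ with $a(u(f),\varphi)=\langle f,\varphi\rangle$ for all $\varphi\in W$ (known result). Riesz representative. For $\widetilde w\in W'$, $z(\widetilde w)\in W$ is the unique element with $\int_{Q_T}\kappa\nabla z(\widetilde w)\cdot\nabla\zeta\,\mathrm{d}\boldsymbol{x}\,\mathrm{d}t=\langle\widetilde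 w,\zeta\rangle$ for all $\zeta\in W$. Optimal control problem. Minimize over $f\in W'$ the functional $J(f):=\frac12\|u(f)-u_d\|_{L^2(Q_T)}^2+\frac\eta2\|f\|_{W'}^2$. It has a unique minimizer $f^\ast\in W'$, and an element $f^\ast\in W'$ is the minimizer if and only if there exist $u^\ast\in U_0$, $p^\ast\in U_T$ satisfying the three displayed conditions at the end of the claim. *)

(* Defs.v *)
From HB Require Import structures.
From mathcomp Require Import all_boot all_order all_algebra.
From mathcomp Require Import all_classical all_reals all_analysis.

Set Implicit Arguments.
Unset Strict Implicit.
Unset Printing Implicit Defensive.
Import Order.TTheory GRing.Theory Num.Theory.
Import numFieldNormedType.Exports.

Local Open Scope classical_set_scope.
Local Open Scope ring_scope.

(* R^n is 'rV[R]_n, with the product Borel sigma-algebra generated by the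
   coordinates. *)
Definition rV_display : measure_display -> measure_display.
Proof. exact. Qed.

Section measurable_rV.
Context {d : measure_display} {T : measurableType d} (n : nat).

Let coord : 'I_n -> 'rV[T]_n -> T := fun i x => x ord0 i.

Let rV_set0 : g_sigma_preimage coord set0.
Proof. exact: sigma_algebra0. Qed.

Let rV_setC A : g_sigma_preimage coord A -> g_sigma_preimage coord (~` A).
Proof. exact: sigma_algebraC. Qed.

Let rV_bigcup (F : (set 'rV[T]_n)^nat) :
  (forall i, g_sigma_preimage coord (F i)) ->
  g_sigma_preimage coord (\bigcup_i (F i)).
Proof. exact: sigma_algebra_bigcup. Qed.

HB.instance Definition _ := @isMeasurable.Build (rV_display d)
  'rV[T]_n (g_sigma_preimage coord) rV_set0 rV_setC rV_bigcup.

End measurable_rV.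

Lemma measurable_coord d (T : measurableType d) n (i : 'I_n) :
  measurable_fun [set: 'rV[T]_n] (fun x => x ord0 i).
Proof.
move=> _ Y mY; rewrite setTI; apply: sub_sigma_algebra => /=.
rewrite -bigcup_seq/=; exists i => /=; first by rewrite mem_index_enum.
by exists Y => //; rewrite setTI.
Qed.

Lemma measurable_fun_coordP d1 d2 (T1 : measurableType d1)
    (T2 : measurableType d2) n (f : T1 -> 'rV[T2]_n) :
  (forall i, measurable_fun [set: T1] (fun x => f x ord0 i)) ->
  measurable_fun [set: T1] f.
Proof.
move=> mf.
pose coord (i : 'I_n) (x : 'rV[T2]_n) := x ord0 i.
suff prefS : g_sigma_preimage (fun i => coord i \o f) `<=` measurable.
  move=> _ A mA; apply: prefS; rewrite g_sigma_preimage_comp.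
  by exists A.
apply: smallest_sub; first exact: sigma_algebra_measurable.
rewrite -bigcup_seq/=; apply: bigcup_sub => i _.
by move=> A [B mB <-]; exact: mf.
Qed.

Section lebesgue_rV.
Context {R : realType}.

Definition cons_rV n (z : measurableTypeR R * 'rV[R]_n) : 'rV[R]_n.+1 :=
  \row_i (if unlift ord0 i is Some j then z.2 ord0 j else z.1).

Definition uncons_rV n (x : 'rV[R]_n.+1) : measurableTypeR R * 'rV[R]_n :=
  (x ord0 ord0, \row_j x ord0 (lift ord0 j)).

Lemma cons_rVK n : cancel (@cons_rV n) (@uncons_rV n).
Proof.
move=> [a x]; rewrite /uncons_rV /cons_rV !mxE unlift_none; congr pair.
by apply/rowP => j; rewrite !mxE liftK.
Qed.

Lemma measurable_cons_rV n : measurable_fun setT (@cons_rV n).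
Proof.
apply: measurable_fun_coordP => i; rewrite /cons_rV.
case: (unliftP ord0 i) => [j|] ->.
  apply: (eq_measurable_fun
    (fun z : measurableTypeR R * 'rV[R]_n => z.2 ord0 j)).
    by move=> z _; rewrite !mxE liftK.
  exact: (measurableT_comp (measurable_coord j) measurable_snd).
apply: (eq_measurable_fun (fun z : measurableTypeR R * 'rV[R]_n => z.1)).
  by move=> z _; rewrite !mxE unlift_none.
exact: measurable_fst.
Qed.

Lemma measurable_uncons_rV n : measurable_fun setT (@uncons_rV n).
Proof.
apply: measurable_fun_pair; first exact: measurable_coord.
apply: measurable_fun_coordP => i.
apply: (eq_measurable_fun (fun x : 'rV[R]_n.+1 => x ord0 (lift ord0 i))).
  by move=> x _; rewrite /= mxE.
exact: measurable_coord.
Qed.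

Section cons_measure.
Local Open Scope ereal_scope.
Context n (mu : {sigma_finite_measure set 'rV[R]_n -> \bar R}).

Definition cons_measure : set 'rV[R]_n.+1 -> \bar R :=
  pushforward (@lebesgue_measure R \x mu) (@cons_rV n).

Let mcons := @measurable_cons_rV n.

Let cons_measure0 : cons_measure set0 = 0.
Proof. exact: measure0. Qed.

Let cons_measure_ge0 A : 0 <= cons_measure A.
Proof. exact: measure_ge0. Qed.

Let cons_measure_sigma_additive : semi_sigma_additive cons_measure.
Proof. exact: measure_semi_sigma_additive. Qed.

HB.instance Definition _ := isMeasure.Build _ _ _ cons_measure
  cons_measure0 cons_measure_ge0 cons_measure_sigma_additive.

Let cons_measure_sigma_finite : sigma_finite setT cons_measure.
Proof.
have /sigma_finiteP[F [FT ndF Foo]] := sigma_finiteT (@lebesgue_measure R).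
have /sigma_finiteP[G [GT ndG Goo]] := sigma_finiteT mu.
exists (fun k => @uncons_rV n @^-1` (F k `*` G k)).
  apply/esym; rewrite -subTset => x _.
  have [i _ Fi] : (\bigcup_i F i) (uncons_rV x).1 by rewrite -FT.
  have [j _ Gj] : (\bigcup_i G i) (uncons_rV x).2 by rewrite -GT.
  exists (maxn i j) => //; split.
    by move: Fi; exact/subsetPset/ndF/leq_maxl.
  by move: Gj; exact/subsetPset/ndG/leq_maxr.
move=> k; have [mF Fk] := Foo k; have [mG Gk] := Goo k; split.
  by rewrite -[X in measurable X]setTI; apply: measurable_uncons_rV => //;
    exact: measurableX.
rewrite /cons_measure /pushforward -comp_preimage.
rewrite (_ : _ \o _ = id) ?preimage_id; last first.
  by apply/funext => z; exact: cons_rVK.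
by rewrite product_measure1E// lte_mul_pinfty// ge0_fin_numE.
Qed.

HB.instance Definition _ := Measure_isSigmaFinite.Build _ _ _ cons_measure
  cons_measure_sigma_finite.

End cons_measure.

(* n-dimensional Lebesgue measure, as the n-fold product of the
   one-dimensional one. *)
Fixpoint lebesgue_rV n : {sigma_finite_measure set 'rV[R]_n -> \bar R} :=
  if n is n'.+1 then cons_measure (lebesgue_rV n') else dirac (0 : 'rV[R]_0).
End lebesgue_rV.

Section calculus.
Context {R : realType}.

(* Functions of class C^k on the open set D. *)
Fixpoint class_C (V W : normedModType R) (k : nat) (D : set V) (f : V -> W)
    : Prop :=
  if k is k'.+1 then
    (forall x, D x -> differentiable f x) /\
    forall e : V, class_C k' D (fun x => 'D_e f x)
  else forall x, D x -> {for x, continuous f}.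

(* C_0^1(D): functions of class C^1 with compact support in D. *)
Definition C01 (V : normedModType R) (D : set V) (f : V -> R) : Prop :=
  class_C 1 setT f /\
  exists2 K, compact K /\ K `<=` D & forall x, ~ K x -> f x = 0.

Definition dotp n (x y : 'rV[R]_n) : R := \sum_(i < n) x ord0 i * y ord0 i.

Definition unit_vec n (i : 'I_n) : 'rV[R]_n := delta_mx ord0 i.

(* Iterated partial derivative; I lists the directions. *)
Fixpoint pderiv n (W : normedModType R) (I : seq 'I_n) (f : 'rV[R]_n -> W)
    : 'rV[R]_n -> W :=
  if I is i :: I' then fun x => 'D_(unit_vec i) (pderiv I' f) x else f.

Definition divergence n (f : 'rV[R]_n -> 'rV[R]_n) (x : 'rV[R]_n) : R :=
  \sum_(i < n) ('D_(unit_vec i) f x) ord0 i.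

(* C^2(closure D): class C^2 on D, and all derivatives of order at most 2
   extend continuously to the closure. *)
Definition C2_closure n (D : set 'rV[R]_n) (f : 'rV[R]_n -> 'rV[R]_n) : Prop :=
  [/\ {within closure D, continuous f}, class_C 2 D f &
      forall I, (size I <= 2)%N ->
        exists2 g, {within closure D, continuous g} &
          forall x, D x -> g x = pderiv I f x].

(* v belongs to C([0, T], C^2(closure D)). *)
Definition C0_C2_closure n (D : set 'rV[R]_n) (T : R)
    (v : 'rV[R]_n * R -> 'rV[R]_n) : Prop :=
  (forall t, 0 <= t <= T -> C2_closure D (fun x => v (x, t))) /\
  forall s, 0 <= s <= T -> forall e, 0 < e ->
    exists2 delta, 0 < delta & forall t, 0 <= t <= T -> `|t - s| < delta ->
      forall I, (size I <= 2)%N -> forall x, D x ->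
        `|pderiv I (fun y => v (y, t)) x - pderiv I (fun y => v (y, s)) x| <= e.

(* Near each boundary point and up to an orthogonal change of coordinates, D is
   the region strictly above the graph of a Lipschitz function of the remaining
   n - 1 coordinates. *)
Definition lipschitz_boundary n (D : set 'rV[R]_n) : Prop :=
  forall x0, (closure D `\` interior D) x0 ->
    exists (M : 'M[R]_n) (i : 'I_n) (g : 'rV[R]_n.-1 -> R) (L : R),
      [/\ M *m M^T = 1%:M, (forall y y', `|g y - g y'| <= L * `|y - y'|) &
          \forall x \near x0, D x <-> g (col' i (x *m M)) < (x *m M) ord0 i].

(* S is locally the regular zero set of a function of class C^2. *)
Definition C2_hypersurface (V : normedModType R) (S : set V) : Prop :=
  forall z, S z -> exists (N : set V) (f : V -> R),
    [/\ open N, N z, class_C 2 N f,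
        (forall y, N y -> exists e, 'D_e f y != 0) &
        forall y, N y -> (S y <-> f y = 0)].

Definition integral_curve n (D : set 'rV[R]_n) (v : 'rV[R]_n * R -> 'rV[R]_n)
    (t1 t2 : R) (x : R -> 'rV[R]_n) : Prop :=
  [/\ {within `[t1, t2], continuous x},
      (forall t, t1 <= t <= t2 -> D (x t)) &
      forall t, t1 < t < t2 -> is_derive t 1 x (v (x t, t))].

(* A particle moving in D with velocity v which is on the interface at one time
   is on it at all times. When the flow of v preserves D, this amounts to
   Gamma t being the image of Gamma 0 under the flow. *)
Definition transported n (D : set 'rV[R]_n) (T : R)
    (v : 'rV[R]_n * R -> 'rV[R]_n) (Gamma : R -> set 'rV[R]_n) : Prop :=
  forall t1 t2 x, 0 <= t1 -> t1 <= t2 -> t2 <= T ->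
    integral_curve D v t1 t2 x ->
    forall s t, t1 <= s <= t2 -> t1 <= t <= t2 -> Gamma s (x s) -> Gamma t (x t).

Definition L2 d (X : measurableType d) (mu : {measure set X -> \bar R})
    (D : set X) (f : X -> R) : Prop :=
  measurable_fun D f /\ mu.-integrable D (fun x => ((f x) ^+ 2)%:E).

End calculus.

Record interface_problem (R : realType) (m : nat) := InterfaceProblem {
  Omega : set 'rV[R]_m ;
  horizon : R ;
  Omega1 : R -> set 'rV[R]_m ;
  Omega2 : R -> set 'rV[R]_m ;
  Gamma : R -> set 'rV[R]_m ;
  velocity : 'rV[R]_m * R -> 'rV[R]_m ;
  kappa1 : R ;
  kappa2 : R }.

Section problem.
Context {R : realType} {m : nat}.
Variable P : interface_problem R m.

Local Notation T := (horizon P).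
Local Notation spacetime := ('rV[R]_m * R)%type.
Local Notation v := (velocity P).

(* The part of spacetime at times in (0, T) with slice D t at time t. *)
Definition tube (D : R -> set 'rV[R]_m) : set spacetime :=
  [set z | 0 < z.2 < T /\ D z.2 z.1].

Definition QT : set spacetime := tube (fun=> Omega P).
Definition Q1 : set spacetime := tube (Omega1 P).
Definition Q2 : set spacetime := tube (Omega2 P).
Definition Gamma_star : set spacetime := tube (Gamma P).

Record standing_assumptions : Prop := {
  dimension_le3 : (1 <= m <= 3)%N ;
  horizon_gt0 : 0 < T ;
  Omega_domain : [/\ open (Omega P), connected (Omega P) & Omega P !=set0] ;
  Omega_bounded : bounded_set (Omega P) ;
  Omega_lipschitz : lipschitz_boundary (Omega P) ;
  subdomains : forall t, 0 <= t <= T ->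
    [/\ open (Omega1 P t), open (Omega2 P t), Omega1 P t !=set0 &
        Omega2 P t !=set0] ;
  partitioned : forall t, 0 <= t <= T ->
    [/\ Omega P = Omega1 P t `|` Gamma P t `|` Omega2 P t,
        Omega1 P t `&` Omega2 P t = set0, Omega1 P t `&` Gamma P t = set0 &
        Omega2 P t `&` Gamma P t = set0] ;
  separated : forall t, 0 <= t <= T ->
    Gamma P t = Omega P `&` closure (Omega1 P t) `&` closure (Omega2 P t) ;
  velocity_regular : C0_C2_closure (Omega P) T v ;
  velocity_div_free : forall x t, Omega P x -> 0 <= t <= T ->
    divergence (fun y => v (y, t)) x = 0 ;
  Gamma_transported : transported (Omega P) T v (Gamma P) ;
  Q1_open : open Q1 ;
  Q2_open : open Q2 ;
  Gamma_star_C2 : C2_hypersurface Gamma_star ;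
  kappa1_gt0 : 0 < kappa1 P ;
  kappa2_gt0 : 0 < kappa2 P }.

(* The value on Gamma_star, which is a null set, is immaterial. *)
Definition kappa (z : spacetime) : R :=
  if z \in Q1 then kappa1 P else kappa2 P.

Definition vol : {measure set _ -> \bar R} :=
  (lebesgue_rV m \x @lebesgue_measure R)%E.

Definition intQ (f : spacetime -> R) : R := \int[vol]_(z in QT) f z.

(* Elements of L^2(QT) are represented by functions on the whole of spacetime, of
   which only the values on QT matter, and equality is eqQ. *)
Definition L2Q (f : spacetime -> R) : Prop := L2 vol QT f.

Definition eqQ (f g : spacetime -> R) : Prop := ae_eq vol QT f g.

Definition ddx (i : 'I_m) (f : spacetime -> R) (z : spacetime) : R :=
  'D_((unit_vec i, 0) : spacetime) f z.

Definition ddt (f : spacetime -> R) (z : spacetime) : R :=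
  'D_((0, 1) : spacetime) f z.

Definition is_wgrad (w : spacetime -> R) (g : spacetime -> 'rV[R]_m) : Prop :=
  (forall i, L2Q (fun z => g z ord0 i)) /\
  forall i xi, C01 QT xi ->
    intQ (fun z => w z * ddx i xi z) = - intQ (fun z => g z ord0 i * xi z).

Definition wgrad (w : spacetime -> R) : spacetime -> 'rV[R]_m :=
  xget (fun=> 0) [set g | is_wgrad w g].

Definition H10 (w : spacetime -> R) : Prop :=
  L2Q w /\ exists g, is_wgrad w g.

Definition H10_norm (w : spacetime -> R) : R :=
  Num.sqrt (intQ (fun z => w z ^+ 2) +
            \sum_(i < m) intQ (fun z => wgrad w z ord0 i ^+ 2)).

Definition W_space (w : spacetime -> R) : Prop :=
  H10 w /\ forall e, 0 < e ->
    exists2 xi, C01 QT xi & H10_norm (fun z => w z - xi z) < e.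

Definition W_form (w1 w2 : spacetime -> R) : R :=
  intQ (fun z => kappa z * dotp (wgrad w1 z) (wgrad w2 z)).

Definition W_norm (w : spacetime -> R) : R := Num.sqrt (W_form w w).

(* A functional is only meaningful on W_space. *)
Definition W_dual (F : (spacetime -> R) -> R) : Prop :=
  (forall c w1 w2, W_space w1 -> W_space w2 ->
     F (fun z => c * w1 z + w2 z) = c * F w1 + F w2) /\
  exists C, forall w, W_space w -> `|F w| <= C * W_norm w.

Definition W_dual_norm (F : (spacetime -> R) -> R) : R :=
  sup [set `|F w| | w in [set w | W_space w /\ W_norm w <= 1]].

Definition is_time_deriv (w : spacetime -> R) (F : (spacetime -> R) -> R)
    : Prop :=
  W_dual F /\ forall xi, C01 QT xi -> F xi = - intQ (fun z => w z * ddt xi z).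

(* Unique on W_space, where C01 QT is dense. *)
Definition time_deriv (w : spacetime -> R) : (spacetime -> R) -> R :=
  xget (fun=> 0) [set F | is_time_deriv w F].

Definition U_space (w : spacetime -> R) : Prop :=
  W_space w /\ exists F, is_time_deriv w F.

(* The trace of w at time s is the value at s of the representative of w in
   C([0, T], L^2(Omega)). *)
Definition has_trace (w : spacetime -> R) (s : R) (g : 'rV[R]_m -> R) : Prop :=
  exists y : R -> 'rV[R]_m -> R,
  [/\ forall t, 0 <= t <= T -> L2 (lebesgue_rV m) (Omega P) (y t),
      forall t, 0 <= t <= T -> forall e, 0 < e ->
        exists2 delta, 0 < delta & forall r, 0 <= r <= T -> `|r - t| < delta ->
          \int[lebesgue_rV m]_(x in Omega P) (y r x - y t x) ^+ 2 < e,
      {ae (@lebesgue_measure R), forall t, 0 < t < T ->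
        ae_eq (lebesgue_rV m) (Omega P) (fun x => w (x, t)) (y t)} &
      ae_eq (lebesgue_rV m) (Omega P) (y s) g].

Definition U0_space (w : spacetime -> R) : Prop :=
  U_space w /\ has_trace w 0 (fun=> 0).

Definition UT_space (w : spacetime -> R) : Prop :=
  U_space w /\ has_trace w T (fun=> 0).

Definition form_a (u phi : spacetime -> R) : R :=
  time_deriv u phi +
  intQ (fun z => dotp (v z) (wgrad u z) * phi z +
                 kappa z * dotp (wgrad u z) (wgrad phi z)).

Definition form_a' (p phi : spacetime -> R) : R :=
  - time_deriv p phi +
  intQ (fun z => - (dotp (v z) (wgrad p z) * phi z) +
                 kappa z * dotp (wgrad p z) (wgrad phi z)).

Definition form_A (eta : R) (u p phi psi : spacetime -> R) : R :=
  form_a u phi + eta^-1 * W_form p phi + intQ (fun z => u z * psi z)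
  - form_a psi p.

Definition is_state (f : (spacetime -> R) -> R) (u : spacetime -> R) : Prop :=
  U0_space u /\ forall phi, W_space phi -> form_a u phi = f phi.

(* u(f), which exists and is unique up to eqQ for every f in the dual of W. *)
Definition state (f : (spacetime -> R) -> R) : spacetime -> R :=
  xget (fun=> 0) [set u | is_state f u].

Definition is_riesz (F : (spacetime -> R) -> R) (w : spacetime -> R) : Prop :=
  W_space w /\ forall zeta, W_space zeta -> W_form w zeta = F zeta.

Definition cost (ud : spacetime -> R) (eta : R) (f : (spacetime -> R) -> R)
    : R :=
  2^-1 * intQ (fun z => (state f z - ud z) ^+ 2) +
  eta / 2 * W_dual_norm f ^+ 2.

Definition is_minimizer (ud : spacetime -> R) (eta : R)
    (f : (spacetime -> R) -> R) : Prop :=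
  W_dual f /\ forall g, W_dual g -> cost ud eta f <= cost ud eta g.

End problem.

(* Main.v *)
Require Import Defs.
From HB Require Import structures.
From mathcomp Require Import all_boot all_order all_algebra.
From mathcomp Require Import all_classical all_reals all_analysis.
From mathcomp Require Import measurable_realfun.
From mathcomp Require Import ring lra.

Set Implicit Arguments.
Unset Strict Implicit.
Unset Printing Implicit Defensive.
Import Order.TTheory GRing.Theory Num.Theory.
Import numFieldNormedType.Exports.

Local Open Scope classical_set_scope.
Local Open Scope ring_scope.

(** Testing the saddle-point problem with $\varphi=0$ gives $a(\psi,\overline p)=\int(\overline
    u-u_d)\psi$ for all $\psi\in U_0$: a weak backward adjoint equation whose test functions vanish
    at time $0$ but are free at time $T$. Subtracting the case $\psi=\overline u$ from the full
    identity leaves $a(\overline u,\varphi)+\eta^{-1}\int\kappa\nabla\overline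
    p\cdot\nabla\varphi=0$ for all $\varphi\in W$.

    Regularity ([adjoint_regularity]). The adjoint equation itself names the functional $F\in W'$
    that must be $\partial_t\overline p$. Because $\psi$ may be nonzero at $T$, the identity
    $F(\psi)=-\int\overline p\,\partial_t\psi$ holds without a boundary term at $T$; this is
    [one_sided], a weak form of $\overline p(T)=0$. It yields $|\int\overline
    p\,(\varphi(t-h)-\varphi(t))|\le Ch\|\nabla\varphi\|$ ([one_sided_bound]), and then, by a
    discrete energy identity, a bound on the time increments of $\overline p$ over every thin strip,
    proportional to its width ([energy_estimate]). Hence the averages of $\overline p$ over short
    intervals $(t,t+h]$ converge in $L^2(\Omega)$, uniformly in $t$. The limit is the continuous
    representative, and it vanishes at $T$ because $\overline p$ is extended by 0 beyond $T$
    ([trace_at_horizon]).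

    Uniqueness. For $\psi\in U_0$ and $p\in U_T$ integration by parts in time has no boundary terms:
    $\langle\partial_t\psi,p\rangle$ and $-\langle\partial_tp,\psi\rangle$ are limits of the same
    difference quotient with the shift put on either factor ([diffq_cvg], [time_deriv_adjoint]).
    Convection is skew since $\nabla\cdot\mathbf v=0$ ([vdot_skew]). Testing the differences against
    each other cancels the coupling and leaves $\|\overline u-u^*\|^2+\eta^{-1}\|\overline
    p-p^*\|_W^2=0$; the Poincaré inequality concludes.

    Throughout, functions on $Q_T$ are extended by 0 to all of space-time, so that time shifts act
    as isometries, and statements on $W$ are obtained from $C_0^1(Q_T)$ by density, with squared
    norms. *)

(** * Square integrable functions and their inner product *)

Section square_integrable.
Context {d : measure_display} {X : measurableType d} {R : realType}.
Variable mu : {measure set X -> \bar R}.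
Implicit Types f g h b : X -> R.

Definition ip f g : R := \int[mu]_x (f x * g x).

Lemma integrable_le f g : measurable_fun setT f ->
  mu.-integrable setT (EFin \o g) -> (forall x, `|f x| <= g x) ->
  mu.-integrable setT (EFin \o f).
Proof.
move=> mf ig fg; apply: (le_integrable measurableT _ _ ig) => //.
  exact/measurable_EFinP.
by move=> x _ /=; rewrite lee_fin (le_trans (fg x))// ler_norm.
Qed.

Lemma integrable_cst_indic (A : set X) (M : R) : measurable A ->
  (mu A < +oo)%E -> mu.-integrable setT (EFin \o (fun x => M * \1_A x)).
Proof.
move=> mA Aoo; have i1 : mu.-integrable setT (EFin \o \1_A).
  apply/integrableP; split; first exact/measurable_EFinP.
  under eq_integral do rewrite gee0_abs ?lee_fin//=.
  by rewrite integral_indic// setIT.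
exact: (integrableZl measurableT M i1).
Qed.

Lemma L2_measurable f : L2 mu setT f -> measurable_fun setT f.
Proof. by case. Qed.

Lemma L2_mul f g : L2 mu setT f -> L2 mu setT g ->
  mu.-integrable setT (EFin \o (fun x => f x * g x)).
Proof.
move=> [mf intf] [mg intg].
apply: (@integrable_le _ (fun x => f x ^+ 2 + g x ^+ 2)).
- exact: measurable_funM.
- exact: (integrableD measurableT intf intg).
- move=> x; rewrite normrM -(real_normK (num_real (f x))).
  rewrite -(real_normK (num_real (g x))).
  have := sqr_ge0 (`|f x| - `|g x|); have := sqr_ge0 (`|f x| + `|g x|); nra.
Qed.

Lemma L2_le f g : measurable_fun setT f -> L2 mu setT g ->
  (forall x, `|f x| <= `|g x|) -> L2 mu setT f.
Proof.
move=> mf [mg ig] fg; split => //.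
apply: (integrable_le _ ig); first exact: measurable_funX.
move=> x; rewrite normrX -(real_normK (num_real (g x))).
by rewrite lerXn2r ?nnegrE.
Qed.

Lemma L2D f g : L2 mu setT f -> L2 mu setT g -> L2 mu setT (fun x => f x + g x).
Proof.
move=> Lf Lg; have ifg := L2_mul Lf Lg; case: Lf Lg => [mf intf] [mg intg].
split; first exact: measurable_funD.
have := integrableD measurableT intf intg.
move=> /(integrableD measurableT)/(_ (integrableZl measurableT 2 ifg)).
apply: eq_integrable => // x _ /=.
by rewrite -EFinM -!EFinD; congr EFin; ring.
Qed.

Lemma L2Z (c : R) f : L2 mu setT f -> L2 mu setT (fun x => c * f x).
Proof.
move=> [mf intf]; split; first exact: measurable_funM.
have := integrableZl measurableT (c ^+ 2) intf.
by apply: eq_integrable => // x _ /=; rewrite -EFinM exprMn.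
Qed.

Lemma L2N f : L2 mu setT f -> L2 mu setT (fun x => - f x).
Proof.
move=> /(L2Z (-1)); rewrite (_ : (fun x => _) = (fun x => - f x))//.
by apply/funext => x; rewrite mulN1r.
Qed.

Lemma L2B f g : L2 mu setT f -> L2 mu setT g -> L2 mu setT (fun x => f x - g x).
Proof. by move=> Lf Lg; exact: L2D Lf (L2N Lg). Qed.

Lemma L20 : L2 mu setT (fun=> 0).
Proof.
split; first exact: measurable_cst.
by rewrite expr0n; exact: integrable0.
Qed.

Lemma L2_bmul b (M : R) f : measurable_fun setT b -> (forall x, `|b x| <= M) ->
  L2 mu setT f -> L2 mu setT (fun x => b x * f x).
Proof.
move=> mb bM Lf; apply: (@L2_le _ (fun x => M * f x)).
- by apply: measurable_funM => //; case: Lf.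
- exact: L2Z.
- by move=> x; rewrite !normrM ler_wpM2r// (le_trans (bM x))// ler_norm.
Qed.

Lemma L2_indic f (A : set X) : measurable A -> L2 mu setT f ->
  L2 mu setT (f \_ A).
Proof.
move=> mA Lf; apply: (@L2_le _ f) => //.
  apply/(measurable_restrictT _ mA); apply: (measurable_funS measurableT) => //.
  by case: Lf.
by move=> x; rewrite patchE; case: ifPn => // _; rewrite normr0.
Qed.

Lemma L2_cst_indic (A : set X) : measurable A -> (mu A < +oo)%E ->
  L2 mu setT (\1_A : X -> R).
Proof.
move=> mA Aoo; split => //.
have := integrable_cst_indic 1 mA Aoo; apply: eq_integrable => // x _ /=.
by rewrite mul1r indicE; case: (_ \in _); rewrite ?expr1n// expr0n.
Qed.

Lemma restrict_indic (A : set X) f : f \_ A = (fun x => f x * \1_A x).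
Proof.
by apply/funext => x; rewrite patchE indicE; case: (_ \in _);
  rewrite ?mulr1 ?mulr0.
Qed.

Lemma L2_integrable_restrict (A : set X) f : measurable A -> (mu A < +oo)%E ->
  L2 mu setT f -> mu.-integrable setT (EFin \o (f \_ A)).
Proof.
by move=> mA Aoo Lf; rewrite restrict_indic; apply: L2_mul => //; exact: L2_cst_indic.
Qed.

Lemma L2_sum (I : Type) (s : seq I) (F : I -> X -> R) :
  (forall i, L2 mu setT (F i)) -> L2 mu setT (fun x => \sum_(i <- s) F i x).
Proof.
move=> LF; elim: s => [|i s ih].
  by under eq_fun do rewrite big_nil; exact: L20.
by under eq_fun do rewrite big_cons; exact: L2D.
Qed.

Lemma ipC f g : ip f g = ip g f.
Proof. by rewrite /ip; under eq_Rintegral do rewrite mulrC. Qed.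

Lemma ipDl f g h : L2 mu setT f -> L2 mu setT g -> L2 mu setT h ->
  ip (fun x => f x + g x) h = ip f h + ip g h.
Proof.
move=> Lf Lg Lh; rewrite /ip -RintegralD//; [|exact: L2_mul..].
by under eq_Rintegral do rewrite mulrDl.
Qed.

Lemma ipDr f g h : L2 mu setT f -> L2 mu setT g -> L2 mu setT h ->
  ip h (fun x => f x + g x) = ip h f + ip h g.
Proof. by move=> *; rewrite ipC ipDl// ![ip h _]ipC. Qed.

Lemma ipZl c f g : L2 mu setT f -> L2 mu setT g ->
  ip (fun x => c * f x) g = c * ip f g.
Proof.
move=> Lf Lg; rewrite /ip -RintegralZl//; last exact: L2_mul.
by under eq_Rintegral do rewrite -mulrA.
Qed.

Lemma ipZr c f g : L2 mu setT f -> L2 mu setT g ->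
  ip g (fun x => c * f x) = c * ip g f.
Proof. by move=> *; rewrite ipC ipZl// ipC. Qed.

Lemma ipNl f g : L2 mu setT f -> L2 mu setT g ->
  ip (fun x => - f x) g = - ip f g.
Proof.
move=> Lf Lg; rewrite -mulN1r -ipZl//.
by congr ip; apply/funext => x; rewrite mulN1r.
Qed.

Lemma ipNr f g : L2 mu setT f -> L2 mu setT g ->
  ip g (fun x => - f x) = - ip g f.
Proof. by move=> *; rewrite ipC ipNl// ipC. Qed.

Lemma ipBl f g h : L2 mu setT f -> L2 mu setT g -> L2 mu setT h ->
  ip (fun x => f x - g x) h = ip f h - ip g h.
Proof. by move=> Lf Lg Lh; rewrite ipDl ?ipNl//; exact: L2N. Qed.

Lemma ipBr f g h : L2 mu setT f -> L2 mu setT g -> L2 mu setT h ->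
  ip h (fun x => f x - g x) = ip h f - ip h g.
Proof. by move=> *; rewrite ipC ipBl// ![ip h _]ipC. Qed.

Lemma ip_ge0 f : 0 <= ip f f.
Proof. by apply: Rintegral_ge0 => x _; rewrite -expr2 sqr_ge0. Qed.

Lemma ip0l f : ip (fun=> 0) f = 0.
Proof.
by rewrite /ip; under eq_Rintegral do rewrite mul0r; rewrite Rintegral_cst ?mul0r.
Qed.

Lemma ip_cauchy_schwarz f g : L2 mu setT f -> L2 mu setT g ->
  ip f g ^+ 2 <= ip f f * ip g g.
Proof.
move=> Lf Lg; set a := ip f f; set b := ip f g; set c := ip g g.
have key t s : 0 <= t ^+ 2 * a + 2 * t * s * b + s ^+ 2 * c.
  have Ltf := L2Z t Lf; have Lsg := L2Z s Lg.
  have := ip_ge0 (fun x => t * f x + s * g x).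
  rewrite ipDl ?ipDr ?ipZl ?ipZr//; last exact: L2D.
  by rewrite (ipC g f) -/a -/b -/c; congr (_ <= _); ring.
have a0 : 0 <= a by exact: ip_ge0.
have c0 : 0 <= c by exact: ip_ge0.
(* The pairs $(b,-a)$ and $(c,-b)$ give $a(ac-b^2)\ge0$ and $c(ac-b^2)\ge0$; the other two settle
   $a=c=0$, where they read $-2b^2\ge0$. *)
have k1 := key b (- a); have k2 := key 1 (- b); have k3 := key (- b) 1.
have k4 := key c (- b).
by case: (ltrP 0 a) => ha; case: (ltrP 0 c) => hc; nra.
Qed.

Lemma ip_le f g : L2 mu setT f -> L2 mu setT g ->
  `|ip f g| <= Num.sqrt (ip f f) * Num.sqrt (ip g g).
Proof.
move=> Lf Lg; rewrite -sqrtrM ?ip_ge0// -sqrtr_sqr ler_wsqrtr//.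
exact: ip_cauchy_schwarz.
Qed.

Lemma ip_le_ip f g : measurable_fun setT f -> L2 mu setT g ->
  (forall x, `|f x| <= `|g x|) -> ip f f <= ip g g.
Proof.
move=> mf Lg fg; have Lf := L2_le mf Lg fg.
apply: le_Rintegral => //; [exact: L2_mul..|].
move=> x _; rewrite -!expr2 -(real_normK (num_real (f x))).
by rewrite -(real_normK (num_real (g x))) lerXn2r ?nnegrE.
Qed.

(** The parallelogram law with one term dropped. It serves as the triangle inequality for squared
    norms in all approximation arguments below. *)
Lemma ipDle f g : L2 mu setT f -> L2 mu setT g ->
  ip (fun x => f x + g x) (fun x => f x + g x) <= 2 * ip f f + 2 * ip g g.
Proof.
move=> Lf Lg; have := ip_ge0 (fun x => f x - g x).
have LB := L2B Lf Lg; have LD := L2D Lf Lg.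
by rewrite ipBl ?ipBr// ipDl ?ipDr//; lra.
Qed.

Lemma ip_sqr f : ip f f = \int[mu]_x (f x ^+ 2).
Proof. by rewrite /ip; under eq_Rintegral do rewrite -expr2. Qed.

Lemma ip_ae f g h : L2 mu setT f -> L2 mu setT g -> L2 mu setT h ->
  ae_eq mu setT f g -> ip f h = ip g h.
Proof.
move=> [mf _] [mg _] [mh _] fg; congr fine; apply: ae_eq_integral => //.
- by apply/measurable_EFinP/measurable_funM.
- by apply/measurable_EFinP/measurable_funM.
- by apply: filterS fg => x /= /(_ I) -> _.
Qed.

Lemma ip_eq0 f : L2 mu setT f -> ip f f = 0 -> ae_eq mu setT f (fun=> 0).
Proof.
move=> Lf; have iff := L2_mul Lf Lf; move=> ff0.
have : ae_eq mu setT (EFin \o (fun x => f x * f x)) (cst 0%E).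
  apply/(ae_eq_integral_abs mu measurableT); first exact: measurable_int iff.
  rewrite (_ : integral _ _ _ = (ip f f)%:E); first by rewrite ff0.
  rewrite /ip /Rintegral fineK ?(integrable_fin_num measurableT iff)//.
  by apply: eq_integral => x _; rewrite /= -expr2 ger0_norm// sqr_ge0.
by apply: filterS => x /= /(_ I) [/eqP]; rewrite mulf_eq0 orbb => /eqP ->.
Qed.

Lemma Rintegral_dominated (F : nat -> X -> R) f g :
  (forall n, measurable_fun setT (F n)) ->
  (forall x, F n x @[n --> \oo] --> f x) -> mu.-integrable setT (EFin \o g) ->
  (forall n x, `|F n x| <= g x) ->
  \int[mu]_x F n x @[n --> \oo] --> \int[mu]_x f x.
Proof.
move=> mF Ff ig Fg.
have mf : measurable_fun setT f by apply: (measurable_fun_cvg mF) => x _; exact: Ff.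
have iF n : mu.-integrable setT (EFin \o F n) by apply: (integrable_le _ ig).
have fg x : `|f x| <= g x.
  apply: (cvgr_to_le (cvg_norm (Ff x))).
  by apply: nearW => n; exact: Fg.
have iff : mu.-integrable setT (EFin \o f) by apply: (integrable_le _ ig).
have mFE n : measurable_fun setT (EFin \o F n) by exact/measurable_EFinP.
have FfE x : setT x -> (EFin \o F ^~ x) n @[n --> \oo] --> (f x)%:E.
  by move=> _; apply: cvg_EFin; [exact: nearW|exact: Ff].
have FgE n x : setT x -> (`|(EFin \o F n) x| <= (EFin \o g) x)%E.
  by move=> _; rewrite lee_fin.
have gf x : setT x -> (EFin \o g) x \is a fin_num by [].
have := dominated_cvg measurableT mFE FfE gf ig FgE.
rewrite -[X in _ --> X]fineK; last exact: (integrable_fin_num measurableT iff).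
exact: fine_cvg.
Qed.

Lemma ip_dominated (F : nat -> X -> R) f g :
  (forall n, measurable_fun setT (F n)) ->
  (forall x, F n x @[n --> \oo] --> f x) -> L2 mu setT g ->
  (forall n x, `|F n x| <= g x) ->
  ip (fun x => F n x - f x) (fun x => F n x - f x) @[n --> \oo] --> 0.
Proof.
move=> mF Ff Lg Fg.
have mf : measurable_fun setT f by apply: (measurable_fun_cvg mF) => x _; exact: Ff.
have fg x : `|f x| <= g x.
  apply: (cvgr_to_le (cvg_norm (Ff x))).
  by apply: nearW => n; exact: Fg.
rewrite -(ip0l (fun=> 0)); apply: (@Rintegral_dominated _ _ (fun x => (2 * g x) * (2 * g x))).
- by move=> n; apply: measurable_funM; exact: measurable_funB.
- move=> x; rewrite -(subrr (f x)).
  by apply: cvgM; apply: cvgB => //; exact: cvg_cst.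
- by apply: L2_mul; exact: L2Z.
- move=> n x; rewrite normrM; have h : `|F n x - f x| <= 2 * g x.
    by rewrite (le_trans (ler_normB _ _))// mulr2n mulrDl mul1r lerD.
  by apply: ler_pM.
Qed.

End square_integrable.

(** * Open sets of space-time are measurable *)

Section borel_rV.
Context {R : realType}.

Lemma mx_ball_rV n (x y : 'rV[R]_n) e : 0 < e ->
  ball x e y <-> forall i, `|x ord0 i - y ord0 i| < e.
Proof.
move=> e0; split => [[_ h] i|h]; first exact: h.
by split => // i j; rewrite ord1; exact: h.
Qed.

Lemma measurable_ball_rV n (x : 'rV[R]_n) e : 0 < e ->
  measurable (ball x e).
Proof.
move=> e0.
rewrite (_ : ball x e = \big[setI/setT]_(i < n)
  ((fun y : 'rV[R]_n => y ord0 i) @^-1` (ball (x ord0 i) e))); last first.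
  apply/seteqP; split => y.
    by move=> /(mx_ball_rV _ _ e0) h; rewrite -bigcap_seq => i _; exact: h.
  by rewrite -bigcap_seq => h; apply/(mx_ball_rV _ _ e0) => i; apply: h; rewrite /= mem_index_enum.
apply: bigsetI_measurable => i _; rewrite -[X in measurable X]setTI.
by apply: measurable_coord => //; exact: measurable_ball.
Qed.

Variable m : nat.
Local Notation V := ('rV[R]_m * R)%type.
(* [vol] is a measure on this copy of [V]: it has the same measurable sets but
   not the same display. *)
Local Notation Vm := ('rV[R]_m * measurableTypeR R)%type.

Lemma measurable_ball_prod (z : V) e : 0 < e -> measurable (ball z e).
Proof.
move=> e0.
rewrite (_ : ball z e = ball z.1 e `*` ball z.2 e).
  by apply: measurableX; [exact: measurable_ball_rV|exact: measurable_ball].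
by [].
Qed.

(** Balls with rational centre and radius $1/(n+1)$ form a countable base; the index packs the
    spatial centre, the time and $n$. *)
Definition rational_center (k : 'rV[rat]_m * rat * nat) : V :=
  (map_mx (@ratr R) k.1.1, ratr k.1.2).

Definition rational_radius (k : 'rV[rat]_m * rat * nat) : R := k.2.+1%:R^-1.

Lemma rational_radius_gt0 k : 0 < rational_radius k.
Proof. by rewrite invr_gt0. Qed.

(** Asking that the ball of twice the radius stay in [A] leaves a margin: the closure of the small
    ball is then compact inside [A], as [C01_dense] needs. *)
Lemma rational_ball_cover (A : set V) z : open A -> A z ->
  exists k, ball (rational_center k) (rational_radius k) z /\
            ball (rational_center k) (2 * rational_radius k) `<=` A.
Proof.
move=> oA Az; have /nbhs_ballP[r /= r0 rA] : nbhs z A by exact: open_nbhs_nbhs.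
have [n n_r] : exists n, n.+1%:R^-1 < r / 3.
  have r20 : 0 < r / 3 by rewrite divr_gt0.
  have [N _ /(_ N (leqnn N)) NP] := near_infty_natSinv_lt (PosNum r20).
  by exists N.
have n0 : 0 < n.+1%:R^-1 :> R by rewrite invr_gt0.
have ratP (x : R) : exists q : rat, `|ratr q - x| < n.+1%:R^-1.
  have [|q] := @rat_in_itvoo _ (x - n.+1%:R^-1) (x + n.+1%:R^-1).
    by rewrite ltrBlDr -addrA ltrDl addr_gt0.
  rewrite in_itv/= => /andP[h1 h2]; exists q.
  by rewrite ltr_norml ltrBrDr addrC h1/= ltrBlDr addrC.
pose q x := sval (cid (ratP x)).
have qP x : `|ratr (q x) - x| < n.+1%:R^-1 by rewrite /q; case: cid.
pose k := ((\row_i q (z.1 ord0 i), q z.2), n).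
have cz : ball (rational_center k) n.+1%:R^-1 z.
  split; last by rewrite /= /ball/=; exact: qP.
  by apply/(mx_ball_rV _ _ n0) => i; rewrite /= !mxE; exact: qP.
exists k; split => // y cy; apply: rA.
have -> : r = r / 3 + 2 * (r / 3) by field.
apply: (@ball_triangle _ _ (rational_center k)).
  by apply/ball_sym; apply: le_ball cz; exact: ltW.
by apply: le_ball cy; rewrite ler_pM2l// ltW.
Qed.

Lemma open_measurable_prod (A : set V) : open A -> measurable (A : set Vm).
Proof.
move=> oA; suff mA : measurable A by exact: mA.
pose F k := if `[< ball (rational_center k) (2 * rational_radius k) `<=` A >]
            then ball (rational_center k) (rational_radius k) else set0.
suff -> : A = \bigcup_k F k.
  apply: countable_bigcupT_measurable; first exact: countableP.
  move=> k; rewrite /F; case: ifPn => // _.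
  by apply: measurable_ball_prod; exact: rational_radius_gt0.
apply/seteqP; split; last first.
  move=> z [k _]; rewrite /F; case: ifPn => // /asboolP kA kz; apply: kA.
  by apply: le_ball kz; rewrite ler_peMl ?ler1n// ltW// rational_radius_gt0.
move=> z Az; have [k [kz kA]] := rational_ball_cover oA Az.
by exists k => //; rewrite /F asboolT.
Qed.

(** [A] is the section at time 0 of the open cylinder above it. *)
Lemma open_measurable_rV (A : set 'rV[R]_m) : open A -> measurable A.
Proof.
move=> oA; have oA' : open ((fst : V -> _) @^-1` A).
  by apply: open_comp => // z _; exact: cvg_fst.
have := measurable_ysection (0 : R) (open_measurable_prod oA').
congr measurable; apply/seteqP; split => x; rewrite /ysection/= inE//.
Qed.

Lemma continuous_measurable_prod (f : V -> R) : continuous f ->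
  measurable_fun (setT : set Vm) f.
Proof.
move=> cf; apply: (measurability _ (RGenOpens.measurableE R)) => _ [_ [a [b ->]] <-].
rewrite setTI; apply: open_measurable_prod; exact: open_comp.
Qed.

Lemma continuous_measurable_rV (f : 'rV[R]_m -> R) : continuous f ->
  measurable_fun setT f.
Proof.
move=> cf; apply: (measurability _ (RGenOpens.measurableE R)) => _ [_ [a [b ->]] <-].
rewrite setTI; apply: open_measurable_rV; exact: open_comp.
Qed.

End borel_rV.

(** * Measure-preserving maps and translation invariance of the volume *)

Section measure_preserving.
Context {d : measure_display} {X : measurableType d} {R : realType}.
Variables (mu : {measure set X -> \bar R}) (s : X -> X).
Hypotheses (ms : measurable_fun setT s)
  (mus : forall A, measurable A -> mu (s @^-1` A) = mu A).
Local Open Scope ereal_scope.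

Lemma ge0_integral_preserving (f : X -> \bar R) : measurable_fun setT f ->
  (forall x, 0 <= f x) -> \int[mu]_x f (s x) = \int[mu]_x f x.
Proof.
move=> mf f0.
have := @ge0_integral_pushforward _ _ _ _ _ _ ms mu setT f measurableT mf.
rewrite preimage_setT => <-; last by move=> z _.
by apply: eq_measure_integral => A mA _; rewrite -(mus mA).
Qed.

Lemma integrable_preserving (f : X -> R) : mu.-integrable setT (EFin \o f) ->
  mu.-integrable setT (EFin \o (f \o s)).
Proof.
move=> /integrableP[mf intf]; apply/integrableP; split.
  exact: (measurableT_comp mf ms).
rewrite (ge0_integral_preserving (f := fun x => `|(f x)%:E|))//.
exact: measurableT_comp.
Qed.

Lemma Rintegral_preserving (f : X -> R) : mu.-integrable setT (EFin \o f) ->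
  (\int[mu]_x f (s x) = \int[mu]_x f x)%R.
Proof.
move=> intf; congr fine; have mf := measurable_int _ intf.
have := @integral_pushforward _ _ _ _ _ _ ms mu setT _ mf.
rewrite preimage_setT => /(_ (integrable_preserving intf) measurableT) <-.
by apply: eq_measure_integral => A mA _; rewrite -(mus mA).
Qed.

End measure_preserving.

Section translation.
Context {R : realType}.
Local Open Scope ereal_scope.

Lemma lebesgue_measure_shift (a : R) (A : set (measurableTypeR R)) :
  measurable A -> lebesgue_measure ((fun x : R => x + a)%R @^-1` A) =
                  lebesgue_measure A.
Proof.
move=> mA; pose s (x : measurableTypeR R) : measurableTypeR R := (x + a)%R.
have ms : measurable_fun setT s by exact: measurable_funD.
rewrite [RHS](@lebesgue_measure_unique _ (pushforward lebesgue_measure s))//.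
move=> _ [[x y] /= xy <-]; rewrite /pushforward.
rewrite (_ : _ @^-1` _ = `](x - a)%R, (y - a)%R]%classic); last first.
  by apply/seteqP; split => z /=; rewrite !in_itv/= ltrBlDr lerBrDr.
by rewrite !lebesgue_measure_itv/= !lte_fin ltrD2r -!EFinB opprB addrA subrK.
Qed.

Lemma measurable_shift_rV n (a : 'rV[R]_n) :
  measurable_fun setT (fun x : 'rV[R]_n => x + a)%R.
Proof.
apply: measurable_fun_coordP => i.
apply: (eq_measurable_fun (fun x : 'rV[R]_n => x ord0 i + a ord0 i)%R).
  by move=> x _; rewrite /= mxE.
by apply: measurable_funD => //; exact: measurable_coord.
Qed.

(** Induction on the dimension: seen through [cons_rV] the shift acts on the two factors separately,
    and a product measure is determined by its values on rectangles. *)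
Lemma lebesgue_rV_shift n (a : 'rV[R]_n) (A : set 'rV[R]_n) :
  measurable A -> lebesgue_rV n ((fun x => x + a)%R @^-1` A) = lebesgue_rV n A.
Proof.
elim: n a A => [|n ih] a A mA.
  congr (lebesgue_rV 0 _); apply/seteqP; split => x /=.
    by rewrite (_ : x + a = x)%R//; apply/rowP => -[].
  by rewrite (_ : x + a = x)%R//; apply/rowP => -[].
rewrite /= /cons_measure /pushforward.
pose a' := uncons_rV a.
pose s (z : measurableTypeR R * 'rV[R]_n) : measurableTypeR R * 'rV[R]_n :=
  (z.1 + a'.1, z.2 + a'.2)%R.
have ms : measurable_fun setT s.
  apply: measurable_fun_pair.
    by apply: measurable_funD => //; exact: measurable_fst.
  exact: (measurableT_comp (measurable_shift_rV a'.2) measurable_snd).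
have mcA : measurable (@cons_rV R n @^-1` A).
  by rewrite -[X in measurable X]setTI; exact: measurable_cons_rV.
transitivity (pushforward (@lebesgue_measure R \x lebesgue_rV n) s
   (@cons_rV R n @^-1` A)).
  rewrite /pushforward; congr (_ _); apply/seteqP; split => z /=; congr (A _);
    apply/rowP => i; rewrite !mxE; case: unliftP => [j|] -> /=;
    by rewrite ?mxE.
apply/esym; apply: (product_measure_unique
  (m' := pushforward (@lebesgue_measure R \x lebesgue_rV n) s)) => // B C mB mC.
rewrite /= /pushforward (_ : _ @^-1` _ =
   (fun x : R => x + a'.1)%R @^-1` B `*` (fun x => x + a'.2)%R @^-1` C)//.
rewrite product_measure1E//.
- by congr mule; [exact: lebesgue_measure_shift|exact: ih].
- rewrite -[X in measurable X]setTI.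
  by apply: (@measurable_funD _ _ _ _ (id : R -> R) (cst a'.1)).
- by rewrite -[X in measurable X]setTI; exact: measurable_shift_rV.
Qed.

Variable m : nat.
Local Notation V := ('rV[R]_m * R)%type.
Local Notation Vm := ('rV[R]_m * measurableTypeR R)%type.
Local Notation vol := (@vol R m).

Definition translate (a : V) (z : V) : V := (z + a)%R.

Lemma measurable_translate (a : V) :
  measurable_fun (setT : set Vm) (translate a : Vm -> Vm).
Proof.
apply: measurable_fun_pair => /=.
  exact: (measurableT_comp (measurable_shift_rV a.1) measurable_fst).
by apply: measurable_funD => //; exact: measurable_snd.
Qed.

Lemma vol_translate (a : V) (A : set Vm) :
  measurable A -> vol (translate a @^-1` A) = vol A.
Proof.
move=> mA; apply/esym; have ms := measurable_translate a.
have H (B : set 'rV[R]_m) (C : set (measurableTypeR R)) :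
    measurable B -> measurable C ->
    pushforward vol (translate a : Vm -> Vm) (B `*` C) =
    lebesgue_rV m B * @lebesgue_measure R C.
  move=> mB mC; rewrite /pushforward (_ : _ @^-1` _ =
     (fun x => x + a.1)%R @^-1` B `*` (fun x : R => x + a.2)%R @^-1` C)//.
  rewrite /= product_measure1E//.
  - by congr mule; [exact: lebesgue_rV_shift|exact: lebesgue_measure_shift].
  - by rewrite -[X in measurable X]setTI; exact: measurable_shift_rV.
  - rewrite -[X in measurable X]setTI.
    by apply: (@measurable_funD _ _ _ _ (id : R -> R) (cst a.2)).
exact: (@product_measure_unique _ _ _ _ _ (lebesgue_rV m) (@lebesgue_measure R)
  (pushforward vol (translate a : Vm -> Vm)) H A mA).
Qed.

Lemma integrable_translate (a : V) (f : V -> R) :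
  vol.-integrable setT (EFin \o f) ->
  vol.-integrable setT (EFin \o (f \o translate a)).
Proof.
exact: (@integrable_preserving _ Vm _ vol _ (measurable_translate a) (@vol_translate a)).
Qed.

Lemma Rintegral_translate (a : V) (f : V -> R) :
  vol.-integrable setT (EFin \o f) ->
  (\int[vol]_z f (translate a z) = \int[vol]_z f z)%R.
Proof.
exact: (@Rintegral_preserving _ Vm _ vol _ (measurable_translate a) (@vol_translate a)).
Qed.

Lemma integrable_shift (a : R) (f : R -> R) :
  (@lebesgue_measure R).-integrable setT (EFin \o f) ->
  (@lebesgue_measure R).-integrable setT (EFin \o (fun t => f (t + a)%R)).
Proof.
apply: (@integrable_preserving _ (measurableTypeR R) _ (@lebesgue_measure R)
  (fun t => t + a)%R); first exact: measurable_funD.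
exact: lebesgue_measure_shift.
Qed.

Lemma Rintegral_shift (a : R) (f : R -> R) :
  (@lebesgue_measure R).-integrable setT (EFin \o f) ->
  (\int[@lebesgue_measure R]_t f (t + a) = \int[@lebesgue_measure R]_t f t)%R.
Proof.
apply: (@Rintegral_preserving _ (measurableTypeR R) _ (@lebesgue_measure R)
  (fun t => t + a)%R); first exact: measurable_funD.
exact: lebesgue_measure_shift.
Qed.

End translation.

(** * Directional derivatives, and the vanishing of their integrals *)

Section lines.
Context {R : realType} {V : normedModType R}.
Implicit Types (f : V -> R) (z e : V).

Lemma is_derive_line f z e (s : R) : derivable f (z + s *: e) e ->
  is_derive s 1 (fun s : R => f (z + s *: e)) ('D_e f (z + s *: e)).
Proof.
have E (h : R) : (h^-1 *: (((fun s => f (z + s *: e)) \o shift s) (h *: 1) - f (z + s *: e)) =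
    h^-1 *: ((f \o shift (z + s *: e)) (h *: e) - f (z + s *: e)))%R.
  congr (_ *: (f _ - _)); rewrite /= scalerDl addrCA; congr (_ + _).
  by rewrite [h *: 1]mulr1.
rewrite /derive /derivable => df; split.
  by rewrite /derivable; under eq_fun do rewrite E.
by rewrite /derive; under eq_fun do rewrite E.
Qed.

Lemma line_lipschitz f z e (M : R) : (forall z, derivable f z e) ->
  (forall z, `|'D_e f z| <= M) ->
  forall h : R, 0 <= h -> `|f (z + h *: e) - f z| <= M * h.
Proof.
move=> df fM h; rewrite le_eqVlt => /predU1P[<-|h0].
  by rewrite scale0r addr0 subrr normr0 mulr0.
have dl (s : R) := is_derive_line (df (z + s *: e)).
have dM (x : R) : x \in `]0, h[%R ->
    is_derive x 1 (fun s => f (z + s *: e)) ('D_e f (z + x *: e)).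
  by move=> _; exact: dl.
have cM : {within `[0, h], continuous (fun s : R => f (z + s *: e))}.
  by apply: derivable_within_continuous => x _; case: (dl x).
have [c _] := @MVT R _ (fun s => 'D_e f (z + s *: e)) 0 h h0 dM cM.
rewrite subr0 scale0r addr0 => ->.
by rewrite normrM (ger0_norm (ltW h0)) ler_wpM2r// ltW.
Qed.

End lines.

Section volume_bounded.
Context {R : realType}.
Local Open Scope ereal_scope.

Lemma lebesgue_rV_ball n (r : R) : (0 < r)%R ->
  lebesgue_rV n (ball (0 : 'rV[R]_n)%R r) < +oo.
Proof.
move=> r0; elim: n => [|n ih]; first by rewrite /= diracE ltry.
rewrite /= /cons_measure /pushforward.
apply: (@le_lt_trans _ _ ((@lebesgue_measure R \x lebesgue_rV n)
    (ball (0 : R)%R r `*` ball (0 : 'rV[R]_n)%R r))).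
  apply: le_measure; rewrite ?inE.
  - rewrite -[X in measurable X]setTI; apply: measurable_cons_rV => //.
    exact: measurable_ball_rV.
  - by apply: measurableX; [exact: measurable_ball|exact: measurable_ball_rV].
  - move=> [x y] /= /(mx_ball_rV _ _ r0) h; split => /=.
      by have := h ord0; rewrite !mxE unlift_none.
    apply/(mx_ball_rV _ _ r0) => i.
    by have := h (lift ord0 i); rewrite !mxE liftK.
rewrite product_measure1E//=; last 2 first.
- exact: measurable_ball.
- exact: measurable_ball_rV.
rewrite [X in X * _]lebesgue_measure_ball ?ltW//; apply: lte_mul_pinfty => //.
by rewrite lee_fin mulrn_wge0// ltW.
Qed.

Lemma vol_ball m (r : R) : (0 < r)%R ->
  @vol R m (ball (0 : 'rV[R]_m * R)%R r) < +oo.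
Proof.
move=> r0; rewrite (_ : ball _ _ = ball (0 : 'rV[R]_m)%R r `*` ball (0 : R)%R r)//.
rewrite /= product_measure1E//=; last 2 first.
- exact: measurable_ball_rV.
- exact: measurable_ball.
apply: lte_mul_pinfty => //.
  by rewrite ge0_fin_numE//; exact: lebesgue_rV_ball.
by rewrite [ltLHS]lebesgue_measure_ball ?ltry// ltW.
Qed.

End volume_bounded.

Section integral_derive.
Context {R : realType} {m : nat}.
Local Notation V := ('rV[R]_m * R)%type.
Local Notation Vm := ('rV[R]_m * measurableTypeR R)%type.
Local Notation vol := (@vol R m).

Lemma integrable_bounded_support (f : V -> R) (M r : R) :
  measurable_fun (setT : set Vm) f ->
  (forall z, `|f z| <= M) -> (forall z, r <= `|z| -> f z = 0) ->
  vol.-integrable setT (EFin \o f).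
Proof.
move=> mf fM f0; pose r' := `|r| + 1.
have r'0 : 0 < r' by rewrite ltr_pwDr.
have mB : measurable (ball (0 : V) r' : set Vm).
  exact: open_measurable_prod (ball_open _ _).
apply: (@integrable_le _ Vm _ vol f (fun z => M * \1_(ball (0 : V) r') z)) => //.
  exact: integrable_cst_indic (vol_ball _ r'0).
move=> z; rewrite indicE; case: (boolP (z \in _)) => [_|]; first by rewrite mulr1.
rewrite mulr0 notin_setE /= => zB; rewrite f0 ?normr0//.
rewrite leNgt; apply/negP => zr; apply: zB.
rewrite -ball_normE /ball_/= sub0r normrN (lt_trans zr)//.
by rewrite (le_lt_trans (ler_norm r))// ltrDl.
Qed.

Variables (f : V -> R) (e : V) (M r : R).
Hypotheses (mf : measurable_fun (setT : set Vm) f) (fM : forall z, `|f z| <= M)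
  (f0 : forall z, r <= `|z| -> f z = 0) (df : forall z, derivable f z e)
  (dfM : forall z, `|'D_e f z| <= M).

Let h (n : nat) : R := n.+1%:R^-1.
Let q n (z : V) : R := (h n)^-1 * (f (translate (h n *: e) z) - f z).

Let q_cvg z : q ^~ z @ \oo --> 'D_e f z.
Proof.
have := @df z; rewrite /derivable => /cvg_ex[l hl].
have -> : 'D_e f z = l by exact: cvg_lim.
have hn : h @ \oo --> 0^'.
  move=> A [/= d d0 dA]; have [N _ HN] := near_infty_natSinv_lt (PosNum d0).
  exists N => // n Nn; apply: dA; last by rewrite /= invr_eq0.
  by rewrite /ball_/= /h sub0r normrN ger0_norm ?invr_ge0//; exact: HN.
rewrite (_ : q ^~ z =
    (fun h => h^-1 *: ((f \o shift z) (h *: e) - f z)) \o h); last first.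
  by apply/funext => n; rewrite /q /translate /= [z + _]addrC.
exact: cvg_comp hn hl.
Qed.

Let mq n : measurable_fun (setT : set Vm) (q n).
Proof.
apply: measurable_funM => //; apply: measurable_funB => //.
exact: (measurableT_comp mf (measurable_translate _)).
Qed.

Lemma measurable_derive : measurable_fun (setT : set Vm) ('D_e f).
Proof.
apply: (measurable_fun_cvg mq) => z _; exact: q_cvg.
Qed.


Let q_bounded n z : `|q n z| <= M.
Proof.
have h0 : 0 < h n by rewrite invr_gt0.
rewrite /q normrM normfV (gtr0_norm h0) mulrC ler_pdivrMr//.
by apply: line_lipschitz => //; exact: ltW.
Qed.

(** The steps [h n] are at most 1, so a shift enlarges the support by at most the norm of [e]. *)
Let q_support n z : r + `|e| <= `|z| -> q n z = 0.
Proof.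
move=> rz; rewrite /q /translate !f0 ?subrr ?mulr0//.
  by rewrite (le_trans _ rz)// lerDl.
have := ler_normD (z + h n *: e) (- (h n *: e)); rewrite addrK normrN normrZ.
rewrite ger0_norm ?invr_ge0// => h1.
have h2 : h n * `|e| <= `|e|.
  by rewrite ler_piMl// invf_le1// ler1n.
lra.
Qed.

Lemma derive_support z : r + `|e| <= `|z| -> 'D_e f z = 0.
Proof.
move=> rz; have qz := @q_cvg z.
have q0 : q ^~ z @ \oo --> 0.
  by under eq_fun do rewrite q_support//; exact: cvg_cst.
exact: (cvg_unique _ qz q0).
Qed.

Lemma integrable_derive : vol.-integrable setT (EFin \o 'D_e f).
Proof.
exact: (integrable_bounded_support measurable_derive dfM derive_support).
Qed.

(** The difference quotients integrate to 0 by translation invariance and are bounded by [M] through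
    the mean value theorem, so dominated convergence applies. Only a bounded derivative in the one
    direction [e] is needed; this allows products with the velocity, of which no differentiability
    in time is known. *)
Lemma Rintegral_derive : \int[vol]_z 'D_e f z = 0.
Proof.
have M0 : 0 <= M by rewrite (le_trans _ (fM 0)).
have intf := integrable_bounded_support mf fM f0.
have q0 n : \int[vol]_z q n z = 0.
  have intft := integrable_translate (h n *: e) intf.
  have intB : vol.-integrable setT
      (EFin \o (fun z : V => f (translate (h n *: e) z) - f z)).
    exact: (integrableB measurableT intft intf).
  by rewrite RintegralZl// RintegralB// Rintegral_translate// subrr mulr0.
pose G (z : V) := M * \1_(ball (0 : V) (`|r + `|e| | + 1)) z.
have r'0 : 0 < `|r + `|e| | + 1 by rewrite ltr_pwDr.
have iG : vol.-integrable setT (EFin \o G).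
  apply: integrable_cst_indic; last exact: vol_ball.
  exact: open_measurable_prod (ball_open _ _).
have qG n (z : V) : setT z -> (`|(q n z)%:E| <= (G z)%:E)%E.
  move=> _; rewrite lee_fin /G indicE; case: (boolP (z \in _)) => [_|].
    by rewrite mulr1.
  rewrite mulr0 notin_setE /= => zB; rewrite q_support ?normr0//.
  rewrite leNgt; apply/negP => zr; apply: zB.
  rewrite -ball_normE /ball_/= sub0r normrN (lt_trans zr)//.
  by rewrite (le_lt_trans (ler_norm _))// ltrDl.
have mqE n : measurable_fun (setT : set Vm) (EFin \o q n).
  exact/measurable_EFinP.
have qE (z : V) : setT z -> (EFin \o q^~ z) n @[n --> \oo] --> ('D_e f z)%:E.
  by move=> _; apply: cvg_EFin; [exact: nearW|exact: q_cvg].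
have := @dominated_cvg _ _ _ vol setT measurableT _ _ _ mqE qE _ iG qG.
move=> /(_ (fun _ _ => erefl)).
have -> : (fun n => \int[vol]_(z in setT) (EFin \o q n) z)%E = cst 0%E.
  apply/funext => n; have iq := integrable_bounded_support (mq n) (q_bounded n) (@q_support n).
  rewrite -[LHS]fineK; first by have := q0 n; rewrite /Rintegral /= => ->.
  exact: integrable_fin_num.
by move=> /(cvg_unique _ (@cvg_cst _ _ _ _ _)) H; rewrite /Rintegral -H.
Qed.

End integral_derive.

(** * Calculus of $C^1$ functions, with explicit examples *)

Section C1_functions.
Context {R : realType}.

Section normed_domain.
Context {V : normedModType R}.
Implicit Types f g : V -> R.

Lemma class_C1P f : (forall x, differentiable f x) ->
  (forall e, continuous (fun x => 'D_e f x)) -> class_C 1 setT f.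
Proof. by move=> df cf; split => [x _|e x _]; [exact: df|exact: cf]. Qed.

Lemma C1_diff f : class_C 1 setT f -> forall x, differentiable f x.
Proof. by move=> [df _] x; exact: df. Qed.

Lemma C1_derivable f : class_C 1 setT f -> forall x e, derivable f x e.
Proof. by move=> C1f x e; exact/diff_derivable/C1_diff. Qed.

Lemma C1_continuous_derive f e : class_C 1 setT f ->
  continuous (fun x => 'D_e f x).
Proof. by move=> [_ cf] x; exact: cf. Qed.

Lemma C1_continuous f : class_C 1 setT f -> continuous f.
Proof. by move=> C1f x; exact/differentiable_continuous/C1_diff. Qed.

Lemma C1_cst c : class_C 1 setT (fun _ : V => c : R).
Proof.
apply: class_C1P => [x|e]; first exact: differentiable_cst.
under eq_fun do rewrite derive_cst; exact: cst_continuous.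
Qed.

Lemma C1D f g : class_C 1 setT f -> class_C 1 setT g ->
  class_C 1 setT (fun x => f x + g x).
Proof.
move=> Cf Cg; apply: class_C1P => [x|e]; first by apply: differentiableD; exact: C1_diff.
have -> : (fun x => 'D_e (fun x => f x + g x) x) = 'D_e f \+ 'D_e g.
  by apply/funext => x; rewrite deriveD//; exact: C1_derivable.
by move=> x; apply: continuousD; exact: C1_continuous_derive.
Qed.

Lemma C1M f g : class_C 1 setT f -> class_C 1 setT g ->
  class_C 1 setT (fun x => f x * g x).
Proof.
move=> Cf Cg; apply: class_C1P => [x|e]; first by apply: differentiableM; exact: C1_diff.
have -> : (fun x => 'D_e (fun x => f x * g x) x) =
    (f \* 'D_e g) \+ (g \* 'D_e f).
  by apply/funext => x; rewrite deriveM//; exact: C1_derivable.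
move=> x; apply: continuousD; apply: continuousM.
- exact: (C1_continuous Cf).
- exact: (C1_continuous_derive Cg).
- exact: (C1_continuous Cg).
- exact: (C1_continuous_derive Cf).
Qed.

End normed_domain.

Section composition.
Context {V : normedModType R}.
Implicit Types f : V -> R.

Lemma C1_derive_comp (g : R -> R) f e x : class_C 1 setT g -> class_C 1 setT f ->
  'D_e (g \o f) x = 'D_1 g (f x) * 'D_e f x.
Proof.
move=> Cg Cf; have dg := C1_diff Cg (f x); have df := C1_diff Cf x.
have dg1 : derivable g (f x) 1 by exact/derivable1_diffP.
rewrite (deriveE e (differentiable_comp df dg)) (diff_comp df dg) /=.
by rewrite (deriveE e df) (deriv1E dg1) derive1E mulrC.
Qed.

Lemma C1_comp (g : R -> R) f : class_C 1 setT g -> class_C 1 setT f ->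
  class_C 1 setT (g \o f).
Proof.
move=> Cg Cf; apply: class_C1P => [x|e].
  by apply: differentiable_comp; exact: C1_diff.
have -> : (fun x => 'D_e (g \o f) x) = ('D_1 g \o f) \* 'D_e f.
  by apply/funext => x; rewrite C1_derive_comp.
move=> x; apply: continuousM; last exact: (C1_continuous_derive Cf).
apply: continuous_comp; first exact: (C1_continuous Cf).
exact: (C1_continuous_derive Cg).
Qed.

End composition.

(** A quadratic bound on the remainder replaces the limit, so that functions defined by cases are
    handled by plain inequalities. *)
Lemma is_derive_quadratic (f : R -> R) x l :
  (forall h, `|f (x + h) - f x - l * h| <= h ^+ 2) -> is_derive x 1 f l.
Proof.
move=> fl; have H : h^-1 *: ((f \o shift x) (h *: 1) - f x) @[h --> 0^'] --> l.
  apply/cvgrPdist_lt => e e0; exists e => // h; rewrite /ball_/= sub0r normrN => he h0.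
  rewrite [h *: 1]mulr1 [_ *: _]mulrC [h + x]addrC.
  have h00 : 0 < `|h| by rewrite normr_gt0.
  rewrite -(ltr_pM2r h00) -normrM mulrBl mulfVK// distrC.
  rewrite (le_lt_trans (fl h))// -(real_normK (num_real h)) expr2.
  by rewrite ltr_pM2r.
by split; [apply/cvg_ex; exists l|exact: cvg_lim].
Qed.

End C1_functions.

Section C1_examples.
Context {R : realType}.

Lemma C1_linear {V : normedModType R} (f : V -> R) :
  (forall a u v, f (a *: u + v) = a * f u + f v) -> continuous f ->
  class_C 1 setT f /\ forall e x, 'D_e f x = f e.
Proof.
move=> fl cf; have lf : linear f by move=> a u v; rewrite fl.
pose isl := GRing.isLinear.Build _ _ _ _ f lf.
pose L : {linear V -> R} := HB.pack f isl.
have df x : differentiable f x by apply: (@linear_differentiable _ _ _ L).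
have Df e x : 'D_e f x = f e.
  by rewrite deriveE// (_ : 'd f x = f :> (_ -> _))//; exact: (@diff_lin _ _ _ L).
split => //; apply: class_C1P => // e; under eq_fun do rewrite Df.
exact: cst_continuous.
Qed.

Lemma C1_id : class_C 1 setT (@id R).
Proof. by have [] := @C1_linear R^o id (fun _ _ _ => erefl) (fun x => cvg_id). Qed.

Lemma C1_coord m (i : 'I_m) :
  class_C 1 setT (fun z : 'rV[R]_m * R => z.1 ord0 i) /\
  forall e x, 'D_e (fun z : 'rV[R]_m * R => z.1 ord0 i) x = e.1 ord0 i.
Proof.
apply: (@C1_linear _ (fun z : 'rV[R]_m * R => z.1 ord0 i)).
  by move=> a u v; rewrite /= !mxE.
move=> z; apply: (@continuous_comp _ _ _ fst (fun x : 'rV[R]_m => x ord0 i)).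
  exact: cvg_fst.
exact: coord_continuous.
Qed.

Lemma C1_time m :
  class_C 1 setT (fun z : 'rV[R]_m * R => z.2) /\
  forall e x, 'D_e (fun z : 'rV[R]_m * R => z.2) x = e.2.
Proof.
by apply: (@C1_linear _ (fun z : 'rV[R]_m * R => z.2)) => // z; exact: cvg_snd.
Qed.

(** A $C^1$ function positive exactly on the positive half-line; all cut-offs and bumps are built
    from it. *)
Definition sqp (x : R) : R := Num.max 0 x ^+ 2.

Lemma sqp_ge0 x : 0 <= sqp x. Proof. exact: sqr_ge0. Qed.

Lemma sqp_npos x : x <= 0 -> sqp x = 0.
Proof. by move=> x0; rewrite /sqp max_l// expr0n. Qed.

Lemma sqp_gt0 x : 0 < x -> 0 < sqp x.
Proof. by move=> x0; rewrite /sqp max_r ?exprn_gt0// ltW. Qed.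

Lemma is_derive_sqp (x : R) : is_derive x 1 sqp (2 * Num.max 0 x).
Proof.
apply: is_derive_quadratic => h; rewrite /sqp.
have ha := real_normK (num_real h); rewrite ler_norml.
case: (leP 0 x) => ?; case: (leP 0 (x + h)) => ?; nra.
Qed.

Lemma C1_sqp : class_C 1 setT sqp.
Proof.
have ds x : differentiable sqp x.
  by apply/derivable1_diffP; case: (is_derive_sqp x).
apply: class_C1P => // e.
have -> : (fun x => 'D_e sqp x) = (fun x => e * (2 * Num.max 0 x)).
  apply/funext => x; have [dsx dE] := is_derive_sqp x.
  by rewrite deriveE// deriv1E// derive1E dE.
have -> : (fun x => e * (2 * Num.max 0 x)) = (cst (e * 2)) \* (cst 0 \max id).
  by apply/funext => x /=; rewrite mulrA.
move=> x; apply: continuousM; first exact: cst_continuous.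
by apply: continuous_max; [exact: cst_continuous|exact: cvg_id].
Qed.

(* A C^1 step: 0 on ]-oo, 1] and 1 on [2, +oo[. *)
Definition step (x : R) : R := 1 + (-1) * sqp (1 + (-1) * sqp (x + -1)).

Lemma C1_step : class_C 1 setT step.
Proof.
apply: C1D; first exact: C1_cst.
apply: C1M; first exact: C1_cst.
apply: (@C1_comp R R^o); first exact: C1_sqp.
apply: C1D; first exact: C1_cst.
apply: C1M; first exact: C1_cst.
apply: (@C1_comp R R^o); first exact: C1_sqp.
by apply: C1D; [exact: C1_id|exact: C1_cst].
Qed.

Lemma step0 x : x <= 1 -> step x = 0.
Proof.
move=> x1; rewrite /step (sqp_npos (x := x + -1)) ?subr_le0// mulr0 addr0.
by rewrite /sqp max_r// expr1n mulr1 subrr.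
Qed.

Lemma step1 x : 2 <= x -> step x = 1.
Proof.
move=> x2; rewrite /step (sqp_npos (x := 1 + _)) ?mulr0 ?addr0//.
by rewrite mulN1r subr_le0 /sqp max_r; nra.
Qed.

Lemma step_ge0 x : 0 <= step x <= 1.
Proof.
rewrite /step; have h := sqp_ge0 (x + -1).
have := sqp_ge0 (1 + (-1) * sqp (x + -1)).
have : sqp (1 + (-1) * sqp (x + -1)) <= 1 by rewrite /sqp; case: (leP 0 _); nra.
lra.
Qed.

End C1_examples.

(** * Compactly supported $C^1$ functions *)

Section compact_support.
Context {R : realType} {V : normedModType R}.
Implicit Types (f g : V -> R) (K D : set V).

Lemma compact_support_bounded g K : compact K -> continuous g ->
  (forall z, ~ K z -> g z = 0) -> exists M, 0 <= M /\ forall z, `|g z| <= M.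
Proof.
move=> cK cg g0.
have cgK : compact (g @` K : set R^o).
  by apply: continuous_compact => //; exact: continuous_subspaceT.
have [M [_ hM]] := @compact_bounded R R^o _ cgK.
exists (`|M| + 1); split; first by rewrite addr_ge0.
move=> z; have [Kz|nKz] := pselect (K z); last by rewrite g0// normr0 addr_ge0.
apply: hM; first by rewrite ltr_pwDr// ler_norm.
by exists z.
Qed.

Lemma compact_support_radius g K : compact K ->
  (forall z, ~ K z -> g z = 0) -> exists r, forall z, r <= `|z| -> g z = 0.
Proof.
move=> cK g0; have [M [_ hM]] := @compact_bounded R V _ cK.
exists (`|M| + 2) => z Mz; apply: g0 => Kz.
have := hM (`|M| + 1); rewrite ltr_pwDr// ?ler_norm// => /(_ isT z Kz) /= h.
by move: Mz; apply/negP; rewrite -ltNge (le_lt_trans h)// ltrD2l ltr1n.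
Qed.

Lemma derive_compact_support f K e : compact K ->
  (forall z, ~ K z -> f z = 0) -> forall z, ~ K z -> 'D_e f z = 0.
Proof.
move=> cK f0 z nKz; rewrite (@near_eq_derive _ _ _ f (cst 0)) ?derive_cst//.
have : open (~` K).
  by apply: closed_openC; apply: compact_closed => //; exact: norm_hausdorff.
rewrite openE => /(_ z nKz); apply: filterS => y; exact: f0.
Qed.

Lemma C01_C1 D f : C01 D f -> class_C 1 setT f.
Proof. by case. Qed.

Lemma C01_sub D D' f : D `<=` D' -> C01 D f -> C01 D' f.
Proof.
move=> DD' [Cf [K [cK KD] f0]]; split => //; exists K => //; split => //.
exact: subset_trans DD'.
Qed.

Lemma C01_off D f : C01 D f -> forall z, ~ D z -> f z = 0.
Proof. by move=> [_ [K [_ KD] f0]] z nDz; apply: f0 => /KD. Qed.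

Lemma C01_derive_off D f e : C01 D f -> forall z, ~ D z -> 'D_e f z = 0.
Proof.
move=> [_ [K [cK KD] f0]] z nDz.
by have := @derive_compact_support f K e cK f0 z; apply => /KD.
Qed.

Lemma C01_bounded D f : C01 D f -> exists M, 0 <= M /\ forall z, `|f z| <= M.
Proof.
move=> [Cf [K [cK KD] f0]]; apply: (compact_support_bounded cK _ f0).
exact: C1_continuous.
Qed.

Lemma C01_derive_bounded D f e : C01 D f ->
  exists M, 0 <= M /\ forall z, `|'D_e f z| <= M.
Proof.
move=> [Cf [K [cK KD] f0]].
apply: (compact_support_bounded cK _ (@derive_compact_support f K e cK f0)).
exact: C1_continuous_derive.
Qed.

Lemma C01_radius D f : C01 D f -> exists r, forall z, r <= `|z| -> f z = 0.
Proof. by move=> [_ [K [cK _] f0]]; exact: (compact_support_radius cK f0). Qed.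

Lemma C01D D f g : C01 D f -> C01 D g -> C01 D (fun z => f z + g z).
Proof.
move=> [Cf [K [cK KD] f0]] [Cg [L [cL LD] g0]]; split; first exact: C1D.
exists (K `|` L).
  split; first exact: compactU.
  by rewrite subUset.
by move=> z /not_orP[nK nL]; rewrite f0// g0// addr0.
Qed.

Lemma C01M D f g : class_C 1 setT g -> C01 D f -> C01 D (fun z => g z * f z).
Proof.
move=> Cg [Cf [K [cK KD] f0]]; split; first exact: C1M.
by exists K => // z nK; rewrite f0// mulr0.
Qed.

Lemma C01Z D c f : C01 D f -> C01 D (fun z => c * f z).
Proof. exact/C01M/C1_cst. Qed.

(** The product is supported in the compact set $K\cap F$. With [g] a time cut-off, this moves a
    support into [QT]. *)
Lemma C01_restrict D (F : set V) f g : closed F -> class_C 1 setT g ->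
  (forall z, ~ F z -> g z = 0) -> C01 D f -> C01 (D `&` F) (fun z => g z * f z).
Proof.
move=> cF Cg g0 [Cf [K [cK KD] f0]]; split; first exact: C1M.
exists (K `&` F).
  split; last exact: setSI.
  by apply: (subclosed_compact _ cK) => //; apply: closedI => //;
    apply: compact_closed => //; exact: norm_hausdorff.
move=> z /not_andP[nK|nF]; first by rewrite f0// mulr0.
by rewrite g0// mul0r.
Qed.

Lemma continuous_addr (a : V) : continuous (fun z : V => z + a).
Proof. by move=> z; apply: cvgD; [exact: cvg_id|exact: cvg_cst]. Qed.

Lemma derive_translate f a e z : 'D_e (fun z => f (z + a)) z = 'D_e f (z + a).
Proof.
by rewrite /derive /=; under eq_fun do rewrite -addrA.
Qed.

Lemma C1_translate f a : class_C 1 setT f -> class_C 1 setT (fun z => f (z + a)).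
Proof.
move=> Cf; apply: class_C1P => [x|e].
  have -> : (fun z => f (z + a)) = f \o (id + cst a) by [].
  apply: differentiable_comp; last exact: C1_diff.
  by apply: differentiableD => //.
under eq_fun do rewrite derive_translate.
move=> x; apply: (@continuous_comp _ _ _ (fun z => z + a) ('D_e f)).
  exact: continuous_addr.
exact: (C1_continuous_derive Cf).
Qed.

Lemma C01_translate D f a : C01 D f ->
  C01 [set z | D (z + a)] (fun z => f (z + a)).
Proof.
move=> [Cf [K [cK KD] f0]]; split; first exact: C1_translate.
exists ((fun z => z - a) @` K).
  split; last by move=> _ [z Kz <-] /=; rewrite subrK; exact: KD.
  apply: continuous_compact => //; apply: continuous_subspaceT.
  exact: continuous_addr.
move=> z nz; apply: f0 => Kz; apply: nz; exists (z + a) => //.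
by rewrite addrK.
Qed.

End compact_support.

Lemma step_derive_bounded {R : realType} :
  exists M, 0 <= M /\ forall x : R, `|'D_1 (@step R) x| <= M.
Proof.
apply: (@compact_support_bounded _ R^o _ `[1, 2]); first exact: segment_compact.
  exact: (C1_continuous_derive C1_step).
move=> z /=; rewrite in_itv/= => /negP; rewrite negb_and -!ltNge => /orP[z1|z2].
  rewrite (@near_eq_derive _ _ _ _ (cst 0)) ?derive_cst//.
  by near=> x; rewrite step0// ltW//; near: x; exact: lt_nbhsl.
rewrite (@near_eq_derive R R^o R^o step (cst 1)) ?derive_cst//.
by near=> x; rewrite step1// ltW//; near: x; exact: lt_nbhsr.
Unshelve. all: by end_near. Qed.

(** * Integration by parts and the Poincaré inequality for smooth functions *)

Section C01_integrals.
Context {R : realType} {m : nat}.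
Local Notation V := ('rV[R]_m * R)%type.
Local Notation Vm := ('rV[R]_m * measurableTypeR R)%type.
Local Notation vol := (@vol R m).
Local Notation ip := (ip vol).
Implicit Types (f g : V -> R) (D : set V).

Lemma bounded_support_L2 f (M r : R) : measurable_fun (setT : set Vm) f ->
  (forall z, `|f z| <= M) -> (forall z, r <= `|z| -> f z = 0) ->
  L2 vol setT f.
Proof.
move=> mf fM f0; split => //.
apply: (@integrable_bounded_support _ _ _ (M ^+ 2) r).
- exact: measurable_funX.
- by move=> z; rewrite normrX lerXn2r// nnegrE// (le_trans _ (fM z)).
- by move=> z rz; rewrite f0// expr0n.
Qed.

Lemma C01_L2 D f : C01 D f -> L2 vol setT f.
Proof.
move=> Cf; have [M [_ fM]] := C01_bounded Cf; have [r f0] := C01_radius Cf.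
apply: (bounded_support_L2 _ fM f0); apply: continuous_measurable_prod.
exact/C1_continuous/(C01_C1 Cf).
Qed.

Lemma C01_derive_L2 D f e : C01 D f -> L2 vol setT ('D_e f).
Proof.
move=> Cf; have [M [_ fM]] := C01_derive_bounded e Cf.
have [Cf1 [K [cK _] f0]] := Cf.
have [r fr] := compact_support_radius cK (@derive_compact_support _ _ f K e cK f0).
apply: (bounded_support_L2 _ fM fr); apply: continuous_measurable_prod.
exact: (C1_continuous_derive Cf1).
Qed.

Lemma C01_int_derive D f e : C01 D f -> \int[vol]_z 'D_e f z = 0.
Proof.
move=> Cf; have [M [M0 fM]] := C01_bounded Cf; have [r f0] := C01_radius Cf.
have [M' [M'0 fM']] := C01_derive_bounded e Cf.
apply: (@Rintegral_derive _ _ f e (M + M') r) => //.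
- by apply: continuous_measurable_prod; exact/C1_continuous/(C01_C1 Cf).
- by move=> z; rewrite (le_trans (fM z))// lerDl.
- by move=> z; exact/C1_derivable/(C01_C1 Cf).
- by move=> z; rewrite (le_trans (fM' z))// lerDr.
Qed.

Lemma C01_ibp D f g e : C01 D f -> C01 D g -> ip f ('D_e g) = - ip ('D_e f) g.
Proof.
move=> Cf Cg; apply/eqP; rewrite -addr_eq0; apply/eqP.
have Cfg := C01M (C01_C1 Cf) Cg; rewrite -(C01_int_derive e Cfg) /ip.
have Lf := C01_L2 Cf; have Lg := C01_L2 Cg.
have Ldf := C01_derive_L2 e Cf; have Ldg := C01_derive_L2 e Cg.
rewrite -RintegralD//; [|exact: L2_mul..].
apply: eq_Rintegral => z _; rewrite deriveM; last 2 first.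
- exact: (C1_derivable (C01_C1 Cf)).
- exact: (C1_derivable (C01_C1 Cg)).
by congr (_ + _); rewrite [RHS]mulrC.
Qed.

(* [int f^2 = int f^2 d_i x_i = - 2 int x_i f d_i f] *)
Lemma C01_poincare D f (i : 'I_m) (B : R) : (forall z, D z -> `|z.1 ord0 i| <= B) ->
  C01 D f ->
  ip f f <= 4 * B ^+ 2 * ip ('D_((unit_vec i, 0) : V) f) ('D_((unit_vec i, 0) : V) f).
Proof.
move=> DB Cf; set e := (_, 0); have [Cx Dx] := @C1_coord R m i.
pose x (z : V) : R := z.1 ord0 i.
have Cxf : C01 D (fun z => x z * f z) by exact: C01M.
have Lf := C01_L2 Cf; have Lxf := C01_L2 Cxf; have Ldf := C01_derive_L2 e Cf.
have Lxdf : L2 vol setT (fun z => x z * 'D_e f z).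
  have := C01_derive_L2 e Cxf => /L2B/(_ Lf); congr L2; apply/funext => z.
  rewrite deriveM; [|exact: (C1_derivable Cx)|exact: (C1_derivable (C01_C1 Cf))].
  rewrite Dx /e /= /unit_vec mxE !eqxx /=.
  by rewrite [f z *: _]mulr1 addrK.
have E : ip f f = - (2 * ip ('D_e f) (fun z => x z * f z)).
  have := C01_ibp e Cf Cxf.
  have -> : 'D_e (fun z => x z * f z) = (fun z => x z * 'D_e f z + f z).
    apply/funext => z.
    rewrite deriveM; [|exact: (C1_derivable Cx)|exact: (C1_derivable (C01_C1 Cf))].
    by rewrite Dx /e /= /unit_vec mxE !eqxx /= [f z *: _]mulr1.
  rewrite ipDr//; have -> : ip f (fun z => x z * 'D_e f z) =
      ip ('D_e f) (fun z => x z * f z).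
    by congr fine; apply: eq_integral => z _; congr EFin; ring.
  lra.
have cs := ip_cauchy_schwarz Ldf Lxf.
have xB : ip (fun z => x z * f z) (fun z => x z * f z) <= B ^+ 2 * ip f f.
  have := @ip_le_ip _ Vm _ vol (fun z => x z * f z) (fun z => B * f z)
     (L2_measurable Lxf) (L2Z B Lf).
  rewrite ipZl ?ipZr ?mulrA ?expr2//; last exact: L2Z.
  apply => z; have [Dz|nDz] := pselect (D z); last first.
    by rewrite (C01_off Cf nDz) !mulr0.
  by rewrite !normrM ler_wpM2r// (le_trans (DB _ Dz))// ler_norm.
have a0 := ip_ge0 vol ('D_e f); have f0 := ip_ge0 vol f.
set a := ip ('D_e f) ('D_e f) in cs a0 *.
set b := ip ('D_e f) _ in E cs; set c := ip _ _ in xB cs.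
set s := ip f f in E xB f0 *.
(* Since $s=-2b$, one has $s^2=4b^2\le4ac\le4B^2as$; it remains to divide by $s$. *)
have h : s ^+ 2 <= 4 * B ^+ 2 * a * s.
  have -> : s ^+ 2 = 4 * b ^+ 2 by rewrite E; ring.
  by have := ler_wpM2l a0 xB; lra.
move: f0; rewrite le_eqVlt => /predU1P[<-|s0].
  by rewrite mulr_ge0// mulr_ge0// sqr_ge0.
by move: h; rewrite expr2 ler_pM2r.
Qed.

End C01_integrals.

(** * The fundamental lemma of the calculus of variations *)

Section boxes.
Context {R : realType} {m : nat}.
Local Notation V := ('rV[R]_m * R)%type.
Local Notation Vm := ('rV[R]_m * measurableTypeR R)%type.
Local Notation vol := (@vol R m).
Local Notation ip := (ip vol).
Implicit Types (f g : V -> R) (D K : set V).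

Definition box (a b : V) : set V :=
  [set z : V | (forall i, a.1 ord0 i < z.1 ord0 i < b.1 ord0 i) /\ a.2 < z.2 < b.2].

Definition boxes : set (set V) := [set B | exists a b, B = box a b].

Lemma setI_boxes : setI_closed boxes.
Proof.
move=> _ _ [a [b ->]] [c [d ->]].
exists (\row_i Num.max (a.1 ord0 i) (c.1 ord0 i), Num.max a.2 c.2).
exists (\row_i Num.min (b.1 ord0 i) (d.1 ord0 i), Num.min b.2 d.2).
apply/seteqP; split => z; rewrite /box /= ?gt_max ?lt_min.
  move=> [[z1 /andP[z2 z3]] [z4 /andP[z5 z6]]]; split; last by rewrite z2 z3 z5 z6.
  move=> i; rewrite !mxE gt_max lt_min.
  by have /andP[-> ->] := z1 i; have /andP[-> ->] := z4 i.
move=> [z1 /andP[/andP[z2 z3] /andP[z4 z5]]].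
have z1' i := z1 i; split; split; rewrite ?z2 ?z3 ?z4 ?z5//.
- by move=> i; have := z1' i; rewrite !mxE gt_max lt_min => /andP[/andP[-> _]] /andP[->].
- by move=> i; have := z1' i; rewrite !mxE gt_max lt_min => /andP[/andP[_ ->]] /andP[_ ->].
Qed.

Lemma ball_box (c : V) r : 0 < r ->
  ball c r = box (\row_i (c.1 ord0 i - r), c.2 - r) (\row_i (c.1 ord0 i + r), c.2 + r).
Proof.
move=> r0; have E (x y : R) : (`|x - y| < r) = (x - r < y < x + r).
  by rewrite distrC ltr_distl.
apply/seteqP; split => z.
  move=> [/(mx_ball_rV _ _ r0) h1 h2]; split; last by rewrite -E.
  by move=> i; rewrite !mxE -E.
move=> [h1 h2]; split; last by rewrite /ball/= E.
by apply/(mx_ball_rV _ _ r0) => i; have := h1 i; rewrite !mxE E.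
Qed.

Lemma closed_ball_compact (c : V) r : exists2 K, compact K &
  ball c r `<=` K /\ K `<=` [set z : V | (forall i, `|c.1 ord0 i - z.1 ord0 i| <= r) /\
                                     `|c.2 - z.2| <= r].
Proof.
have [r0|r0] := ltP 0 r; last first.
  exists set0; first exact: compact0.
  split; last by move=> ?.
  by move=> z [] [h _]; move: h; rewrite ltNge r0.
pose A : set 'rV[R]_m := [set x | forall i, `[c.1 ord0 i - r, c.1 ord0 i + r]%classic (x ord0 i)].
have cA : compact A.
  apply: (@rV_compact R m (fun i => `[c.1 ord0 i - r, c.1 ord0 i + r]%classic)) => i.
  exact: segment_compact.
exists (A `*` `[c.2 - r, c.2 + r]).
  by apply: compact_setX => //; exact: segment_compact.
split => z.
  rewrite ball_box// => -[h1 /andP[/ltW h2 /ltW h3]]; split.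
    move=> i; have := h1 i; rewrite !mxE => /andP[/ltW h4 /ltW h5].
    by rewrite /= in_itv/= h4 h5.
  by rewrite /= in_itv/= h2 h3.
move=> [h1 h2]; split.
  by move=> i; have := h1 i; rewrite /= in_itv/= distrC ler_distl.
by move: h2; rewrite /= in_itv/= distrC ler_distl.
Qed.

Lemma norm_box (z : V) : exists k : nat, box (\row__ (- k%:R), - k%:R) (\row__ k%:R, k%:R) z.
Proof.
exists (Num.truncn `|z|).+1; set k : R := _%:R.
have zk : `|z| < k by exact: Num.Theory.truncnS_gt.
have k0 : 0 < k by rewrite ltr0n.
have : ball (0 : V) k z by rewrite -ball_normE /ball_ /= sub0r normrN.
rewrite ball_box// => -[h1 h2]; split; last by move: h2; rewrite /= sub0r add0r.
by move=> i; have := h1 i; rewrite !mxE sub0r add0r.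
Qed.

(** It suffices that each coordinate be measurable for the generated sigma-algebra. The preimage of
    an interval under one coordinate is a countable union of boxes, the others ranging over
    $(-k,k)$. *)
Lemma boxes_generate (A : set Vm) : measurable A -> (<<s boxes >>) A.
Proof.
move=> mA; pose T := g_sigma_algebraType boxes.
have mT (a b : V) : measurable (box a b : set T).
  by apply: sub_sigma_algebra; exists a; exists b.
have mtime : measurable_fun (setT : set T) (fun z : V => z.2 : R).
  apply: (measurability _ (RGenOpens.measurableE R)) => _ [_ [x [y ->]] <-].
  rewrite setTI (_ : _ @^-1` _ =
    \bigcup_k (box (\row__ (- k%:R), x) (\row__ k%:R, y) : set T)).
    by apply: bigcupT_measurable.
  apply/seteqP; split => z /=; rewrite in_itv/=.
    move=> zxy; have [k [zk _]] := norm_box z; exists k => //.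
  by move=> [k _ []].
have mcoord (i : 'I_m) : measurable_fun (setT : set T) (fun z : V => z.1 ord0 i : R).
  apply: (measurability _ (RGenOpens.measurableE R)) => _ [_ [x [y ->]] <-].
  rewrite setTI (_ : _ @^-1` _ = \bigcup_k
    (box (\row_j (if j == i then x else - k%:R), - k%:R)
         (\row_j (if j == i then y else k%:R), k%:R) : set T)).
    by apply: bigcupT_measurable.
  apply/seteqP; split => z /=; rewrite in_itv/=.
    move=> zxy; have [k [zk zt]] := norm_box z; exists k => //; split => // j.
    by have := zk j; rewrite !mxE; case: eqP => [->|].
  by move=> [k _ [/(_ i)]]; rewrite !mxE eqxx.
have mid : measurable_fun (setT : set T) (fun z : V => (z.1, z.2) : Vm).
  by apply: measurable_fun_pair => //; exact: measurable_fun_coordP.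
have := mid measurableT A mA; rewrite setTI.
by congr (_ _); apply/seteqP; split => -[].
Qed.

(** A $C^1$ function positive exactly on the box, so that [step (n%:R * box_bump a b z)] tends to
    the indicator of the box. *)
Definition box_bump (a b z : V) : R :=
  (\prod_(i < m) (sqp (z.1 ord0 i - a.1 ord0 i) * sqp (b.1 ord0 i - z.1 ord0 i))) *
  (sqp (z.2 - a.2) * sqp (b.2 - z.2)).

Lemma box_bump_ge0 a b z : 0 <= box_bump a b z.
Proof.
rewrite /box_bump mulr_ge0//; last by rewrite mulr_ge0// sqp_ge0.
by apply: prodr_ge0 => i _; rewrite mulr_ge0// sqp_ge0.
Qed.

Lemma box_bump_gt0 a b z : box a b z -> 0 < box_bump a b z.
Proof.
move=> [h1 /andP[h2 h3]]; rewrite /box_bump mulr_gt0//; last first.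
  by rewrite mulr_gt0// sqp_gt0// subr_gt0.
apply: prodr_gt0 => i _; have /andP[? ?] := h1 i.
by rewrite mulr_gt0// sqp_gt0// subr_gt0.
Qed.

Lemma box_bump_eq0 a b z : ~ box a b z -> box_bump a b z = 0.
Proof.
move=> /not_andP[/existsNP[i /negP]|/negP]; rewrite negb_and -!leNgt => h.
  rewrite /box_bump (bigD1 i)//=.
  have -> : sqp (z.1 ord0 i - a.1 ord0 i) * sqp (b.1 ord0 i - z.1 ord0 i) = 0.
    case/orP: h => h.
      by rewrite (sqp_npos (x := z.1 ord0 i - _)) ?subr_le0// mul0r.
    by rewrite (sqp_npos (x := b.1 ord0 i - _)) ?subr_le0// mulr0.
  by rewrite !mul0r.
rewrite /box_bump; case/orP: h => h.
  by rewrite (sqp_npos (x := z.2 - a.2)) ?subr_le0// mul0r mulr0.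
by rewrite (sqp_npos (x := b.2 - z.2)) ?subr_le0// !mulr0.
Qed.

Lemma C1_box_bump a b : class_C 1 setT (box_bump a b).
Proof.
have sq (f : V -> R) : class_C 1 setT f -> class_C 1 setT (fun z => sqp (f z)).
  by move=> Cf; exact: (C1_comp C1_sqp Cf).
have sub (f : V -> R) c : class_C 1 setT f -> class_C 1 setT (fun z => f z - c).
  by move=> Cf; apply: C1D => //; exact: C1_cst.
have rsub (f : V -> R) c : class_C 1 setT f -> class_C 1 setT (fun z => c - f z).
  move=> Cf; have := C1D (C1_cst c) (C1M (C1_cst (-1)) Cf).
  by under eq_fun do rewrite mulN1r.
have [Ct _] := C1_time (R := R) m.
apply: C1M; last by apply: C1M; apply: sq; [exact: sub|exact: rsub].
have : forall s : seq 'I_m, class_C 1 setT (fun z : V => \prod_(i <- s)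
   (sqp (z.1 ord0 i - a.1 ord0 i) * sqp (b.1 ord0 i - z.1 ord0 i))).
  elim => [|i s ih]; first by under eq_fun do rewrite big_nil; exact: C1_cst.
  under eq_fun do rewrite big_cons; apply: C1M => //.
  have [Ci _] := C1_coord (R := R) i.
  by apply: C1M; apply: sq; [exact: sub|exact: rsub].
exact.
Qed.

Lemma measurable_box a b : measurable (box a b : set Vm).
Proof.
have -> : box a b = [set z | 0 < box_bump a b z].
  apply/seteqP; split => z; first exact: box_bump_gt0.
  by move=> /= h; apply: contrapT => /box_bump_eq0 e; move: h; rewrite e ltxx.
apply: open_measurable_prod; have cb := C1_continuous (C1_box_bump a b).
rewrite (_ : [set _ | _] = box_bump a b @^-1` [set x | 0 < x])//.
by apply: open_comp => [z _|]; [exact: cb|exact: open_gt].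
Qed.

Lemma vol_sub_compact (A : set Vm) K : measurable A -> compact K -> A `<=` K ->
  (vol A < +oo)%E.
Proof.
move=> mA cK AK; have [M [_ hM]] := @compact_bounded R V _ cK.
have r0 : 0 < `|M| + 2 by rewrite ltr_pwDr.
apply: (le_lt_trans _ (@vol_ball R m _ r0)); apply: le_measure; rewrite ?inE//.
  exact: open_measurable_prod (ball_open _ _).
move=> z /AK Kz; rewrite -ball_normE /ball_ /= sub0r normrN.
have := hM (`|M| + 1); rewrite ltr_pwDr// ?ler_norm// => /(_ isT z Kz) /= h.
by rewrite (le_lt_trans h)// ltrD2l ltr1n.
Qed.

(** The functions [xi n] are admissible tests and converge pointwise to the indicator of the box,
    under which they stay; dominated convergence passes the orthogonality to the limit. *)
Lemma box_integral_eq0 g D a b K : L2 vol setT g ->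
  (forall xi, C01 D xi -> ip g xi = 0) -> compact K -> box a b `<=` K ->
  K `<=` D -> \int[vol]_z (g \_ (box a b)) z = 0.
Proof.
move=> Lg g0 cK bK KD.
have boo := vol_sub_compact (measurable_box a b) cK bK.
pose xi (n : nat) (z : V) := step (n%:R * box_bump a b z).
have xi0 n z : ~ box a b z -> xi n z = 0.
  by move=> nz; rewrite /xi box_bump_eq0// mulr0 step0.
have Cxi n : C01 D (xi n).
  split.
    apply: (C1_comp C1_step); apply: C1M; [exact: C1_cst|exact: C1_box_bump].
  by exists K => // z nKz; apply: xi0 => /bK.
have Lxi n := C01_L2 (Cxi n).
have ig : vol.-integrable setT (EFin \o (g \_ (box a b))).
  by apply: L2_integrable_restrict => //; exact: measurable_box.
have F_cvg z : g z * xi n z @[n --> \oo] --> (g \_ (box a b)) z.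
  rewrite patchE; case: ifPn => [/set_mem bz|/negP nbz].
    have b0 := box_bump_gt0 bz; apply: cvg_near_cst.
    exists (Num.truncn (2 / box_bump a b z)).+1 => // n hn; rewrite /xi step1 ?mulr1//.
    rewrite -ler_pdivrMr//; apply/ltW/(lt_le_trans (Num.Theory.truncnS_gt _)).
    by rewrite ler_nat.
  rewrite (_ : (fun n => _) = cst 0); first exact: cvg_cst.
  by apply/funext => n; rewrite xi0 ?mulr0// => /mem_set.
have mF n : measurable_fun (setT : set Vm) (fun z => g z * xi n z).
  by apply: measurable_funM; [case: Lg|case: (Lxi n)].
have bd n z : `|g z * xi n z| <= `|(g \_ (box a b)) z|.
  rewrite patchE; case: ifPn => [_|/negP nbz].
    have /andP[s0 s1] := step_ge0 (n%:R * box_bump a b z).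
    by rewrite normrM ler_piMr// ger0_norm.
  by rewrite xi0 ?mulr0 ?normr0// => /mem_set.
have := Rintegral_dominated mF F_cvg (integrable_norm ig) bd.
have -> : (fun n => \int[vol]_z (g z * xi n z)) = cst 0.
  by apply/funext => n; exact: (g0 _ (Cxi n)).
by move=> h; exact: (cvg_unique _ h (cvg_cst 0)).
Qed.

(* The sets over which [g] integrates to 0 form a lambda-system containing the
   pi-system of boxes. *)
Lemma C01_dense g D : open D -> L2 vol setT g ->
  (forall xi, C01 D xi -> ip g xi = 0) -> ae_eq vol D g (fun=> 0).
Proof.
move=> oD Lg g0.
(* Local version: as $r<s$, the closed ball [K] of radius [r] is a compact subset of [D], so every
   box inside the small ball is covered by [box_integral_eq0]. *)
have ball0 (c : V) r s : 0 < r -> r < s -> ball c s `<=` D -> ae_eq vol setT (g \_ (ball c r)) (fun=> 0).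
  move=> r0 rs csD.
  have [K cK [rK Kr]] := closed_ball_compact c r.
  have KD : K `<=` D.
    have s0 := lt_trans r0 rs.
    move=> z /Kr[h1 h2]; apply: csD; split; last exact: le_lt_trans rs.
    by apply/(mx_ball_rV _ _ s0) => i; exact: le_lt_trans rs.
  pose B : set V := ball c r; pose h := g \_ B.
  have mB : measurable (B : set Vm) by exact: open_measurable_prod (ball_open _ _).
  have BE : B = _ := ball_box c r0.
  have Boo : (vol B < +oo)%E := vol_sub_compact mB cK rK.
  have ih : vol.-integrable setT (EFin \o h) by exact: L2_integrable_restrict.
  have iA (A : set Vm) : measurable A -> vol.-integrable setT (EFin \o (h \_ A)).
    move=> mA; rewrite -restrict_EFin.
    by apply/(integrable_mkcond _ mA); exact: integrableS ih.
  pose H : set (set Vm) := [set A | measurable A /\ \int[vol]_z (h \_ A) z = 0].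
  have boxH A : boxes A -> H A.
    move=> [a [b Aab]]; split; first by rewrite Aab; exact: measurable_box.
    have [a' [b' ab']] : boxes (A `&` B).
      by apply: setI_boxes; [exists a, b|rewrite BE; eexists; eexists].
    rewrite -(@box_integral_eq0 g D a' b' K)//; last first.
      by rewrite -ab'; apply: subset_trans rK; exact: subIsetr.
    apply: eq_Rintegral => z _; rewrite -ab'.
    by rewrite /h !patchE in_setI; case: (z \in A); case: (z \in B).
  have lH : lambda_system setT H.
    split => //.
    - split => //; rewrite -(_ : \int[vol]_z (h \_ B) z = 0).
        by apply: eq_Rintegral => z _; rewrite /h !patchE in_setT; case: (z \in B).
      by apply boxH; rewrite BE; eexists; eexists.
    - move=> A A' AA' [mA iA0] [mA' iA'0]; split; first exact: measurableD.
      have -> : h \_ (A `\` A') = fun z => (h \_ A) z - (h \_ A') z.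
        apply/funext => z; rewrite !patchE in_setD.
        have [/set_mem/AA'/mem_set ->|_] := boolP (z \in A'); first by rewrite subrr.
        by rewrite andbT subr0.
      by rewrite RintegralB ?iA0 ?iA'0 ?subrr//; exact: iA.
    - move=> F ndF HF; have mF n : measurable (F n) by case: (HF n).
      split; first exact: bigcupT_measurable.
      have c' z : (h \_ (F n)) z @[n --> \oo] --> (h \_ (\bigcup_n F n)) z.
        rewrite [X in _ --> X]patchE; case: ifPn => [/set_mem[N _ Nz]|/negP nz].
          apply: cvg_near_cst; exists N => // n Nn; rewrite patchE mem_set//.
          by move/subsetPset : (ndF _ _ Nn); exact.
        rewrite (_ : (fun n => _) = cst 0); first exact: cvg_cst.
        apply/funext => n; rewrite patchE; case: ifPn => // /set_mem Fz.
        by exfalso; apply: nz; apply/mem_set; exists n.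
      have mhF n : measurable_fun (setT : set Vm) (h \_ (F n)).
        by apply/measurable_EFinP; exact: measurable_int (iA _ (mF n)).
      have bd n z : `|(h \_ (F n)) z| <= `|h z|.
        by rewrite patchE; case: ifPn => // _; rewrite normr0.
      have := Rintegral_dominated mhF c' (integrable_norm ih) bd.
      rewrite (_ : (fun n => _) = cst 0); last by apply/funext => n; case: (HF n).
      by move=> lim0; exact: (cvg_unique _ lim0 (cvg_cst 0)).
  have allH (A : set Vm) : measurable A -> H A.
    move=> mA; apply: (lambda_system_subset setI_boxes lH boxH) => //.
    exact: boxes_generate.
  have m0 : measurable_fun (setT : set Vm) (cst 0%E : Vm -> \bar R).
    exact: measurable_cst.
  apply: filterS (integral_ae_eq measurableT ih m0 _).
    by move=> z /= /(_ I) [hz] _; exact: hz.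
  move=> A _ mA; have [_ A0] := allH A mA; rewrite integral0 integral_mkcond.
  rewrite restrict_EFin -[LHS]fineK ?(integrable_fin_num _ (iA _ mA))//.
  by move: A0; rewrite /Rintegral => ->.
(* Globalisation: [D] is covered by countably many rational balls whose doubles lie in [D], and on
   each of them [g] is nonzero only on a negligible set; [N'] reindexes these sets by natural
   numbers. *)
pose c k := @rational_center R m k; pose r k := @rational_radius R m k.
have r0 k : 0 < r k by exact: rational_radius_gt0.
pose N k := [set z : V | ball (c k) (2 * r k) `<=` D /\ ball (c k) (r k) z /\ g z != 0].
pose N' n := if unpickle n is Some k then N k else set0.
have negN n : vol.-negligible (N' n).
  rewrite /N'; case: unpickle => [k|]; last exact: negligible_set0.
  have [kD|nkD] := pselect (ball (c k) (2 * r k) `<=` D); last first.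
    by apply: (negligibleS _ (negligible_set0 vol)) => z [].
  have rs : r k < 2 * r k by rewrite ltr_pMl// ltr1n.
  have := ball0 (c k) (r k) (2 * r k) (r0 k) rs kD.
  rewrite /ae_eq /almost_everywhere; apply: negligibleS => z [_ [bz gz]] /= h.
  by move: (h I); rewrite patchE mem_set//; exact/eqP.
apply: (negligibleS _ (negligible_bigcup negN)) => z /= /not_implyP[Dz /eqP gz].
have [k [kz kD]] := rational_ball_cover oD Dz.
by exists (pickle k) => //; rewrite /N' pickleK.
Qed.

End boxes.

(** * Geometry of the space-time cylinder *)

Section geometry.
Context {R : realType} {m : nat} (P : interface_problem R m).
Hypothesis hP : standing_assumptions P.
Local Notation V := ('rV[R]_m * R)%type.
Local Notation Vm := ('rV[R]_m * measurableTypeR R)%type.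
Local Notation vol := (@vol R m).
Local Notation T := (horizon P).
Local Notation Q := (QT P).

Lemma Omega_open : open (Omega P). Proof. by have [] := Omega_domain hP. Qed.

Definition cylinder (I : set R) : set V := [set z | Omega P z.1 /\ I z.2].

Lemma QT_cylinder : Q = cylinder [set t | 0 < t < T].
Proof. by apply/seteqP; split => z [? ?]; split. Qed.

Lemma open_cylinder (I : set R) : open I -> open (cylinder I).
Proof.
move=> oI; rewrite (_ : cylinder I = (fst @^-1` Omega P) `&` (snd @^-1` I))//.
apply: openI; apply: open_comp => //.
- by move=> z _; exact: cvg_fst.
- exact: Omega_open.
- by move=> z _; exact: cvg_snd.
Qed.

Lemma QT_open : open Q.
Proof.
rewrite QT_cylinder; apply: open_cylinder.
rewrite (_ : [set t | _] = `]0, T[%classic); first exact: itv_open.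
by apply/seteqP; split => t /=; rewrite in_itv/=.
Qed.

Lemma measurable_QT : measurable (Q : set Vm).
Proof. exact: open_measurable_prod QT_open. Qed.

Lemma Omega_ball : exists r, 0 < r /\ Omega P `<=` ball (0 : 'rV[R]_m) r.
Proof.
have [M [_ hM]] := Omega_bounded hP; exists (`|M| + 2).
rewrite ltr_pwDr//; split => // x Ox; rewrite -ball_normE /ball_ /= sub0r normrN.
have := hM (`|M| + 1); rewrite ltr_pwDr// ?ler_norm// => /(_ isT x Ox) /= h.
by rewrite (le_lt_trans h)// ltrD2l ltr1n.
Qed.

Lemma Omega_finite : (lebesgue_rV m (Omega P) < +oo)%E.
Proof.
have [r [r0 Or]] := Omega_ball.
apply: (le_lt_trans _ (lebesgue_rV_ball m r0)); apply: le_measure; rewrite ?inE//.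
  exact: open_measurable_rV Omega_open.
exact: measurable_ball_rV.
Qed.

Lemma QT_finite : (vol Q < +oo)%E.
Proof.
have [r [r0 Or]] := Omega_ball; have T0 := horizon_gt0 hP.
have r'0 : 0 < r + T by rewrite addr_gt0.
apply: (le_lt_trans _ (@vol_ball R m _ r'0)); apply: le_measure; rewrite ?inE.
- exact: measurable_QT.
- exact: open_measurable_prod (ball_open _ _).
move=> z [/andP[t0 tT] /Or Oz]; split.
  by apply: le_ball Oz; rewrite lerDl ltW.
by rewrite /ball/= sub0r normrN gtr0_norm// (lt_trans tT)// ltrDr.
Qed.

(** A coordinate exists because the dimension is at least 1; the Poincaré inequality integrates
    along it. *)
Definition some_coord : 'I_m := Ordinal (proj1 (andP (dimension_le3 hP))).

Lemma coord_bounded : exists B, forall z, Q z -> `|z.1 ord0 some_coord| <= B.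
Proof.
have [r [r0 Or]] := Omega_ball; exists r => z [_ /Or].
by move=> /(mx_ball_rV _ _ r0)/(_ some_coord); rewrite !mxE sub0r normrN => /ltW.
Qed.

End geometry.

(** * The space $W$ as a closure of pairs made of a function and its gradient *)

Section W_pairs.
Context {R : realType} {m : nat} (P : interface_problem R m).
Hypothesis hP : standing_assumptions P.
Local Notation V := ('rV[R]_m * R)%type.
Local Notation Vm := ('rV[R]_m * measurableTypeR R)%type.
Local Notation vol := (@vol R m).
Local Notation ip := (ip vol).
Local Notation L2V := (L2 vol setT).
Local Notation T := (horizon P).
Local Notation Q := (QT P).
Implicit Types (w xi : V -> R) (g : 'I_m -> V -> R).

Definition grad_nrm2 g : R := \sum_(i < m) ip (g i) (g i).

Definition nrm2 w g : R := ip w w + grad_nrm2 g.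

Lemma grad_nrm2_ge0 g : 0 <= grad_nrm2 g.
Proof. by apply: sumr_ge0 => i _; exact: ip_ge0. Qed.

Lemma nrm2_ge0 w g : 0 <= nrm2 w g.
Proof. by rewrite addr_ge0 ?ip_ge0 ?grad_nrm2_ge0. Qed.

Lemma grad_nrm2D g g' : (forall i, L2V (g i)) -> (forall i, L2V (g' i)) ->
  grad_nrm2 (fun i z => g i z + g' i z) <= 2 * grad_nrm2 g + 2 * grad_nrm2 g'.
Proof.
move=> Lg Lg'; rewrite /grad_nrm2 !mulr_sumr -big_split/=.
by apply: ler_sum => i _; exact: ipDle.
Qed.

Lemma nrm2D w g w' g' : L2V w -> L2V w' ->
  (forall i, L2V (g i)) -> (forall i, L2V (g' i)) ->
  nrm2 (fun z => w z + w' z) (fun i z => g i z + g' i z) <=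
  2 * nrm2 w g + 2 * nrm2 w' g'.
Proof.
move=> Lw Lw' Lg Lg'; have := grad_nrm2D Lg Lg'; have := ipDle Lw Lw'.
by rewrite /nrm2; lra.
Qed.

Lemma nrm2Z c w g : L2V w -> (forall i, L2V (g i)) ->
  nrm2 (fun z => c * w z) (fun i z => c * g i z) = c ^+ 2 * nrm2 w g.
Proof.
move=> Lw Lg; rewrite /nrm2 /grad_nrm2 mulrDr mulr_sumr; congr (_ + _).
  by rewrite ipZl// ?ipZr// ?mulrA ?expr2//; exact: L2Z.
by apply: eq_bigr => i _; rewrite ipZl// ?ipZr// ?mulrA ?expr2//; exact: L2Z.
Qed.

(* The functions of [W], extended by 0 outside [QT], with their gradient. *)
Definition W_pair w g : Prop :=
  [/\ L2V w, (forall i, L2V (g i)),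
      (forall z, ~ Q z -> w z = 0 /\ forall i, g i z = 0) &
      forall e, 0 < e -> exists2 xi, C01 Q xi &
        nrm2 (fun z => w z - xi z) (fun i z => g i z - ddx i xi z) < e].

Lemma ddx_L2 D xi i : C01 D xi -> L2V (ddx i xi).
Proof. exact: C01_derive_L2. Qed.

Lemma nrm2_0 : nrm2 (fun=> 0) (fun _ _ => 0) = 0.
Proof. by rewrite /nrm2 /grad_nrm2 big1 ?ip0l ?addr0// => i _; rewrite ip0l. Qed.

Lemma W_pair_C01 xi : C01 Q xi -> W_pair xi (fun i => ddx i xi).
Proof.
move=> Cxi; split.
- exact: C01_L2 Cxi.
- by move=> i; exact: ddx_L2 Cxi.
- move=> z nz; split => [|i]; first exact: C01_off Cxi _ nz.
  exact: C01_derive_off Cxi _ nz.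
- move=> e e0; exists xi => //.
  rewrite (_ : nrm2 _ _ = nrm2 (fun=> 0) (fun _ _ => 0)); first by rewrite nrm2_0.
  by congr nrm2; [|apply/funext => i]; apply/funext => z; rewrite subrr.
Qed.

Lemma W_pair_closed w g : L2V w -> (forall i, L2V (g i)) ->
  (forall z, ~ Q z -> w z = 0 /\ forall i, g i z = 0) ->
  (forall e, 0 < e -> exists w' g', W_pair w' g' /\
     nrm2 (fun z => w z - w' z) (fun i z => g i z - g' i z) < e) ->
  W_pair w g.
Proof.
move=> Lw Lg w0 H; split => // e e0.
have e40 : 0 < e / 4 by rewrite divr_gt0.
have [w' [g' [[Lw' Lg' _ H'] ww']]] := H _ e40.
have [xi Cxi w'xi] := H' _ e40; exists xi => //.
have Lxi := C01_L2 Cxi; have Ldxi i := ddx_L2 i Cxi.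
have := nrm2D (L2B Lw Lw') (L2B Lw' Lxi) (fun i => L2B (Lg i) (Lg' i))
  (fun i => L2B (Lg' i) (Ldxi i)).
rewrite (_ : nrm2 (fun z => w z - w' z + _) _ = 
  nrm2 (fun z => w z - xi z) (fun i z => g i z - ddx i xi z)); first lra.
by congr nrm2; [|apply/funext => i]; apply/funext => z; rewrite subrKA.
Qed.

Lemma W_pair_lin c w g w' g' : W_pair w g -> W_pair w' g' ->
  W_pair (fun z => c * w z + w' z) (fun i z => c * g i z + g' i z).
Proof.
move=> [Lw Lg w0 H] [Lw' Lg' w'0 H']; split.
- by apply: L2D => //; exact: L2Z.
- by move=> i; apply: L2D => //; exact: L2Z.
- move=> z nz; have [-> gz] := w0 z nz; have [-> g'z] := w'0 z nz.
  by split => [|i]; rewrite ?gz ?g'z mulr0 addr0.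
move=> e e0; have c0 : 0 < c ^+ 2 + 1 by rewrite ltr_pwDr// sqr_ge0.
(* The denominator makes $c^2$ times this tolerance at most $e/4$, and is nonzero also when
   $c=0$. *)
have e40 : 0 < e / (4 * (c ^+ 2 + 1)) by rewrite divr_gt0// mulr_gt0.
have e40' : 0 < e / 4 by rewrite divr_gt0.
have [xi Cxi h] := H _ e40; have [xi' Cxi' h'] := H' _ e40'.
exists (fun z => c * xi z + xi' z); first by apply: C01D => //; exact: C01Z.
have Lxi := C01_L2 Cxi; have Ldxi i := ddx_L2 i Cxi.
have Lxi' := C01_L2 Cxi'; have Ldxi' i := ddx_L2 i Cxi'.
have L1 := L2B Lw Lxi; have L2' i := L2B (Lg i) (Ldxi i).
have := nrm2D (L2Z c L1) (L2B Lw' Lxi') (fun i => L2Z c (L2' i))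
  (fun i => L2B (Lg' i) (Ldxi' i)).
rewrite nrm2Z//; move=> h2.
have h3 : c ^+ 2 * nrm2 (fun z => w z - xi z) (fun i z => g i z - ddx i xi z) <= e / 4.
  apply: (@le_trans _ _ (c ^+ 2 * (e / (4 * (c ^+ 2 + 1))))).
    by rewrite ler_wpM2l ?sqr_ge0// ltW.
  rewrite mulrCA ler_wpM2l ?(ltW e0)// invfM mulrCA ger_pMr ?invr_gt0//.
  by rewrite ler_pdivrMr// mul1r lerDl.
rewrite (_ : nrm2 _ _ = nrm2 (fun z => c * (w z - xi z) + (w' z - xi' z))
   (fun i z => c * (g i z - ddx i xi z) + (g' i z - ddx i xi' z))); first lra.
congr nrm2; first by apply/funext => z; ring.
apply/funext => i; apply/funext => z.
rewrite /ddx deriveD; last 2 first.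
- by apply/diff_derivable/C1_diff/(C01_C1 (C01Z c Cxi)).
- by apply/diff_derivable/C1_diff/(C01_C1 Cxi').
rewrite (_ : 'D_(unit_vec i, 0) (fun z => c * xi z) z = c * 'D_(unit_vec i, 0) xi z); first by ring.
by apply: deriveMl; apply/diff_derivable/C1_diff/(C01_C1 Cxi).
Qed.

End W_pairs.

(** The closing step of the density arguments: the error [e] of the approximation enters only
    through [K * e] with [K] independent of [e]. *)
Lemma le_epsilon_scaled {R : realFieldType} (x y K : R) : 0 <= K ->
  (forall e, 0 < e -> x <= y + K * e) -> x <= y.
Proof.
move=> K0 H; apply/ler_addgt0Pr => e e0.
have K1 : 0 < K + 1 by rewrite ltr_pwDr.
have := H (e / (K + 1)); rewrite divr_gt0// => /(_ isT) h.
rewrite (le_trans h)// lerD2l mulrCA ger_pMr// ler_pdivrMr// mul1r.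
by rewrite lerDl.
Qed.

(** * Integration by parts, Poincaré inequality and uniqueness of gradients on $W$ *)

Section W_pair_theory.
Context {R : realType} {m : nat} (P : interface_problem R m).
Hypothesis hP : standing_assumptions P.
Local Notation V := ('rV[R]_m * R)%type.
Local Notation Vm := ('rV[R]_m * measurableTypeR R)%type.
Local Notation vol := (@vol R m).
Local Notation ip := (ip vol).
Local Notation L2V := (L2 vol setT).
Local Notation T := (horizon P).
Local Notation Q := (QT P).
Implicit Types (w f xi : V -> R) (g : 'I_m -> V -> R).

Lemma ip_le_nrm2 w g : ip w w <= nrm2 w g.
Proof. by rewrite lerDl grad_nrm2_ge0. Qed.

Lemma grad_le_nrm2 w g : grad_nrm2 g <= nrm2 w g.
Proof. by rewrite lerDr ip_ge0. Qed.

Lemma ip_le_grad g i : ip (g i) (g i) <= grad_nrm2 g.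
Proof.
by rewrite /grad_nrm2 (bigD1 i)//= lerDl; apply: sumr_ge0 => j _; exact: ip_ge0.
Qed.

(** By Cauchy-Schwarz both sides are continuous in the pair, and they agree on $C_0^1$; so a limit
    gradient is a weak gradient. *)
Lemma W_pair_ibp w g i xi : W_pair P w g -> C01 Q xi ->
  ip w (ddx i xi) = - ip (g i) xi.
Proof.
move=> [Lw Lg _ H] Cxi; have Lxi := C01_L2 Cxi; have Ldxi := ddx_L2 i Cxi.
apply/eqP; rewrite -subr_eq0 opprK; apply/eqP; set x := _ + _.
pose A := ip (ddx i xi) (ddx i xi); pose B := ip xi xi.
have A0 : 0 <= A by exact: ip_ge0.
have B0 : 0 <= B by exact: ip_ge0.
suff : x ^+ 2 <= 0 by move=> h; apply/eqP; rewrite -sqrf_eq0 eq_le h sqr_ge0.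
apply: (@le_epsilon_scaled _ _ _ (2 * A + 2 * B)); first by lra.
move=> e e0; have [z Cz hz] := H e e0.
have Lz := C01_L2 Cz; have Ldz := ddx_L2 i Cz.
have -> : x = ip (fun y => w y - z y) (ddx i xi) + ip (fun y => g i y - ddx i z y) xi.
  rewrite !ipBl// /x; have := C01_ibp (unit_vec i, 0) Cz Cxi.
  by rewrite -/(ddx i xi) -/(ddx i z) => ->; ring.
have cs1 := ip_cauchy_schwarz (L2B Lw Lz) Ldxi.
have cs2 := ip_cauchy_schwarz (L2B (Lg i) Ldz) Lxi.
have h1 := ip_le_nrm2 (fun y => w y - z y) (fun i y => g i y - ddx i z y).
have h2 := le_trans (ip_le_grad (fun i y => g i y - ddx i z y) i)
  (grad_le_nrm2 (fun y => w y - z y) (fun i y => g i y - ddx i z y)).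
set a := ip _ (ddx i xi) in cs1 *; set b := ip _ xi in cs2 *.
have l1 : a ^+ 2 <= e * A.
  by apply: (le_trans cs1); rewrite ler_wpM2r// (le_trans h1)// ltW.
have l2 : b ^+ 2 <= e * B.
  by apply: (le_trans cs2); rewrite ler_wpM2r// (le_trans h2)// ltW.
by have := sqr_ge0 (a - b); lra.
Qed.

(** The inequality for $C_0^1$ survives the limit; the factor 4 comes from passing to the
    approximation and back, each time with $(a+b)^2\le2a^2+2b^2$. *)
Lemma W_pair_poincare : exists2 C, 0 <= C &
  forall w g, W_pair P w g -> ip w w <= C * grad_nrm2 g.
Proof.
have [B QB] := coord_bounded hP; pose C := 4 * B ^+ 2.
have C0 : 0 <= C by rewrite mulr_ge0// sqr_ge0.
exists (4 * C) => [|w g [Lw Lg _ H]]; first by rewrite mulr_ge0.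
apply: (@le_epsilon_scaled _ _ _ (2 + 4 * C)); first by lra.
move=> e e0; have [z Cz hz] := H e e0.
have Lz := C01_L2 Cz; have Ldz i := ddx_L2 i Cz.
have p1 := C01_poincare QB Cz.
have p2 := ip_le_grad (fun i => ddx i z) (some_coord hP).
have p3 : ip z z <= C * grad_nrm2 (fun i => ddx i z).
  by apply: (le_trans p1); rewrite ler_wpM2l.
have l1 := ipDle (L2B Lw Lz) Lz.
have l2 := grad_nrm2D (fun i => L2N (L2B (Lg i) (Ldz i))) Lg.
have E1 : (fun y => w y - z y + z y) = w by apply/funext => y; rewrite subrK.
have E2 : (fun i y => - (g i y - ddx i z y) + g i y) = (fun i => ddx i z).
  by apply/funext => i; apply/funext => y; rewrite opprB subrK.
have E3 : grad_nrm2 (fun i y => - (g i y - ddx i z y)) =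
          grad_nrm2 (fun i y => (g i y - ddx i z y)).
  apply: eq_bigr => i _; rewrite ipNl ?ipNr ?opprK//; try exact: L2B.
  exact/L2N/L2B.
rewrite E1 in l1; rewrite E2 E3 in l2.
have h1 := ip_le_nrm2 (fun y => w y - z y) (fun i y => g i y - ddx i z y).
have h2 := grad_le_nrm2 (fun y => w y - z y) (fun i y => g i y - ddx i z y).
have h3 : C * grad_nrm2 (fun i => ddx i z) <= C * (2 * e + 2 * grad_nrm2 g).
  by rewrite ler_wpM2l//; lra.
lra.
Qed.

Lemma L2V_ext f : L2Q P f <-> L2V (f \_ Q).
Proof.
have mQ := measurable_QT hP.
have E : (EFin \o (fun z => f z ^+ 2)) \_ Q = EFin \o (fun z => (f \_ Q) z ^+ 2).
  apply/funext => z; rewrite [LHS]patchE /= patchE.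
  by case: ifPn => //= _; rewrite expr0n.
split=> -[mf intf]; split.
- by apply/(measurable_restrictT _ mQ).
- by move/(integrable_mkcond _ mQ) : intf; rewrite E.
- by apply/(measurable_restrictT _ mQ).
- by apply/(integrable_mkcond _ mQ); rewrite E.
Qed.

Lemma intQ_mul f f' : intQ P (fun z => f z * f' z) = ip (f \_ Q) (f' \_ Q).
Proof.
rewrite /intQ Rintegral_mkcond; apply: eq_Rintegral => z _.
by rewrite !patchE; case: ifPn => // _; rewrite mulr0.
Qed.

Lemma eqQ_ext f f' : eqQ P f f' <-> ae_eq vol setT (f \_ Q) (f' \_ Q).
Proof.
split; apply: filterS => z h.
  by move=> _; rewrite !patchE; case: ifPn => // /set_mem; exact: h.
by move=> Qz; have := h I; rewrite !patchE mem_set.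
Qed.

Lemma ext_id f : (forall z, ~ Q z -> f z = 0) -> f \_ Q = f.
Proof.
move=> f0; apply/funext => z; rewrite patchE; case: ifPn => // /negP nz.
by rewrite f0// => /mem_set.
Qed.

Lemma ext_off f z : ~ Q z -> (f \_ Q) z = 0.
Proof. by move=> nz; rewrite patchE memNset. Qed.

Lemma is_wgradE w (g : V -> 'rV[R]_m) : is_wgrad P w g <->
  (forall i, L2V ((fun z => g z ord0 i) \_ Q)) /\
  (forall i xi, C01 Q xi ->
     ip (w \_ Q) (ddx i xi) = - ip ((fun z => g z ord0 i) \_ Q) xi).
Proof.
have E xi : C01 Q xi -> xi \_ Q = xi.
  by move=> Cxi; apply: ext_id; exact: C01_off Cxi.
have E' xi i : C01 Q xi -> ddx i xi \_ Q = ddx i xi.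
  by move=> Cxi; apply: ext_id; exact: C01_derive_off Cxi.
split=> -[Lg H]; split => [i|i xi Cxi].
- exact/L2V_ext.
- by have := H i xi Cxi; rewrite !intQ_mul (E _ Cxi) (E' _ i Cxi).
- exact/L2V_ext.
- by rewrite !intQ_mul (E _ Cxi) (E' _ i Cxi); exact: H.
Qed.

(** The difference of the two gradients is orthogonal to every $C_0^1$ function, hence zero almost
    everywhere by [C01_dense]. *)
Lemma is_wgrad_unique w w' (g g' : V -> 'rV[R]_m) : is_wgrad P w g -> is_wgrad P w' g' ->
  ae_eq vol setT (w \_ Q) (w' \_ Q) -> L2V (w \_ Q) -> L2V (w' \_ Q) ->
  forall i, ae_eq vol setT ((fun z => g z ord0 i) \_ Q) ((fun z => g' z ord0 i) \_ Q).
Proof.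
move=> /is_wgradE[Lg H] /is_wgradE[Lg' H'] ww' Lw Lw' i.
have := @C01_dense _ _ _ Q (QT_open hP) (L2B (Lg i) (Lg' i)).
have h xi : C01 Q xi ->
    ip (fun z => ((fun z => g z ord0 i) \_ Q) z - ((fun z => g' z ord0 i) \_ Q) z) xi = 0.
  move=> Cxi; have Lxi := C01_L2 Cxi; rewrite ipBl//.
  rewrite -[X in X - _]opprK -[X in _ - X]opprK -H// -H'//.
  by rewrite (ip_ae Lw Lw' (ddx_L2 i Cxi) ww') subrr.
move=> /(_ h); apply: filterS => z hz _.
have [Qz|nQz] := pselect (Q z); last by rewrite !ext_off.
by apply/eqP; rewrite -subr_eq0; apply/eqP; exact: hz.
Qed.

End W_pair_theory.

(** * Identification of [W_space] with the extended pairs *)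

Section W_space_pairs.
Context {R : realType} {m : nat} (P : interface_problem R m).
Hypothesis hP : standing_assumptions P.
Local Notation V := ('rV[R]_m * R)%type.
Local Notation Vm := ('rV[R]_m * measurableTypeR R)%type.
Local Notation vol := (@vol R m).
Local Notation ip := (ip vol).
Local Notation L2V := (L2 vol setT).
Local Notation T := (horizon P).
Local Notation Q := (QT P).
Implicit Types (w f xi : V -> R) (g : 'I_m -> V -> R).

(** [wgrad] is an arbitrary choice among almost everywhere equal gradients, which is why the rules
    for [grad0] hold only up to null sets. *)
Definition grad0 w (i : 'I_m) : V -> R := (fun z => wgrad P w z ord0 i) \_ Q.

Lemma wgradP w : H10 P w -> is_wgrad P w (wgrad P w).
Proof. by move=> [_ ex]; exact: xgetPex ex. Qed.

Lemma nrm2_ae w g w' g' : L2V w -> L2V w' -> (forall i, L2V (g i)) ->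
  (forall i, L2V (g' i)) -> ae_eq vol setT w w' ->
  (forall i, ae_eq vol setT (g i) (g' i)) -> nrm2 w g = nrm2 w' g'.
Proof.
move=> Lw Lw' Lg Lg' ww' gg'; rewrite /nrm2 /grad_nrm2; congr (_ + _).
  by rewrite (ip_ae Lw Lw' Lw ww') ipC (ip_ae Lw Lw' Lw' ww').
apply: eq_bigr => i _.
by rewrite (ip_ae (Lg i) (Lg' i) (Lg i) (gg' i)) ipC (ip_ae (Lg i) (Lg' i) (Lg' i) (gg' i)).
Qed.

Lemma H10_normE w : H10_norm P w = Num.sqrt (nrm2 (w \_ Q) (grad0 w)).
Proof.
rewrite /H10_norm /nrm2 /grad_nrm2; congr (Num.sqrt (_ + _)).
  exact: (intQ_mul P w w).
by apply: eq_bigr => i _; exact: (intQ_mul P (fun z => wgrad P w z ord0 i) (fun z => wgrad P w z ord0 i)).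
Qed.

Lemma H10_L2 w : H10 P w -> L2V (w \_ Q) /\ forall i, L2V (grad0 w i).
Proof.
move=> Hw; have [Lg _] := wgradP Hw; case: Hw => Lw _.
by split => [|i]; apply/(L2V_ext hP).
Qed.

Lemma extB f f' : (fun z => f z - f' z) \_ Q = (fun z => (f \_ Q) z - (f' \_ Q) z).
Proof.
by apply/funext => z; rewrite !patchE; case: ifPn => // _; rewrite subr0.
Qed.

Lemma H10_sub_C01 w xi : H10 P w -> C01 Q xi ->
  H10 P (fun z => w z - xi z) /\
  forall i, ae_eq vol setT (grad0 (fun z => w z - xi z) i)
                           (fun z => grad0 w i z - ddx i xi z).
Proof.
move=> Hw Cxi; have [Lw Lg] := H10_L2 Hw.
have Lxi := C01_L2 Cxi; have Ldxi i := ddx_L2 i Cxi.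
have xiE : xi \_ Q = xi by apply: ext_id; exact: C01_off Cxi.
have dxiE i : ddx i xi \_ Q = ddx i xi by apply: ext_id; exact: C01_derive_off Cxi.
have rowE i : (fun z => (wgrad P w z - \row_j ddx j xi z) ord0 i) \_ Q =
    fun z => grad0 w i z - ddx i xi z.
  rewrite /grad0 -(dxiE i) -extB; congr patch.
  by apply/funext => z; rewrite !mxE.
have Lw' : L2V ((fun z => w z - xi z) \_ Q) by rewrite extB xiE; exact: L2B.
have wg : is_wgrad P (fun z => w z - xi z) (fun z => wgrad P w z - \row_i ddx i xi z).
  apply/(is_wgradE hP); split => [i|i z Cz].
    by rewrite rowE; exact: L2B.
  have Lz := C01_L2 Cz; have Ldz := ddx_L2 i Cz.
  rewrite rowE extB xiE !ipBl//; have [_ H] := (is_wgradE hP _ _).1 (wgradP Hw).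
  by rewrite H// (C01_ibp (unit_vec i, 0) Cxi Cz) /grad0 /ddx; ring.
have Hw' : H10 P (fun z => w z - xi z).
  by split; [exact/(L2V_ext hP)|eexists; exact: wg].
split => // i; have := is_wgrad_unique hP (wgradP Hw') wg _ Lw' Lw' i.
by rewrite rowE; apply; exact: nearW.
Qed.

(** Together with [W_pair_space] this identifies the two descriptions of $W$. The substance is
    [H10_sub_C01]: the gradient chosen for $w-\xi$ is almost everywhere the difference of the
    gradients. *)
Lemma W_space_pair w : W_space P w -> W_pair P (w \_ Q) (grad0 w).
Proof.
move=> [Hw H]; have [Lw Lg] := H10_L2 Hw; split => //.
  by move=> z nz; split => [|i]; exact: ext_off.
move=> e e0; have se0 : 0 < Num.sqrt e by rewrite sqrtr_gt0.
have [xi Cxi h] := H _ se0; exists xi => //.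
have [Hwxi gE] := H10_sub_C01 Hw Cxi; have [Lwxi Lgxi] := H10_L2 Hwxi.
have Lxi := C01_L2 Cxi; have Ldxi i := ddx_L2 i Cxi.
move: h; rewrite H10_normE ltr_sqrt// => h.
rewrite (_ : nrm2 _ _ = nrm2 ((fun z => w z - xi z) \_ Q) (grad0 (fun z => w z - xi z)))//.
have E : (fun z => (w \_ Q) z - xi z) = (fun z => w z - xi z) \_ Q.
  rewrite extB; apply/funext => z; congr (_ - _).
  by rewrite (@ext_id _ _ P xi)//; exact: C01_off Cxi.
rewrite E; apply: nrm2_ae => //.
- by move=> i; exact: L2B.
- exact: nearW.
- by move=> i; apply: filterS (gE i) => z h' _; rewrite h'.
Qed.

Lemma W_pair_space w g : W_pair P (w \_ Q) g ->
  W_space P w /\ forall i, ae_eq vol setT (grad0 w i) (g i).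
Proof.
move=> Wwg; have [Lw Lg w0 H] := Wwg.
have gE i : (fun z => (\row_j g j z) ord0 i) \_ Q = g i.
  rewrite (_ : (fun z => (\row_j g j z) ord0 i) = g i); last by apply/funext => z; rewrite mxE.
  by apply: ext_id => z /w0[_]; exact.
have wg : is_wgrad P w (fun z => \row_i g i z).
  apply/(is_wgradE hP); split => [i|i z Cz]; rewrite gE//.
  exact: W_pair_ibp Wwg Cz.
have Hw : H10 P w by split; [exact/(L2V_ext hP)|eexists; exact: wg].
have gg i : ae_eq vol setT (grad0 w i) (g i).
  have := is_wgrad_unique hP (wgradP Hw) wg _ Lw Lw i.
  by rewrite gE; apply; exact: nearW.
split => //; split => // e e0.
have ee0 : 0 < e ^+ 2 by rewrite exprn_gt0.
have [xi Cxi h] := H _ ee0; exists xi => //.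
have [Hwxi gE'] := H10_sub_C01 Hw Cxi; have [Lwxi Lgxi] := H10_L2 Hwxi.
have Lxi := C01_L2 Cxi; have Ldxi i := ddx_L2 i Cxi.
rewrite H10_normE -[ltRHS]ger0_norm ?(ltW e0)// -sqrtr_sqr ltr_sqrt//.
rewrite (_ : nrm2 _ _ = nrm2 (fun z => (w \_ Q) z - xi z) (fun i z => g i z - ddx i xi z))//.
have E : (fun z => (w \_ Q) z - xi z) = (fun z => w z - xi z) \_ Q.
  rewrite extB; apply/funext => z; congr (_ - _).
  by rewrite (@ext_id _ _ P xi)//; exact: C01_off Cxi.
rewrite E; apply: nrm2_ae => //.
- by move=> i; exact: L2B.
- exact: nearW.
- by move=> i; apply: filterS2 (gE' i) (gg i) => z h1 h2 _; rewrite h1// h2.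
Qed.

Lemma W_pair_grad w g : W_pair P (w \_ Q) g ->
  forall i, ae_eq vol setT (grad0 w i) (g i).
Proof. by move=> /W_pair_space[]. Qed.

Lemma W_space_lin c w w' : W_space P w -> W_space P w' ->
  W_space P (fun z => c * w z + w' z) /\
  forall i, ae_eq vol setT (grad0 (fun z => c * w z + w' z) i)
                           (fun z => c * grad0 w i z + grad0 w' i z).
Proof.
move=> /W_space_pair W1 /W_space_pair W2; apply: W_pair_space.
have := W_pair_lin c W1 W2; congr W_pair; apply/funext => z.
by rewrite !patchE; case: ifPn => // _; rewrite mulr0 addr0.
Qed.

Lemma W_space0 : W_space P (fun=> 0).
Proof.
have C0 : C01 Q (fun _ : V => 0 : R).
  by split; [exact: C1_cst|exists set0 => //; split => //; exact: compact0].
have := W_pair_C01 C0; rewrite -{1}(@ext_id _ _ P (fun=> 0))//.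
by case/W_pair_space.
Qed.

Lemma W_space_C01 xi : C01 Q xi -> W_space P xi /\
  forall i, ae_eq vol setT (grad0 xi i) (ddx i xi).
Proof.
move=> Cxi; apply: W_pair_space; rewrite ext_id; last exact: C01_off Cxi.
exact: W_pair_C01.
Qed.

End W_space_pairs.

Lemma cvg_sum0 {R : realType} (I : Type) (s : seq I) (F : nat -> I -> R) :
  (forall i, F n i @[n --> \oo] --> 0) -> \sum_(i <- s) F n i @[n --> \oo] --> 0.
Proof.
move=> F0; elim: s => [|i s ih]; first by under eq_fun do rewrite big_nil; exact: cvg_cst.
under eq_fun do rewrite big_cons.
have : F n i + \sum_(j <- s) F n j @[n --> \oo] --> (0 + 0 : R) by exact: cvgD.
by rewrite addr0.
Qed.

Lemma ip_subC {d} {X : measurableType d} {R : realType}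
    (mu : {measure set X -> \bar R}) (f g : X -> R) :
  ip mu (fun x => f x - g x) (fun x => f x - g x) =
  ip mu (fun x => g x - f x) (fun x => g x - f x).
Proof. by apply: eq_Rintegral => x _; ring. Qed.

(** * Cut-offs in time *)

Section time_shifts.
Context {R : realType} {m : nat} (P : interface_problem R m).
Hypothesis hP : standing_assumptions P.
Local Notation V := ('rV[R]_m * R)%type.
Local Notation Vm := ('rV[R]_m * measurableTypeR R)%type.
Local Notation vol := (@vol R m).
Local Notation ip := (ip vol).
Local Notation L2V := (L2 vol setT).
Local Notation T := (horizon P).
Local Notation Q := (QT P).
Local Notation et := ((0, 1) : V).
Implicit Types (w f xi : V -> R) (g : 'I_m -> V -> R).

Lemma C1_time_comp (chi : R -> R) : class_C 1 setT chi ->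
  class_C 1 setT (fun z : V => chi z.2) /\
  forall e z, 'D_e (fun z : V => chi z.2) z = 'D_1 chi z.2 * e.2.
Proof.
move=> Cchi; have [Ct Dt] := C1_time (R := R) m.
split; first exact: (C1_comp Cchi Ct).
by move=> e z; rewrite -(Dt e z); exact: (C1_derive_comp e z Cchi Ct).
Qed.

Lemma ddx_cut (chi : R -> R) xi i : class_C 1 setT chi -> class_C 1 setT xi ->
  ddx i (fun z => chi z.2 * xi z) = (fun z => chi z.2 * ddx i xi z).
Proof.
move=> Cchi Cxi; have [Ct Dt] := C1_time_comp Cchi.
apply/funext => z; rewrite /ddx deriveM; [|exact: C1_derivable..].
by rewrite Dt /= mulr0 scaler0 addr0.
Qed.

Lemma ddt_cut (chi : R -> R) xi : class_C 1 setT chi -> class_C 1 setT xi ->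
  ddt (fun z => chi z.2 * xi z) =
  (fun z => chi z.2 * ddt xi z + 'D_1 chi z.2 * xi z).
Proof.
move=> Cchi Cxi; have [Ct Dt] := C1_time_comp Cchi.
apply/funext => z; rewrite /ddt deriveM; [|exact: C1_derivable..].
by rewrite Dt /= mulr1; congr (_ + _); rewrite mulrC.
Qed.

Lemma C1_step_affine (a b : R) : class_C 1 setT (fun t : R => step (a * t + b)).
Proof.
apply: (C1_comp C1_step (V := R^o) (f := fun t => a * t + b)).
by apply: C1D; [apply: C1M; [exact: C1_cst|exact: C1_id]|exact: C1_cst].
Qed.

(** For $n>0$ it vanishes up to $1/n$ and from $T-1/n$ on, and is 1 at distance at least $2/n$
    inside $(0,T)$. Both arguments are kept affine, even with [+ 0], to match [C1_step_affine]. *)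
Definition cutoff (n : nat) (t : R) : R :=
  step (n%:R * t + 0) * step (- n%:R * t + n%:R * T).

Lemma C1_cutoff n : class_C 1 setT (cutoff n).
Proof. by apply: C1M; exact: C1_step_affine. Qed.

Lemma cutoff_ge0 n t : 0 <= cutoff n t <= 1.
Proof.
rewrite /cutoff; have /andP[a0 a1] := step_ge0 (n%:R * t + 0).
have /andP[b0 b1] := step_ge0 (- n%:R * t + n%:R * T).
by rewrite mulr_ge0//= mulr_ile1.
Qed.

Lemma cutoff_cvg t : 0 < t < T -> \forall n \near \oo, cutoff n t = 1.
Proof.
move=> /andP[t0 tT]; have tT' : 0 < T - t by rewrite subr_gt0.
exists (maxn (Num.truncn (2 / t)).+1 (Num.truncn (2 / (T - t))).+1) => // n /=.
rewrite geq_max => /andP[n1 n2]; rewrite /cutoff.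
have h (x : R) : 0 < x -> ((Num.truncn (2 / x)).+1 <= n)%N -> 2 <= n%:R * x.
  move=> x0 hn; rewrite -ler_pdivrMr//; apply/ltW.
  by apply: (lt_le_trans (Num.Theory.truncnS_gt _)); rewrite ler_nat.
rewrite !step1 ?mulr1//; last by rewrite addr0; exact: h.
by rewrite mulNr addrC -mulrBr; exact: h.
Qed.

Lemma C01_cutoff n xi : C01 (cylinder P setT) xi ->
  C01 Q (fun z => cutoff n z.2 * xi z).
Proof.
move=> Cxi; pose F := [set z : V | 1 <= n%:R * z.2 /\ 1 <= n%:R * (T - z.2)].
have [Ct _] := C1_time_comp (C1_cutoff n).
have [C2 _] := C1_time (R := R) m.
have cl : continuous (fun z : V => n%:R * z.2).
  exact: (C1_continuous (C1M (C1_cst n%:R) C2)).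
have cr : continuous (fun z : V => n%:R * (T + (-1) * z.2)).
  exact: (C1_continuous (C1M (C1_cst n%:R) (C1D (C1_cst T) (C1M (C1_cst (-1)) C2)))).
have cF : closed F.
  rewrite (_ : F = (fun z : V => n%:R * z.2) @^-1` [set x | 1 <= x] `&`
     (fun z : V => n%:R * (T + (-1) * z.2)) @^-1` [set x | 1 <= x]).
    by apply: closedI; apply: closed_comp; [move=> z _|exact: closed_ge|move=> z _|exact: closed_ge].
  by apply/seteqP; split => z; rewrite /F /= mulN1r.
have F0 z : ~ F z -> cutoff n z.2 = 0.
  move=> /not_andP[/negP|/negP]; rewrite -ltNge => /ltW h; rewrite /cutoff.
    by rewrite (step0 (x := n%:R * z.2 + 0)) ?addr0// mul0r.
  by rewrite (step0 (x := - n%:R * z.2 + _)) ?mulr0// mulNr addrC -mulrBr.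
apply: C01_sub (C01_restrict cF Ct F0 Cxi) => z [[Oz _] [h1 h2]]; split => //.
have n0 : 0 <= n%:R :> R by [].
by apply/andP; split; rewrite ltNge; apply/negP => h; nra.
Qed.

Lemma cutoff_off n z : cylinder P setT z -> ~ Q z -> cutoff n z.2 = 0.
Proof.
move=> [Oz _] nQ; have n0 : 0 <= n%:R :> R by [].
have : ~ (0 < z.2 < T) by move=> zT; apply: nQ; split.
move=> /negP; rewrite negb_and -!leNgt => /orP[h|h]; rewrite /cutoff.
  by rewrite (step0 (x := n%:R * z.2 + 0)) ?mul0r// addr0; nra.
by rewrite (step0 (x := - n%:R * z.2 + _)) ?mulr0//; nra.
Qed.

(** The family of cut-offs is left general because the treatment of traces uses a second one, which
    cuts at a single end. *)
Lemma cutoff_cvg0 (chi : nat -> R -> R) (D : set V) f :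
  (forall n, class_C 1 setT (chi n)) -> (forall n t, 0 <= chi n t <= 1) ->
  (forall t, 0 < t < T -> \forall n \near \oo, chi n t = 1) ->
  (forall n z, D z -> ~ Q z -> chi n z.2 = 0) ->
  continuous f -> (forall z, ~ D z -> f z = 0) -> L2V f ->
  ip (fun z => (f \_ Q) z - chi n z.2 * f z)
     (fun z => (f \_ Q) z - chi n z.2 * f z) @[n --> \oo] --> 0.
Proof.
move=> Cchi chi01 chi1 chi0 cf f0 Lf; under eq_fun do rewrite ip_subC.
apply: (@ip_dominated _ _ _ vol _ _ (fun z => `|f z|)).
- move=> n; apply: measurable_funM; last by case: Lf.
  apply: continuous_measurable_prod; have [Ct _] := C1_time_comp (Cchi n).
  exact: C1_continuous.
- move=> z; rewrite patchE; case: ifPn => [/set_mem[zT _]|/negP nQ].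
    apply: cvg_near_cst; apply: filterS (chi1 _ zT) => n ->.
    by rewrite mul1r.
  rewrite (_ : (fun n => _) = cst 0); first exact: cvg_cst.
  apply/funext => n; have [Dz|/f0->] := pselect (D z); last by rewrite mulr0.
  by rewrite chi0 ?mul0r// => /mem_set.
- split; first by apply: measurableT_comp => //; case: Lf.
  case: Lf => _; apply: eq_integrable => // z _ /=.
  by rewrite real_normK// num_real.
- move=> n z; have /andP[c0 c1] := chi01 n z.2.
  by rewrite normrM ler_piMl// ger0_norm.
Qed.

(** The norm of $W$ contains no time derivative, so cutting off near $0$ and $T$ costs nothing in
    the limit: membership in $W$ imposes no condition at the two ends. *)
Lemma W_pair_cylinder xi : C01 (cylinder P setT) xi ->
  W_pair P (xi \_ Q) (fun i => ddx i xi \_ Q).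
Proof.
move=> Cxi; have mQ := measurable_QT hP.
have Lxi := C01_L2 Cxi; have Ldxi i := ddx_L2 i Cxi.
split.
- exact: L2_indic.
- by move=> i; exact: L2_indic.
- by move=> z nz; split => [|i]; exact: ext_off.
move=> e e0.
have c1 := cutoff_cvg0 C1_cutoff cutoff_ge0 cutoff_cvg cutoff_off (C1_continuous (C01_C1 Cxi)) (C01_off Cxi) Lxi.
have c2 i := cutoff_cvg0 C1_cutoff cutoff_ge0 cutoff_cvg cutoff_off (@C1_continuous_derive _ _ xi (unit_vec i, 0) (C01_C1 Cxi))
  (@C01_derive_off _ _ _ xi (unit_vec i, 0) Cxi) (Ldxi i).
have c3 : nrm2 (fun z => (xi \_ Q) z - cutoff n z.2 * xi z)
     (fun i z => (ddx i xi \_ Q) z - cutoff n z.2 * ddx i xi z) @[n --> \oo] -->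
     (0 + 0 : R).
  by apply: cvgD => //; exact: cvg_sum0.
rewrite addr0 in c3.
have [N _ hN] := cvgr_lt _ c3 _ e0.
exists (fun z => cutoff N z.2 * xi z); first exact: C01_cutoff.
have := hN N (leqnn N); congr (nrm2 _ _ < _); apply/funext => i; apply/funext => z.
by rewrite ddx_cut//; [exact: C1_cutoff|exact: (C01_C1 Cxi)].
Qed.

End time_shifts.

(** * Time translations on $W$ *)

Section shifts.
Context {R : realType} {m : nat} (P : interface_problem R m).
Hypothesis hP : standing_assumptions P.
Local Notation V := ('rV[R]_m * R)%type.
Local Notation Vm := ('rV[R]_m * measurableTypeR R)%type.
Local Notation vol := (@vol R m).
Local Notation ip := (ip vol).
Local Notation L2V := (L2 vol setT).
Local Notation T := (horizon P).
Local Notation Q := (QT P).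
Implicit Types (w f xi : V -> R) (g : 'I_m -> V -> R).

Definition shiftt (s : R) f : V -> R := fun z => f (translate (0, s) z).

Lemma shifttE s f z : shiftt s f z = f (z.1, z.2 + s).
Proof. by rewrite /shiftt /translate; case: z => x t; congr f; congr pair; rewrite addr0. Qed.

Lemma shifttD s s' f : shiftt s (shiftt s' f) = shiftt (s + s') f.
Proof. by apply/funext => z; rewrite !shifttE /= addrA. Qed.

Lemma L2_shiftt s f : L2V f -> L2V (shiftt s f).
Proof.
move=> [mf intf]; split.
  exact: (measurableT_comp mf (measurable_translate _)).
exact: (integrable_translate (0, s) (f := fun z => f z ^+ 2)).
Qed.

Lemma ip_shiftt s f f' : L2V f -> L2V f' ->
  ip (shiftt s f) (shiftt s f') = ip f f'.
Proof.
move=> Lf Lf'.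
exact: (Rintegral_translate (0, s) (f := fun z => f z * f' z) (L2_mul Lf Lf')).
Qed.

Lemma ip_shiftt_adj s f f' : L2V f -> L2V f' ->
  ip (shiftt s f) f' = ip f (shiftt (- s) f').
Proof.
move=> Lf Lf'; rewrite -(ip_shiftt (- s) (L2_shiftt s Lf) Lf').
rewrite shifttD addNr; congr ip; apply/funext => z.
by rewrite shifttE addr0; case: z.
Qed.

Lemma ip_ext_le f : L2V f -> ip (f \_ Q) (f \_ Q) <= ip f f.
Proof.
move=> Lf; apply: ip_le_ip => //.
  exact: L2_measurable (L2_indic (measurable_QT hP) Lf).
by move=> z; rewrite patchE; case: ifPn => // _; rewrite normr0.
Qed.

Lemma nrm2_ext_shiftt s w g : L2V w -> (forall i, L2V (g i)) ->
  nrm2 (shiftt s w \_ Q) (fun i => shiftt s (g i) \_ Q) <= nrm2 w g.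
Proof.
move=> Lw Lg; rewrite /nrm2 /grad_nrm2; apply: lerD.
  by rewrite -(ip_shiftt s Lw Lw); exact: ip_ext_le (L2_shiftt s _).
apply: ler_sum => i _.
by rewrite -(ip_shiftt s (Lg i) (Lg i)); exact: ip_ext_le (L2_shiftt s _).
Qed.

Lemma grad_nrm2_ext_shiftt s g : (forall i, L2V (g i)) ->
  grad_nrm2 (fun i => shiftt s (g i) \_ Q) <= grad_nrm2 g.
Proof.
move=> Lg; apply: ler_sum => i _.
by rewrite -(ip_shiftt s (Lg i) (Lg i)); exact: ip_ext_le (L2_shiftt s _).
Qed.

Lemma nrm2_shiftt s w g : L2V w -> (forall i, L2V (g i)) ->
  nrm2 (shiftt s w) (fun i => shiftt s (g i)) = nrm2 w g.
Proof.
move=> Lw Lg; rewrite /nrm2 /grad_nrm2 ip_shiftt//; congr (_ + _).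
by apply: eq_bigr => i _; rewrite ip_shiftt.
Qed.

Lemma shiftt_derive s e f z : 'D_e (shiftt s f) z = shiftt s ('D_e f) z.
Proof. by rewrite /shiftt /translate derive_translate. Qed.

Lemma C01_shiftt D s xi : C01 D xi ->
  C01 [set z | D (translate (0, s) z)] (shiftt s xi).
Proof. by move=> Cxi; exact: (C01_translate (0, s) Cxi). Qed.

Lemma C01_shiftt_cylinder (I J : set R) s xi :
  (forall t, I (t + s) -> J t) ->
  C01 (cylinder P I) xi -> C01 (cylinder P J) (shiftt s xi).
Proof.
move=> IJ /(C01_shiftt s); apply: C01_sub => z [] /=.
by rewrite addr0 => Oz /IJ.
Qed.

(** A shifted $C_0^1(Q_T)$ function may stick out of the time interval but keeps compact support in
    $\Omega\times\mathbb R$, so [W_pair_cylinder] applies to it; shifting and restricting do not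
    increase the norm, and closedness does the rest. *)
Lemma W_pair_shiftt s w g : W_pair P w g ->
  W_pair P (shiftt s w \_ Q) (fun i => shiftt s (g i) \_ Q).
Proof.
move=> [Lw Lg w0 H]; have mQ := measurable_QT hP; apply: W_pair_closed.
- by apply: L2_indic => //; exact: L2_shiftt.
- by move=> i; apply: L2_indic => //; exact: L2_shiftt.
- by move=> z nz; split => [|i]; exact: ext_off.
move=> e e0; have [xi Cxi h] := H e e0.
have Lxi := C01_L2 Cxi; have Ldxi i := ddx_L2 i Cxi.
have Cs : C01 (cylinder P setT) (shiftt s xi).
  apply: (@C01_shiftt_cylinder [set t | 0 < t < T]) => //.
  by rewrite -QT_cylinder.
exists (shiftt s xi \_ Q), (fun i => ddx i (shiftt s xi) \_ Q).
split; first exact: W_pair_cylinder.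
apply: (le_lt_trans _ h).
apply: (le_trans _ (nrm2_ext_shiftt s (L2B Lw Lxi) (fun i => L2B (Lg i) (Ldxi i)))).
rewrite le_eqVlt; apply/orP; left; apply/eqP; congr nrm2.
  by rewrite -extB.
apply/funext => i; rewrite -extB; congr patch.
by apply/funext => z; rewrite /ddx shiftt_derive.
Qed.

Lemma norm_time (s : R) : `|((0, s) : V)| = `|s|.
Proof. by rewrite prod_normE /= normr0 max_r. Qed.

Lemma shiftt_cvg0 f K (s : nat -> R) : compact K -> continuous f ->
  (forall z, ~ K z -> f z = 0) -> s n @[n --> \oo] --> 0 -> (forall n, `|s n| <= 1) ->
  ip (fun z => shiftt (s n) f z - f z) (fun z => shiftt (s n) f z - f z) @[n --> \oo]
  --> 0.
Proof.
move=> cK cf f0 s0 s1; have [M [M0 fM]] := compact_support_bounded cK cf f0.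
have [r fr] := compact_support_radius cK f0.
have r'0 : 0 < `|r| + 1 + 1 by rewrite ltr_pwDr.
have mf := continuous_measurable_prod cf.
apply: (@ip_dominated _ _ _ vol _ _ (fun z => M * \1_(ball (0 : V) (`|r| + 1 + 1)) z)).
- by move=> n; exact: (measurableT_comp mf (measurable_translate _)).
- move=> z; have h : translate (0, s n) z @[n --> \oo] --> z + (0 : V).
    apply: cvgD; first exact: cvg_cst.
    apply/cvgrPdist_lt => e e0; move/cvgrPdist_lt : (s0) => /(_ e e0).
    apply: filterS => n; rewrite !sub0r !normrN => sn.
    by rewrite norm_time.
  rewrite addr0 in h; exact: cvg_comp h (cf z).
- apply: L2Z; apply: L2_cst_indic; last exact: vol_ball.
  exact: open_measurable_prod (ball_open _ _).
move=> n z; rewrite indicE; case: (boolP (z \in _)) => [_|].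
  by rewrite mulr1; exact: fM.
rewrite mulr0 notin_setE /= => zB; rewrite /shiftt fr ?normr0//.
rewrite leNgt; apply/negP => zr; apply: zB.
rewrite -ball_normE /ball_/= sub0r normrN.
have := ler_normD (translate (0, s n) z) (- ((0, s n) : V)).
rewrite {1}/translate addrK normrN.
have : `|((0, s n) : V)| <= 1.
  by rewrite norm_time.
have := ler_norm r; lra.
Qed.

(** Continuity of translations: by [shiftt_cvg0] for a smooth approximation, then for the pair
    because shifts are isometries. *)
Lemma nrm2_shift_cvg w g e : W_pair P w g -> 0 < e ->
  exists2 delta, 0 < delta & forall s, 0 <= s -> s < delta ->
    nrm2 (fun z => shiftt s w z - w z) (fun i z => shiftt s (g i) z - g i z) < e.
Proof.
move=> [Lw Lg _ H] e0.
have e80 : 0 < e / 16 by rewrite divr_gt0.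
have [xi Cxi h] := H _ e80.
have [C1xi [K [cK _] xi0]] := Cxi.
have Lxi := C01_L2 Cxi; have Ldxi i := ddx_L2 i Cxi.
(* Failure at every scale $1/(n+1)$ would give a sequence of shifts tending to 0, to which dominated
   convergence applies. *)
apply: contrapT => /forall2NP hN.
have {}hN n : exists s, [/\ 0 <= s, s < n.+1%:R^-1 &
    e <= nrm2 (fun z => shiftt s w z - w z) (fun i z => shiftt s (g i) z - g i z)].
  have [|/existsNP[s /not_implyP[s0 /not_implyP[s1 /negP]]]] := hN n.+1%:R^-1.
    by rewrite invr_gt0.
  by rewrite -leNgt => hs; exists s.
have [s hs] := choice hN.
have s_cvg : s n @[n --> \oo] --> 0.
  apply: (@squeeze_cvgr _ _ _ _ (cst 0) (fun n => n.+1%:R^-1)).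
  - by apply: nearW => n; have [-> /ltW ->] := hs n.
  - exact: cvg_cst.
  - exact: cvg_harmonic.
have s1 n : `|s n| <= 1.
  have [s0 sn _] := hs n; rewrite ger0_norm// (le_trans (ltW sn))//.
  by rewrite invf_le1// ler1n.
have c1 := shiftt_cvg0 cK (C1_continuous C1xi) xi0 s_cvg s1.
have c2 i := shiftt_cvg0 cK (@C1_continuous_derive _ _ xi (unit_vec i, 0) C1xi)
  (@derive_compact_support _ _ xi K (unit_vec i, 0) cK xi0) s_cvg s1.
have c3 : nrm2 (fun z => shiftt (s n) xi z - xi z)
     (fun i z => shiftt (s n) (ddx i xi) z - ddx i xi z) @[n --> \oo] --> (0 + 0 : R).
  by apply: cvgD => //; exact: cvg_sum0.
rewrite addr0 in c3.
have [N _ hN'] := cvgr_lt _ c3 _ e80; have := hN' N (leqnn N) => /= hN''.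
have [_ _] := hs N; apply/negP; rewrite -ltNge; set sN := s N in hN'' *.
have L1 := L2B Lw Lxi; have L2' i := L2B (Lg i) (Ldxi i).
have L1s := L2_shiftt sN L1; have L2s i := L2_shiftt sN (L2' i).
have L3 := L2B (L2_shiftt sN Lxi) Lxi.
have L4 i := L2B (L2_shiftt sN (Ldxi i)) (Ldxi i).
have n1 := nrm2D L3 (L2N L1) L4 (fun i => L2N (L2' i)).
have n2 := nrm2D L1s (L2D L3 (L2N L1)) L2s (fun i => L2D (L4 i) (L2N (L2' i))).
rewrite (nrm2_shiftt sN L1 L2') in n2.
have En : nrm2 (fun z => - (w z - xi z)) (fun i z => - (g i z - ddx i xi z)) =
          nrm2 (fun z => w z - xi z) (fun i z => g i z - ddx i xi z).
  rewrite -[RHS]mul1r -(expr1n _ 2) -(sqrrN 1) -nrm2Z//; congr nrm2.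
    by apply/funext => z; rewrite mulN1r.
  by apply/funext => i; apply/funext => z; rewrite mulN1r.
rewrite En in n1.
rewrite (_ : nrm2 _ _ = nrm2
   (fun z => shiftt sN (fun z => w z - xi z) z + (shiftt sN xi z - xi z + - (w z - xi z)))
   (fun i z => shiftt sN (fun z => g i z - ddx i xi z) z +
      (shiftt sN (ddx i xi) z - ddx i xi z + - (g i z - ddx i xi z)))); last first.
  by congr nrm2; [|apply/funext => i]; apply/funext => z; rewrite !shifttE; ring.
lra.
Qed.

End shifts.

(** * Bounded functionals on $W$ and uniqueness of the time derivative *)

Section dual.
Context {R : realType} {m : nat} (P : interface_problem R m).
Hypothesis hP : standing_assumptions P.
Local Notation V := ('rV[R]_m * R)%type.
Local Notation Vm := ('rV[R]_m * measurableTypeR R)%type.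
Local Notation vol := (@vol R m).
Local Notation ip := (ip vol).
Local Notation L2V := (L2 vol setT).
Local Notation T := (horizon P).
Local Notation Q := (QT P).
Implicit Types (w f xi : V -> R) (g : 'I_m -> V -> R) (F : (V -> R) -> R).

Definition kmin : R := Num.min (kappa1 P) (kappa2 P).
Definition kmax : R := Num.max (kappa1 P) (kappa2 P).

Lemma kmin_gt0 : 0 < kmin.
Proof. by rewrite lt_min (kappa1_gt0 hP) (kappa2_gt0 hP). Qed.

Lemma kappa_bounds z : kmin <= kappa P z <= kmax.
Proof. by rewrite /kappa /kmin /kmax; case: ifPn => _; rewrite ge_min le_max !lexx ?orbT. Qed.

Lemma kappa_le z : `|kappa P z| <= kmax.
Proof.
have /andP[h1 h2] := kappa_bounds z.
by rewrite ger0_norm// (le_trans (ltW kmin_gt0)).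
Qed.

Lemma kmax_gt0 : 0 < kmax.
Proof. by have /andP[h1 h2] := kappa_bounds 0; rewrite (lt_le_trans kmin_gt0)// (le_trans h1). Qed.

Lemma measurable_kappa : measurable_fun (setT : set Vm) (kappa P).
Proof.
have mQ1 : measurable (Q1 P : set Vm) := open_measurable_prod (Q1_open hP).
rewrite (_ : kappa P = (fun z => kappa2 P + (kappa1 P - kappa2 P) * \1_(Q1 P) z)).
  by apply: measurable_funD => //; apply: measurable_funM.
apply/funext => z; rewrite /kappa indicE; case: (z \in Q1 P).
  by rewrite mulr1 subrKC.
by rewrite mulr0 addr0.
Qed.

Lemma L2_kappa f : L2V f -> L2V (fun z => kappa P z * f z).
Proof. exact: L2_bmul measurable_kappa kappa_le. Qed.

Lemma grad0_L2 w i : W_space P w -> L2V (grad0 P w i).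
Proof. by move=> [Hw _]; have [_] := H10_L2 hP Hw. Qed.

Lemma W_space_L2 w : W_space P w -> L2V (w \_ Q).
Proof. by move=> [Hw _]; have [] := H10_L2 hP Hw. Qed.

Lemma ext_sum (I : finType) (f : I -> V -> R) :
  (fun z => \sum_i f i z) \_ Q = fun z => \sum_i (f i \_ Q) z.
Proof.
apply/funext => z; rewrite patchE; case: ifPn => [Qz|nQz].
  by apply: eq_bigr => i _; rewrite patchE Qz.
by rewrite big1// => i _; rewrite patchE (negbTE nQz).
Qed.

Lemma Rintegral_sum (I : eqType) (s : seq I) (f : I -> V -> R) :
  (forall i, vol.-integrable setT (EFin \o f i)) ->
  \int[vol]_z (\sum_(i <- s) f i z) = \sum_(i <- s) \int[vol]_z f i z /\
  vol.-integrable setT (EFin \o (fun z => \sum_(i <- s) f i z)).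
Proof.
move=> intf; elim: s => [|i s [ih ihi]].
  rewrite big_nil; split.
    by under eq_Rintegral do rewrite big_nil; rewrite Rintegral_cst ?mul0r.
  by under eq_fun do rewrite big_nil; exact: integrable0.
rewrite big_cons -ih -RintegralD//; split.
  by under eq_Rintegral do rewrite big_cons.
under eq_fun do rewrite big_cons.
exact: (integrableD measurableT (intf i) ihi).
Qed.

Lemma W_formE w w' : W_space P w -> W_space P w' ->
  W_form P w w' =
  \sum_(i < m) ip (fun z => kappa P z * grad0 P w i z) (grad0 P w' i).
Proof.
move=> Ww Ww'; rewrite /W_form /intQ Rintegral_mkcond.
have Lk i := L2_kappa (grad0_L2 i Ww).
have [<- _] := Rintegral_sum (index_enum 'I_m) (fun i => L2_mul (Lk i) (grad0_L2 i Ww')).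
apply: eq_Rintegral => z _; rewrite /grad0 patchE; case: ifPn => [Qz|nQz].
  by rewrite /dotp mulr_sumr; apply: eq_bigr => i _; rewrite !patchE Qz mulrA.
by rewrite big1// => i _; rewrite !patchE (negbTE nQz) mulr0.
Qed.

Lemma W_form_bounds w : W_space P w ->
  kmin * grad_nrm2 (grad0 P w) <= W_form P w w <= kmax * grad_nrm2 (grad0 P w).
Proof.
move=> Ww; rewrite W_formE// /grad_nrm2 !mulr_sumr.
have h i : kmin * ip (grad0 P w i) (grad0 P w i) <=
    ip (fun z => kappa P z * grad0 P w i z) (grad0 P w i) <=
    kmax * ip (grad0 P w i) (grad0 P w i).
  have Lg := grad0_L2 i Ww; have Lk := L2_kappa Lg.
  rewrite -!ipZl//; apply/andP; split; apply: le_Rintegral => //;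
    try (by apply: L2_mul => //; exact: L2Z);
  move=> z _; have /andP[k1 k2] := kappa_bounds z;
  by rewrite -!mulrA -expr2 ler_wpM2r// sqr_ge0.
by apply/andP; split; apply: ler_sum => i _; have /andP[] := h i.
Qed.

Lemma W_norm_sqr w : W_space P w -> W_norm P w ^+ 2 = W_form P w w.
Proof.
move=> Ww; rewrite /W_norm sqr_sqrtr//.
have /andP[h _] := W_form_bounds Ww; apply: le_trans h.
by rewrite mulr_ge0 ?grad_nrm2_ge0// ltW// kmin_gt0.
Qed.

(** Boundedness is rewritten with squares and without $\kappa$, the form suited to density
    arguments; [bound_W_dual] is the way back. *)
Lemma W_dual_bound F : W_dual P F -> exists2 C, 0 <= C &
  forall w, W_space P w -> F w ^+ 2 <= C * grad_nrm2 (grad0 P w).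
Proof.
move=> [_ [C FC]]; have k0 := kmax_gt0.
exists (C ^+ 2 * kmax) => [|w Ww]; first by rewrite mulr_ge0 ?sqr_ge0// ltW.
have /andP[_ h] := W_form_bounds Ww.
have h1 := FC w Ww; have h2 : F w ^+ 2 <= (C * W_norm P w) ^+ 2.
  rewrite -(real_normK (num_real (F w))) -(real_normK (num_real (C * _))).
  by rewrite lerXn2r ?nnegrE// (le_trans h1)// ler_norm.
apply: (le_trans h2); rewrite exprMn W_norm_sqr// -[leRHS]mulrA.
by rewrite ler_wpM2l ?sqr_ge0.
Qed.

Lemma bound_W_dual F C : 0 <= C ->
  (forall c w1 w2, W_space P w1 -> W_space P w2 ->
     F (fun z => c * w1 z + w2 z) = c * F w1 + F w2) ->
  (forall w, W_space P w -> F w ^+ 2 <= C * grad_nrm2 (grad0 P w)) -> W_dual P F.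
Proof.
move=> C0 Fl FC; split => //; have k0 := kmin_gt0.
exists (Num.sqrt (C / kmin)) => w Ww; rewrite -sqrtr_sqr -sqrtrM ?divr_ge0 ?(ltW k0)//.
have /andP[h _] := W_form_bounds Ww.
apply: ler_wsqrtr; apply: (le_trans (FC w Ww)).
rewrite -mulrA ler_wpM2l// mulrC ler_pdivlMr// mulrC.
exact: h.
Qed.

(** The norm of $W$ sees only gradients. This makes a functional, which takes functions and not
    classes as arguments, blind to null sets. *)
Lemma W_dual_ae F w w' : W_dual P F -> W_space P w -> W_space P w' ->
  (forall i, ae_eq vol setT (grad0 P w i) (grad0 P w' i)) -> F w = F w'.
Proof.
move=> DF Ww Ww' gg'; have [C C0 FC] := W_dual_bound DF; have [Fl _] := DF.
have [Wd gd] := W_space_lin hP (-1) Ww' Ww.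
have := FC _ Wd; rewrite Fl// (_ : grad_nrm2 _ = 0) ?mulr0.
  rewrite mulN1r addrC => h; apply/eqP; rewrite -subr_eq0 -sqrf_eq0 eq_le h.
  exact: sqr_ge0.
rewrite /grad_nrm2 big1// => i _.
have L := grad0_L2 i Wd.
have z0 : ae_eq vol setT (grad0 P (fun z => -1 * w' z + w z) i) (fun=> 0).
  by apply: filterS2 (gd i) (gg' i) => z h1 h2 _; rewrite h1// h2// mulN1r addrC subrr.
by rewrite (ip_ae L (L20 vol) L z0) ip0l.
Qed.

Lemma W_space_ext_eq w w' : W_space P w -> w \_ Q = w' \_ Q ->
  W_space P w' /\ forall i, ae_eq vol setT (grad0 P w' i) (grad0 P w i).
Proof. by move=> /(W_space_pair hP) + E; rewrite E => /(W_pair_space hP). Qed.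

Lemma W_dual_ext_eq F w w' : W_dual P F -> W_space P w -> w \_ Q = w' \_ Q ->
  F w = F w'.
Proof.
move=> DF Ww E; have [Ww' gg] := W_space_ext_eq Ww E.
by apply: (W_dual_ae DF) => // i; apply: filterS (gg i) => z h _; rewrite h.
Qed.

(** Density of $C_0^1$ in $W$; it makes the choice behind [time_deriv] immaterial. *)
Lemma W_dual_unique F F' : W_dual P F -> W_dual P F' ->
  (forall xi, C01 Q xi -> F xi = F' xi) -> forall w, W_space P w -> F w = F' w.
Proof.
move=> DF DF' FF' w Ww; have [C C0 FC] := W_dual_bound DF.
have [C' C'0 FC'] := W_dual_bound DF'; have [Fl _] := DF; have [Fl' _] := DF'.
apply/eqP; rewrite -subr_eq0 -sqrf_eq0 eq_le sqr_ge0 andbT.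
apply: (@le_epsilon_scaled _ _ _ (2 * C + 2 * C')); first by lra.
move=> e e0; have [_ _ _ H] := W_space_pair hP Ww.
have [xi Cxi h] := H e e0; have [Wxi gxi] := W_space_C01 hP Cxi.
have [Wd gd] := W_space_lin hP (-1) Wxi Ww.
have g : grad_nrm2 (grad0 P (fun z => -1 * xi z + w z)) <= e.
  apply: (le_trans _ (ltW h)); apply: (le_trans _ (grad_le_nrm2 _ _)).
  rewrite le_eqVlt; apply/orP; left; apply/eqP; apply: eq_bigr => i _.
  have L1 := grad0_L2 i Wd; have L2' := L2B (grad0_L2 i Ww) (ddx_L2 i Cxi).
  have ae : ae_eq vol setT (grad0 P (fun z => -1 * xi z + w z) i)
      (fun z => grad0 P w i z - ddx i xi z).
    apply: filterS2 (gd i) (gxi i) => z h1 h2 _.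
    by rewrite h1// h2// mulN1r addrC.
  by rewrite (ip_ae L1 L2' L1 ae) ipC (ip_ae L1 L2' L2' ae).
have f1 := FC _ Wd; have f2 := FC' _ Wd.
have -> : F w - F' w = F (fun z => -1 * xi z + w z) - F' (fun z => -1 * xi z + w z).
  by rewrite Fl// Fl'// (FF' _ Cxi); ring.
set a := F _ in f1 *; set b := F' _ in f2 *; rewrite add0r.
have l1 : C * grad_nrm2 (grad0 P (fun z => -1 * xi z + w z)) <= C * e by rewrite ler_wpM2l.
have l2 : C' * grad_nrm2 (grad0 P (fun z => -1 * xi z + w z)) <= C' * e by rewrite ler_wpM2l.
have := sqr_ge0 (a + b); lra.
Qed.

Lemma time_derivP w : U_space P w -> is_time_deriv P w (time_deriv P w).
Proof. by move=> [_ ex]; exact: xgetPex ex. Qed.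

Lemma time_deriv_unique w F : is_time_deriv P w F ->
  forall phi, W_space P phi -> time_deriv P w phi = F phi.
Proof.
move=> h; have [D1 h1] : is_time_deriv P w (time_deriv P w) by apply: xgetPex; exists F.
have [D2 h2] := h; apply: W_dual_unique => // xi Cxi.
by rewrite h1// h2.
Qed.

Lemma intQ_ddt w xi : C01 Q xi ->
  intQ P (fun z => w z * ddt xi z) = ip (w \_ Q) (ddt xi).
Proof.
move=> Cxi; rewrite intQ_mul; congr ip; apply: ext_id.
exact: C01_derive_off Cxi.
Qed.

End dual.

(** * Time derivatives through one-sided difference quotients *)

Section difference_quotients.
Context {R : realType} {m : nat} (P : interface_problem R m).
Hypothesis hP : standing_assumptions P.
Local Notation V := ('rV[R]_m * R)%type.
Local Notation Vm := ('rV[R]_m * measurableTypeR R)%type.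
Local Notation vol := (@vol R m).
Local Notation ip := (ip vol).
Local Notation L2V := (L2 vol setT).
Local Notation T := (horizon P).
Local Notation Q := (QT P).
Implicit Types (w f xi : V -> R) (g : 'I_m -> V -> R) (F : (V -> R) -> R).

Lemma L2_integrable_QT w : L2V w -> (forall z, ~ Q z -> w z = 0) ->
  vol.-integrable setT (EFin \o w).
Proof.
move=> Lw w0; rewrite -(ext_id w0).
by apply: L2_integrable_restrict => //; [exact: measurable_QT|exact: QT_finite].
Qed.

(** Differentiation under the integral sign. The dominating function is a multiple of the absolute
    value of [w], integrable because $Q_T$ has finite volume. *)
Lemma is_derive_ip_shiftt w xi D (c a : R) : L2V w ->
  (forall z, ~ Q z -> w z = 0) -> C01 D xi ->
  is_derive a 1 (fun h => ip w (shiftt (c * h) xi))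
                (c * ip w (shiftt (c * a) (ddt xi))).
Proof.
move=> Lw w0 Cxi; have Cxi1 := C01_C1 Cxi.
have [M [M0 xiM]] := C01_derive_bounded ((0, 1) : V) Cxi.
have iw := L2_integrable_QT Lw w0.
pose f (h : R) (z : Vm) := w z * shiftt (c * h) xi z.
have Dz (h : R) (z : V) : is_derive h 1 (fun h => shiftt (c * h) xi z)
    (c * shiftt (c * h) (ddt xi) z).
  have E h' : translate (0, c * h') z = z + h' *: ((0, c) : V).
    by rewrite /translate; congr (_ + _); congr pair; rewrite /= ?scaler0// mulrC.
  have d0 : derivable xi (z + h *: ((0, c) : V)) (0, c) by exact: C1_derivable.
  have := is_derive_line d0.
  rewrite /shiftt; under eq_fun do rewrite -E; rewrite -E.
  congr is_derive; have dxi := C1_diff Cxi1 (translate (0, c * h) z).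
  rewrite /ddt !deriveE// (_ : ((0, c) : V) = c *: ((0, 1) : V)) ?linearZ//.
  by congr pair; rewrite /= ?scaler0// [RHS]mulr1.
have Df (h : R) (z : V) : is_derive h 1 (f ^~ z) (w z * (c * shiftt (c * h) (ddt xi) z)).
  by apply: is_deriveZ; exact: Dz.
have intf (h : R) : `]a - 1, a + 1[%classic h -> vol.-integrable setT (EFin \o f h).
  move=> _; apply: L2_mul => //; apply: L2_shiftt; exact: C01_L2 Cxi.
have derf (h : R) (z : V) : `]a - 1, a + 1[%classic h -> setT z -> derivable (f ^~ z) h 1.
  by move=> _ _; case: (Df h z).
pose G z := `|w z| * (`|c| * M).
have G0 z : 0 <= G z by rewrite !mulr_ge0.
have iG : vol.-integrable setT (EFin \o G).
  have := integrableZl measurableT (`|c| * M) (integrable_norm iw).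
  by apply: eq_integrable => // z _ /=; rewrite -EFinM mulrC.
have pE (h : R) (z : V) : partial1of2 f h z = w z * (c * shiftt (c * h) (ddt xi) z).
  by rewrite /partial1of2 derive1E; case: (Df h z).
have bd (h : R) (z : V) : `]a - 1, a + 1[%classic h -> setT z -> `|partial1of2 f h z| <= G z.
  by move=> _ _; rewrite pE /G !normrM !ler_wpM2l//; exact: xiM.
have ain : `]a - 1, a + 1[%classic a by rewrite /= in_itv/= ltrBlDr ltrDl ltr01.
have := cvg_differentiation_under_integral measurableT ain intf derf G0 iG bd.
have -> : \int[vol]_z partial1of2 f a z = c * ip w (shiftt (c * a) (ddt xi)).
  rewrite -ipZr//; last by apply: L2_shiftt; exact: C01_derive_L2 Cxi.
  by apply: eq_Rintegral => z _; rewrite pE.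
move=> H.
have {}H : h^-1 *: (((fun h => ip w (shiftt (c * h) xi)) \o shift a) (h *: 1) -
   ip w (shiftt (c * a) xi)) @[h --> 0^'] --> c * ip w (shiftt (c * a) (ddt xi)).
  apply: cvg_trans H; apply: near_eq_cvg; apply: nearW => h /=.
  by rewrite [h *: 1]mulr1.
by split; [apply/cvg_ex; eexists; exact: H|exact: cvg_lim H].
Qed.

(* [sg] is 1 or -1 according as the functions [shiftt (sg * h) xi], for
   [xi] in [C01 QT] and [0 <= h], vanish near [T] or near [0]. *)
Definition one_sided w F (sg : R) : Prop :=
  forall xi h, C01 Q xi -> 0 <= h ->
    F (shiftt (sg * h) xi) = - ip w (ddt (shiftt (sg * h) xi)).

Variables (w : V -> R) (F : (V -> R) -> R) (sg : R).
Hypotheses (Lw : L2V w) (w0 : forall z, ~ Q z -> w z = 0) (DF : W_dual P F)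
  (osF : one_sided w F sg) (sg1 : sg ^+ 2 = 1).

Lemma W_space_shiftt s xi : C01 Q xi -> W_space P (shiftt s xi) /\
  grad_nrm2 (grad0 P (shiftt s xi)) <= grad_nrm2 (fun i => ddx i xi).
Proof.
move=> Cxi; have [Ws gs] := W_pair_space hP (W_pair_shiftt hP s (W_pair_C01 Cxi)).
split => //.
apply: (le_trans _ (grad_nrm2_ext_shiftt hP s (fun i => ddx_L2 i Cxi))).
rewrite le_eqVlt; apply/orP; left; apply/eqP; apply: eq_bigr => i _.
have L1 := grad0_L2 hP i Ws.
have L2' : L2V (shiftt s (ddx i xi) \_ Q).
  apply: L2_indic; first exact: measurable_QT.
  by apply: L2_shiftt; exact: ddx_L2 Cxi.
by rewrite (ip_ae L1 L2' L1 (gs i)) ipC (ip_ae L1 L2' L2' (gs i)).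
Qed.

(** Mean value theorem for the pairing of [w] with the shifted [xi]: by one-sidedness its derivative
    at an intermediate $c$ is, up to sign, [F] at a shifted [xi], and shifting does not increase the
    gradient norm. *)
Lemma one_sided_bound_C01 : exists2 C, 0 <= C & forall xi h, C01 Q xi -> 0 < h ->
  ip w (fun z => shiftt (sg * h) xi z - xi z) ^+ 2 <=
  C * h ^+ 2 * grad_nrm2 (fun i => ddx i xi).
Proof.
have [C C0 FC] := W_dual_bound hP DF; exists C => // xi h Cxi h0.
have Lxi := C01_L2 Cxi.
pose H (h : R) := ip w (shiftt (sg * h) xi).
have dH (a : R) := is_derive_ip_shiftt sg a Lw w0 Cxi.
have cH : {within `[0, h], continuous H}.
  by apply: derivable_within_continuous => x _; case: (dH x).
have [c] := MVT h0 (fun x _ => dH x) cH; rewrite in_itv/= => /andP[c0 ch].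
rewrite -/(H h) -/(H 0) subr0 => E.
have -> : ip w (fun z => shiftt (sg * h) xi z - xi z) = H h - H 0.
  rewrite ipBr//; last exact: L2_shiftt.
  congr (_ - _); rewrite /H mulr0; congr ip; apply/funext => -[x t].
  by rewrite shifttE addr0.
rewrite E !exprMn sg1 mul1r mulrC [C * _]mulrC -[leRHS]mulrA.
apply: ler_wpM2l; first exact: sqr_ge0.
have := osF Cxi (ltW c0).
have -> : ddt (shiftt (sg * c) xi) = shiftt (sg * c) (ddt xi).
  by apply/funext => z; exact: shiftt_derive.
move/eqP; rewrite -eqr_oppLR => /eqP <-; rewrite sqrrN.
have [Ws gs] := W_space_shiftt (sg * c) Cxi.
by apply: (le_trans (FC _ Ws)); rewrite ler_wpM2l.
Qed.

Lemma one_sided_bound : exists2 C, 0 <= C & forall phi g h, W_pair P phi g -> 0 < h ->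
  ip w (fun z => shiftt (sg * h) phi z - phi z) ^+ 2 <= C * h ^+ 2 * grad_nrm2 g.
Proof.
have [C C0 FC] := one_sided_bound_C01; exists (4 * C) => [|phi g h]; first by rewrite mulr_ge0.
move=> [Lp Lg _ Happ] h0; pose W := ip w w.
have W0 : 0 <= W by exact: ip_ge0.
(* From $(x+y)^2\le2x^2+2y^2$ with $x^2\le Ch^2(2e+2\|g\|^2)$ and $y^2\le4We$. *)
apply: (@le_epsilon_scaled _ _ _ (8 * W + 4 * C * h ^+ 2)).
  by have := mulr_ge0 C0 (sqr_ge0 h); lra.
move=> e e0; have [xi Cxi hxi] := Happ e e0.
have Lxi := C01_L2 Cxi; have Ldxi i := ddx_L2 i Cxi.
have Lps := L2_shiftt (sg * h) Lp; have Lxs := L2_shiftt (sg * h) Lxi.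
have Ld := L2B Lp Lxi; have Lds := L2_shiftt (sg * h) Ld.
have -> : ip w (fun z => shiftt (sg * h) phi z - phi z) =
  ip w (fun z => shiftt (sg * h) xi z - xi z) +
  ip w (fun z => shiftt (sg * h) (fun z => phi z - xi z) z - (phi z - xi z)).
  rewrite -ipDr//; [|exact: L2B|exact: L2B].
  by congr ip; apply/funext => z; rewrite !shifttE; ring.
have b1 := FC xi h Cxi h0.
have b2 := ip_cauchy_schwarz Lw (L2B Lds Ld).
have b3 := ipDle Lds (L2N Ld).
rewrite (ip_shiftt (sg * h) Ld Ld) ipNl ?ipNr// in b3; last exact: L2N.
rewrite opprK in b3.
have b4 := ip_le_nrm2 (fun z => phi z - xi z) (fun i z => g i z - ddx i xi z).
have b5 := grad_nrm2D (fun i => L2N (L2B (Lg i) (Ldxi i))) Lg.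
have E2 : (fun i y => - (g i y - ddx i xi y) + g i y) = (fun i => ddx i xi).
  by apply/funext => i; apply/funext => y; rewrite opprB subrK.
have E3 : grad_nrm2 (fun i y => - (g i y - ddx i xi y)) =
          grad_nrm2 (fun i y => (g i y - ddx i xi y)).
  apply: eq_bigr => i _; rewrite ipNl ?ipNr ?opprK//; try exact: L2B.
  exact/L2N/L2B.
rewrite E2 E3 in b5.
have b6 := grad_le_nrm2 (fun z => phi z - xi z) (fun i z => g i z - ddx i xi z).
set x := ip w _ in b1 *; set y := ip w _ in b2 *.
set d := ip (fun z => phi z - xi z) _ in b3 b4.
set N := nrm2 _ _ in hxi b4 b6.
set gx := grad_nrm2 (fun i => ddx i xi) in b1 b5.
set gd := grad_nrm2 (fun i z => g i z - ddx i xi z) in b5 b6.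
set gg := grad_nrm2 g in b5 *.
have h2 : 0 <= h ^+ 2 by exact: sqr_ge0.
have c1 : C * h ^+ 2 * gx <= C * h ^+ 2 * (2 * e + 2 * gg).
  apply: ler_wpM2l; first exact: mulr_ge0.
  lra.
have c2 : y ^+ 2 <= W * (4 * e).
  apply: (le_trans b2); rewrite ler_wpM2l//; apply: (le_trans b3); lra.
by have := sqr_ge0 (x - y); lra.
Qed.

Definition diffq n phi : R :=
  n.+1%:R * ip w (fun z => shiftt (sg * n.+1%:R^-1) phi z - phi z).

Lemma diffq_cvg_C01 xi : C01 Q xi -> diffq n xi @[n --> \oo] --> - sg * F xi.
Proof.
move=> Cxi; have Lxi := C01_L2 Cxi.
have s0 (f : V -> R) : shiftt (sg * 0) f = f.
  by apply/funext => -[x t]; rewrite shifttE mulr0 addr0.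
have [d0 dE] := is_derive_ip_shiftt sg 0 Lw w0 Cxi.
have -> : - sg * F xi = sg * ip w (shiftt (sg * 0) (ddt xi)).
  have := osF Cxi (lexx 0); rewrite !s0 => ->; by rewrite mulrNN.
rewrite -dE; have /cvg_ex[l hl] := d0.
have -> : 'D_1 (fun h => ip w (shiftt (sg * h) xi)) 0 = l by exact: cvg_lim hl.
have hn : (fun n : nat => n.+1%:R^-1 : R) @ \oo --> 0^'.
  move=> A [/= d' d'0 dA]; have [N _ HN] := near_infty_natSinv_lt (PosNum d'0).
  exists N => // n Nn; apply: dA; last by rewrite /= invr_eq0.
  by rewrite /ball_/= sub0r normrN ger0_norm ?invr_ge0//; exact: HN.
rewrite (_ : diffq ^~ xi = (fun h => h^-1 *: (((fun h => ip w (shiftt (sg * h) xi)) \o shift 0) (h *: 1) -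
   ip w (shiftt (sg * 0) xi))) \o (fun n : nat => n.+1%:R^-1 : R)).
  exact: cvg_comp hn hl.
apply/funext => n; rewrite /diffq /= invrK s0 addr0 [_ *: 1]mulr1 ipBr//.
exact: L2_shiftt.
Qed.

(** The functionals [diffq n] are bounded on $W$ uniformly in [n] by [one_sided_bound] and converge
    on $C_0^1$; hence they converge on all of $W$. Every value of the time derivative thus becomes a
    limit of shifts. *)
Lemma diffq_cvg phi : W_space P phi ->
  diffq n (phi \_ Q) @[n --> \oo] --> - sg * F phi.
Proof.
move=> Wphi; have [C C0 HC] := one_sided_bound.
have [C' C'0 HC'] := W_dual_bound hP DF; have [Fl _] := DF.
have := W_space_pair hP Wphi => -[Lp Lg _ Happ].
apply/cvgrPdist_lt => e e0.
pose d := e / 3; have d0 : 0 < d by rewrite divr_gt0.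
have CC : 0 < C + C' + 1 by rewrite ltr_pwDr// addr_ge0.
(* Small enough for the constant [C] of the quotients and the constant [C'] of [F] at once. *)
pose d2 := d ^+ 2 / (C + C' + 1).
have d20 : 0 < d2 by rewrite divr_gt0// exprn_gt0.
have [xi Cxi hxi] := Happ d2 d20.
have Lxi := C01_L2 Cxi; have Ldxi i := ddx_L2 i Cxi.
have [Wxi gxi] := W_space_C01 hP Cxi.
have [Wd gd] := W_space_lin hP (-1) Wxi Wphi.
have Pd : W_pair P (fun z => -1 * xi z + (phi \_ Q) z)
    (fun i z => -1 * ddx i xi z + grad0 P phi i z).
  exact: W_pair_lin (W_pair_C01 Cxi) (W_space_pair hP Wphi).
have gle : grad_nrm2 (fun i z => -1 * ddx i xi z + grad0 P phi i z) <= d2.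
  apply: (le_trans _ (ltW hxi)); apply: (le_trans _ (grad_le_nrm2 _ _)).
  rewrite le_eqVlt; apply/orP; left; apply/eqP; congr grad_nrm2.
  by apply/funext => i; apply/funext => z; rewrite mulN1r addrC.
have gle' : grad_nrm2 (grad0 P (fun z => -1 * xi z + phi z)) <= d2.
  apply: (le_trans _ gle); rewrite le_eqVlt; apply/orP; left; apply/eqP.
  apply: eq_bigr => i _; have L1 := grad0_L2 hP i Wd.
  have L2' : L2V (fun z => -1 * ddx i xi z + grad0 P phi i z).
    by apply: L2D; [exact: L2Z|exact: Lg].
  have ae : ae_eq vol setT (grad0 P (fun z => -1 * xi z + phi z) i)
      (fun z => -1 * ddx i xi z + grad0 P phi i z).
    by apply: filterS2 (gd i) (gxi i) => z h1 h2 _; rewrite h1// h2.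
  by rewrite (ip_ae L1 L2' L1 ae) ipC (ip_ae L1 L2' L2' ae).
have small (x K : R) : 0 <= K -> K <= C + C' + 1 -> x ^+ 2 <= K * d2 -> `|x| <= d.
  move=> K0 KC xK; rewrite -(@ler_pXn2r _ 2)// ?nnegrE ?(ltW d0)//.
  rewrite real_normK ?num_real// (le_trans xK)//.
  rewrite /d2 mulrCA -[leRHS]mulr1 ler_wpM2l ?sqr_ge0//.
  by rewrite ler_pdivrMr// mul1r.
have [N _ hN] := (@cvgrPdist_lt _ _ _ _ _ _ _).1 (diffq_cvg_C01 Cxi) d d0.
exists N => // n Nn; have h1 := hN n Nn.
have n0 : 0 < n.+1%:R^-1 :> R by rewrite invr_gt0.
have h2 : `|diffq n (fun z => -1 * xi z + (phi \_ Q) z)| <= d.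
  apply: (small _ C) => //; first by lra.
  rewrite /diffq exprMn; have := HC _ _ _ Pd n0.
  rewrite -(ler_pM2l (x := n.+1%:R ^+ 2)) ?exprn_gt0// => /le_trans; apply.
  rewrite exprVn mulrA mulrCA mulfV ?mulr1 ?expf_neq0//.
  by rewrite ler_wpM2l.
have h3 : `|F (fun z => -1 * xi z + phi z)| <= d.
  apply: (small _ C') => //; first by lra.
  by apply: (le_trans (HC' _ Wd)); rewrite ler_wpM2l.
have sgn : `|sg| = 1.
  by apply/eqP; rewrite -(@eqrXn2 _ 2)// expr1n real_normK ?num_real// sg1.
have E1 : diffq n (phi \_ Q) = diffq n (fun z => -1 * xi z + (phi \_ Q) z) + diffq n xi.
  rewrite /diffq -mulrDr -ipDr//.
  - by congr (_ * ip _ _); apply/funext => z; rewrite !shifttE; ring.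
  - by apply: L2B; [apply: L2_shiftt|]; apply: L2D => //; exact: L2Z.
  - by apply: L2B => //; exact: L2_shiftt.
have E2 : F phi = F (fun z => -1 * xi z + phi z) + F xi by rewrite Fl//; ring.
rewrite E1 E2.
have -> : forall a b c d : R, - sg * (a + b) - (c + d) = - sg * a + (- sg * b - d) - c.
  by move=> *; ring.
apply: (le_lt_trans (ler_normB _ _)).
have := ler_normD (- sg * F (fun z => -1 * xi z + phi z)) (- sg * F xi - diffq n xi).
rewrite normrM normrN sgn mul1r.
have : e = d + d + d by rewrite /d; field.
lra.
Qed.

End difference_quotients.

(** * Slices at fixed time, and smallness near a time of zero trace *)

Section slices.
Context {R : realType} {m : nat}.
Local Notation V := ('rV[R]_m * R)%type.
Local Notation Vm := ('rV[R]_m * measurableTypeR R)%type.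
Local Notation vol := (@vol R m).
Local Notation mux := (lebesgue_rV m).
Local Notation mut := (@lebesgue_measure R).
Local Open Scope ereal_scope.

Lemma vol_tonelli (f : V -> \bar R) : measurable_fun (setT : set Vm) f ->
  (forall z, 0 <= f z) ->
  \int[vol]_z f z = \int[mut]_t \int[mux]_x f (x, t).
Proof.
by move=> mf f0; exact: (@fubini_tonelli2 _ _ _ _ R mux mut f mf f0).
Qed.

Lemma measurable_int_slice (f : V -> \bar R) : measurable_fun (setT : set Vm) f ->
  (forall z, 0 <= f z) ->
  measurable_fun (setT : set (measurableTypeR R)) (fun t => \int[mux]_x f (x, t)).
Proof.
by move=> mf f0; exact: (@measurable_fun_fubini_tonelli_G _ _ _ _ R mux f mf f0).
Qed.

Lemma measurable_slice d (Y : measurableType d) (f : V -> Y) (t : R) :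
  measurable_fun (setT : set Vm) f -> measurable_fun setT (fun x => f (x, t)).
Proof.
move=> mf.
have h : measurable_fun setT (fun x : 'rV[R]_m => (x, t) : Vm).
  by apply: measurable_fun_pair => //; exact: measurable_cst.
exact: (measurableT_comp mf h).
Qed.

End slices.

Section trace.
Context {R : realType} {m : nat} (P : interface_problem R m).
Hypothesis hP : standing_assumptions P.
Local Notation V := ('rV[R]_m * R)%type.
Local Notation Vm := ('rV[R]_m * measurableTypeR R)%type.
Local Notation vol := (@vol R m).
Local Notation ip := (ip vol).
Local Notation L2V := (L2 vol setT).
Local Notation mux := (lebesgue_rV m).
Local Notation mut := (@lebesgue_measure R).
Local Notation T := (horizon P).
Local Notation Q := (QT P).
Implicit Types (w f xi : V -> R) (g : 'I_m -> V -> R) (F : (V -> R) -> R).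

Definition slab (s r : R) : set V := [set z | `|z.2 - s| < r].

Lemma measurable_slab s r : measurable (slab s r : set Vm).
Proof.
apply: open_measurable_prod; rewrite (_ : slab s r = snd @^-1` (ball s r)).
  by apply: open_comp => [z _|]; [exact: cvg_snd|exact: ball_open].
by apply/seteqP; split => z; rewrite /slab /= /ball/= distrC.
Qed.

Lemma ip_EFin f : L2V f -> ((ip f f)%:E = \int[vol]_z (f z ^+ 2)%:E)%E.
Proof.
move=> Lf; rewrite ip_sqr /Rintegral fineK//.
by apply: integrable_fin_num => //; case: Lf.
Qed.

(** For almost every $t$ near [s0] the slice has squared norm $\|y(t)\|^2=\|y(t)-y(s_0)\|^2<e$ by
    continuity of the representative; integrate over an interval of length $2r$. *)
Lemma trace_small w s0 : has_trace P w s0 (fun=> 0) -> L2V (w \_ Q) ->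
  0 <= s0 <= T -> forall e, 0 < e -> exists2 delta, 0 < delta &
  forall r, 0 < r -> r < delta ->
    ip ((w \_ Q) \_ (slab s0 r)) ((w \_ Q) \_ (slab s0 r)) <= 2 * r * e.
Proof.
move=> [y [yL2 yc yw y0]] Lw s0T e e0.
have mO : measurable (Omega P) := open_measurable_rV (Omega_open hP).
have [delta d0 hd] := yc s0 s0T e e0; exists delta => // r r0 rd.
have Lf := L2_indic (measurable_slab s0 r) Lw; set f := _ \_ _ in Lf *.
rewrite -lee_fin ip_EFin// vol_tonelli//; last 2 first.
- by apply/measurable_EFinP/measurable_funX; case: Lf.
- by move=> z; rewrite lee_fin sqr_ge0.
have mB : measurable (ball s0 r : set (measurableTypeR R)) by exact: measurable_ball.
have BE : mut (ball s0 r) = (r *+ 2)%:E by exact: lebesgue_measure_ball (ltW r0).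
have Boo : (mut (ball s0 r) < +oo)%E by rewrite BE ltry.
have -> : (2 * r * e)%:E = (\int[mut]_t (e * \1_(ball s0 r) t)%:E)%E.
  under eq_integral do rewrite EFinM.
  rewrite integralZl//; last first.
    have := integrable_cst_indic 1 mB Boo; apply: eq_integrable => // t _ /=.
    by rewrite mul1r.
  rewrite integral_indic// setIT [X in (_ * X)%E]BE.
  by rewrite -EFinM; congr EFin; ring.
apply: ae_ge0_le_integral => //.
- by move=> t _; apply: integral_ge0 => x _; rewrite lee_fin sqr_ge0.
- apply: (measurable_int_slice (f := fun z => (f z ^+ 2)%:E)).
    by apply/measurable_EFinP/measurable_funX; case: Lf.
  by move=> z; rewrite lee_fin sqr_ge0.
- by move=> t _; rewrite lee_fin mulr_ge0// ltW.
- by apply/measurable_EFinP/measurable_funM.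
apply: negligibleS yw; apply: subsetC => t yt _.
have [tr|ntr] := pselect (`|t - s0| < r /\ 0 < t < T); last first.
  rewrite integral0_eq ?lee_fin ?mulr_ge0 ?(ltW e0)// => x _.
  rewrite /f patchE; case: ifPn => [/set_mem /= h|_]; last by rewrite expr0n.
  rewrite patchE; case: ifPn => [/set_mem[/= h' _]|_]; last by rewrite expr0n.
  by exfalso; apply: ntr.
have [t1 t2] := tr.
rewrite indicE mem_set ?mulr1; last by rewrite /ball/= distrC.
have tT : 0 <= t <= T by have /andP[/ltW -> /ltW ->] := t2.
have := hd t tT (lt_trans t1 rd); rewrite -lte_fin => /ltW; apply: le_trans.
have [mwt iwt] := yL2 t tT; have [mw0 iw0] := yL2 s0 s0T.
have Emw : measurable_fun (Omega P) (fun x => (w \_ Q) (x, t)).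
  by apply: measurable_funTS; apply: measurable_slice; case: Lw.
have -> : (\int[mux]_x (f (x, t) ^+ 2)%:E =
    \int[mux]_(x in Omega P) ((w \_ Q) (x, t) ^+ 2)%:E)%E.
  rewrite [RHS]integral_mkcond; apply: eq_integral => x _.
  rewrite /f !patchE /= (mem_set (A := slab s0 r))//.
  case: ifPn => [/set_mem[_ Ox]|nQ]; first by rewrite mem_set.
  by case: ifPn => // _; rewrite expr0n.
have E1 : (\int[mux]_(x in Omega P) ((w \_ Q) (x, t) ^+ 2)%:E =
    \int[mux]_(x in Omega P) (y t x ^+ 2)%:E)%E.
  apply: ae_eq_integral => //.
  - by apply/measurable_EFinP/measurable_funX.
  - by apply/measurable_EFinP/measurable_funX.
  apply: filterS (yt t2) => x h Ox; rewrite patchE mem_set; last by split.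
  by rewrite h.
have E2 : (\int[mux]_(x in Omega P) (y t x ^+ 2)%:E =
    \int[mux]_(x in Omega P) ((y t x - y s0 x) ^+ 2)%:E)%E.
  apply: ae_eq_integral => //.
  - by apply/measurable_EFinP/measurable_funX.
  - by apply/measurable_EFinP/measurable_funX/measurable_funB.
  by apply: filterS y0 => x h Ox; rewrite h// subr0.
rewrite E1 E2 /Rintegral fineK// -E2.
exact: integrable_fin_num.
Qed.

End trace.

Lemma step_derive_out {R : realType} (x : R) : x < 1 \/ 2 < x -> 'D_1 (@step R) x = 0.
Proof.
case=> hx.
  rewrite (@near_eq_derive R R^o R^o step (cst 0)) ?derive_cst//.
  by near=> y; rewrite step0// ltW//; near: y; exact: lt_nbhsl.
rewrite (@near_eq_derive R R^o R^o step (cst 1)) ?derive_cst//.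
by near=> y; rewrite step1// ltW//; near: y; exact: lt_nbhsr.
Unshelve. all: by end_near. Qed.

Lemma step_affine_derive {R : realType} (a b t : R) :
  'D_1 (fun t => step (a * t + b)) t = 'D_1 (@step R) (a * t + b) * a.
Proof.
have Ca : class_C 1 setT (fun t : R => a * t + b).
  by apply: C1D; [apply: C1M; [exact: C1_cst|exact: C1_id]|exact: C1_cst].
rewrite (C1_derive_comp (V := R^o) 1 t C1_step Ca); congr (_ * _).
have [_ ->//] : is_derive t 1 (fun t : R => a * t + b) a.
by apply: is_derive_quadratic => h; rewrite (_ : _ - _ = 0) ?normr0 ?sqr_ge0//; ring.
Qed.

(** * A zero trace at one end admits test functions that do not vanish there *)

Section trace_one_sided.
Context {R : realType} {m : nat} (P : interface_problem R m).
Hypothesis hP : standing_assumptions P.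
Local Notation V := ('rV[R]_m * R)%type.
Local Notation Vm := ('rV[R]_m * measurableTypeR R)%type.
Local Notation vol := (@vol R m).
Local Notation ip := (ip vol).
Local Notation L2V := (L2 vol setT).
Local Notation T := (horizon P).
Local Notation Q := (QT P).
Implicit Types (w f xi : V -> R) (g : 'I_m -> V -> R) (F : (V -> R) -> R).

Lemma vol_slab_Omega s r : 0 < r ->
  vol (slab s r `&` cylinder P setT) = ((fine (lebesgue_rV m (Omega P))) * (r *+ 2))%:E.
Proof.
move=> r0; rewrite (_ : _ `&` _ = Omega P `*` ball s r); last first.
  by apply/seteqP; split => z; rewrite /slab /cylinder /ball/= distrC; case=> // ? [].
rewrite /= product_measure1E//=; last 2 first.
- exact: open_measurable_rV (Omega_open hP).
- exact: measurable_ball.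
rewrite EFinM fineK; last by rewrite ge0_fin_numE//; exact: Omega_finite.
by congr mule; exact: lebesgue_measure_ball (ltW r0).
Qed.

(** The two ends are treated together: on $(0,T)$ the quantity $at+b$ is the distance to [s0], with
    $(a,b,s_0)=(1,0,0)$ at the initial time and $(-1,T,T)$ at the horizon. [J] is a half-line of
    times on which only the end other than [s0] is still excluded. *)
Variables (a b s0 : R) (J : set R).
Hypotheses (s0T : 0 <= s0 <= T) (rhoE : forall t, `|a * t + b| = `|t - s0|)
  (a1 : `|a| = 1) (JT : forall t, J t -> 0 < a * t + b -> 0 < t < T)
  (TJ : forall t, 0 < t < T -> 0 < a * t + b).

Let chi (n : nat) (t : R) : R := step (n%:R * a * t + n%:R * b).

Let chiE n t : chi n t = step (n%:R * (a * t + b)).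
Proof. by congr step; ring. Qed.

Let C1_chi n : class_C 1 setT (chi n).
Proof. exact: C1_step_affine. Qed.

Let chi01 n t : 0 <= chi n t <= 1.
Proof. exact: step_ge0. Qed.

Let chi1 t : 0 < t < T -> \forall n \near \oo, chi n t = 1.
Proof.
move=> /TJ r0; exists (Num.truncn (2 / (a * t + b))).+1 => // n /= hn.
rewrite chiE step1// -ler_pdivrMr//; apply/ltW.
by apply: (lt_le_trans (Num.Theory.truncnS_gt _)); rewrite ler_nat.
Qed.

Let chi0 n z : cylinder P J z -> ~ Q z -> chi n z.2 = 0.
Proof.
move=> [Oz Jz] nQ; rewrite chiE step0//.
have [r0|r0] := ltP 0 (a * z.2 + b); first by exfalso; apply: nQ; split => //; exact: JT.
by have n0 : 0 <= n%:R :> R by []; nra.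
Qed.

Let C01_chi n xi : C01 (cylinder P J) xi -> C01 Q (fun z => chi n z.2 * xi z).
Proof.
move=> Cxi; pose F := [set z : V | 1 <= n%:R * a * z.2 + n%:R * b].
have [Ct _] := C1_time_comp (C1_chi n) (m := m).
have [C2 _] := C1_time (R := R) m.
have cl : continuous (fun z : V => n%:R * a * z.2 + n%:R * b).
  exact: (C1_continuous (C1D (C1M (C1_cst (n%:R * a)) C2) (C1_cst (n%:R * b)))).
have cF : closed F.
  rewrite (_ : F = (fun z : V => n%:R * a * z.2 + n%:R * b) @^-1` [set x | 1 <= x])//.
  by apply: closed_comp; [move=> z _|exact: closed_ge].
have F0 z : ~ F z -> chi n z.2 = 0.
  by move=> /negP; rewrite -ltNge => /ltW h; rewrite /chi step0.
apply: C01_sub (C01_restrict cF Ct F0 Cxi) => z [[Oz Jz]].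
rewrite /F /= => h; split => //; apply: JT => //.
by have n0 : 0 <= n%:R :> R by []; rewrite ltNge; apply/negP => h'; nra.
Qed.

Variable w : V -> R.
Hypotheses (Uw : U_space P w) (trw : has_trace P w s0 (fun=> 0)).

Let W := w \_ Q.

Let LW : L2V W.
Proof. by apply: (W_space_L2 hP); case: Uw. Qed.

(** The derivative of the cut-off has size $n$ on a slab of width of order $1/n$, where the integral
    of $W^2$ is of smaller order than $1/n$ by the zero trace; Cauchy-Schwarz makes the pairing
    vanish in the limit. *)
Let boundary_term xi : C01 (cylinder P J) xi -> exists2 K, 0 <= K &
  forall e, 0 < e -> \forall n \near \oo,
    ip W (fun z => 'D_1 (chi n) z.2 * xi z) ^+ 2 <= K * e.
Proof.
move=> Cxi; have [M [M0 hM]] := @step_derive_bounded R.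
have [Mx [Mx0 hMx]] := C01_bounded Cxi; have Lxi := C01_L2 Cxi.
pose vO := fine (lebesgue_rV m (Omega P)).
have vO0 : 0 <= vO by exact: fine_ge0.
(* $36=n^2(2r)^2$ for $r=3/n$: one factor $2r$ comes from [trace_small], the other from the volume
   of the slab. *)
exists (36 * (M * Mx) ^+ 2 * vO) => [|e e0].
  by rewrite !mulr_ge0// sqr_ge0.
have [delta d0 hd] := trace_small hP trw LW s0T e0.
exists (Num.truncn (3 / delta)).+1 => // n /= hn.
have n0 : 0 < n%:R :> R by rewrite ltr0n (leq_ltn_trans _ hn).
(* With $3/n$ instead of $2/n$, the argument of [step] is strictly beyond its transition interval
   everywhere outside the open slab. *)
pose r := 3 / n%:R : R; have r0 : 0 < r by rewrite divr_gt0.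
have rd : r < delta.
  rewrite /r ltr_pdivrMr// mulrC -ltr_pdivrMr//.
  by apply: (lt_le_trans (Num.Theory.truncnS_gt _)); rewrite ler_nat.
pose S : set V := slab s0 r; have mS : measurable (S : set Vm) := measurable_slab s0 r.
pose q (z : V) := 'D_1 (chi n) z.2 * xi z.
have qE (z : V) : q z = 'D_1 (@step R) (n%:R * (a * z.2 + b)) * (n%:R * a) * xi z.
  rewrite /q /chi step_affine_derive.
  by rewrite (_ : n%:R * a * z.2 + n%:R * b = n%:R * (a * z.2 + b))//; ring.
have q0 (z : V) : ~ S z -> q z = 0.
  move=> /negP; rewrite /= -leNgt -rhoE => h; rewrite qE step_derive_out ?mul0r//.
  have h3 : 3 <= `|n%:R * (a * z.2 + b)|.
    by rewrite normrM (gtr0_norm n0) mulrC -ler_pdivrMr.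
  by move: h3; rewrite ler_normr => /orP[h3|h3]; [right|left]; lra.
have qb (z : V) : `|q z| <= n%:R * (M * Mx).
  rewrite qE !normrM a1 mulr1 (gtr0_norm n0) [_ * n%:R]mulrC -mulrA.
  by rewrite ler_wpM2l ?(ltW n0)// ler_pM.
have [Ct _] := C1_time_comp (C1_chi n) (m := m).
have mq : measurable_fun (setT : set Vm) q.
  apply: measurable_funM; last exact: L2_measurable Lxi.
  apply: continuous_measurable_prod.
  have h := @C1_continuous_derive _ _ _ ((0, 1) : V) Ct.
  move: h; under eq_fun do rewrite (C1_time_comp (C1_chi n)).2 /= mulr1.
  exact.
pose A := S `&` cylinder P setT.
have mA : measurable (A : set Vm).
  apply: measurableI => //; apply: open_measurable_prod.
  by apply: open_cylinder => //; exact: openT.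
have Av : vol A = (vO * (r *+ 2))%:E := vol_slab_Omega s0 r0.
have Aoo : (vol A < +oo)%E by rewrite Av ltry.
have qA (z : V) : `|q z| <= `|n%:R * (M * Mx) * \1_A z|.
  rewrite indicE; have [Az|nAz] := boolP (z \in A).
    by rewrite mulr1 (le_trans (qb z))// ler_norm.
  move: nAz; rewrite notin_setE => /not_andP[/q0 ->|nC]; first by rewrite normr0.
  by rewrite /q (C01_off Cxi) ?mulr0 ?normr0// => -[Oz _]; apply: nC.
have LA := L2Z (n%:R * (M * Mx)) (L2_cst_indic mA Aoo).
have Lq := L2_le mq LA qA.
have b1 := ip_le_ip mq LA qA.
have IA : ip (\1_A : V -> R) (\1_A : V -> R) = vO * (r *+ 2).
  have -> : ip (\1_A : V -> R) (\1_A : V -> R) = \int[vol]_z (\1_A z).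
    by apply: eq_Rintegral => z _; rewrite indicE; case: (_ \in _); rewrite ?mulr1 ?mulr0.
  by rewrite /Rintegral integral_indic// setIT [X in fine X]Av.
have LI := L2_cst_indic mA Aoo.
rewrite (ipZl _ LI (L2Z _ LI)) (ipZr _ LI LI) IA in b1.
have -> : ip W q = ip (W \_ S) q.
  apply: eq_Rintegral => z _; rewrite patchE; case: ifPn => // /negP nz.
  by rewrite q0 ?mulr0// => /mem_set.
have b2 := ip_cauchy_schwarz (L2_indic mS LW) Lq.
have b3 := hd r r0 rd.
apply: (le_trans b2); apply: (le_trans (ler_pM (ip_ge0 _ _) (ip_ge0 _ _) b3 b1)).
rewrite /r le_eqVlt; apply/orP; left; apply/eqP.
by field; rewrite gt_eqF.
Qed.

(** Test the definition of the time derivative with $\chi_n\xi$: its gradient and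
    $\chi_n\partial_t\xi$ converge in $L^2$, and [boundary_term] removes $\chi_n'\xi$. *)
Lemma trace_time_deriv xi : C01 (cylinder P J) xi ->
  time_deriv P w xi = - ip W (ddt xi).
Proof.
move=> Cxi; set F := time_deriv P w.
have [DF hF] := time_derivP Uw; have [Fl _] := DF.
have [C C0 FC] := W_dual_bound hP DF; have [K K0 hK] := boundary_term Cxi.
have CxiT : C01 (cylinder P setT) xi by apply: C01_sub Cxi => z [].
have Lxi := C01_L2 Cxi; have Ldxi i := ddx_L2 i Cxi.
have Ldt : L2V (ddt xi) := C01_derive_L2 (0, 1) Cxi.
have mQ := measurable_QT hP.
have W0 : 0 <= ip W W by exact: ip_ge0.
have cx i := cutoff_cvg0 C1_chi chi01 chi1 chi0
  (@C1_continuous_derive _ _ xi (unit_vec i, 0) (C01_C1 Cxi))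
  (@C01_derive_off _ _ _ xi (unit_vec i, 0) Cxi) (Ldxi i).
have ct := cutoff_cvg0 C1_chi chi01 chi1 chi0
  (@C1_continuous_derive _ _ xi (0, 1) (C01_C1 Cxi))
  (@C01_derive_off _ _ _ xi (0, 1) Cxi) Ldt.
have cxs := cvg_sum0 (index_enum 'I_m) cx.
apply/eqP; rewrite -subr_eq0 opprK -sqrf_eq0 eq_le sqr_ge0 andbT.
apply: (@le_epsilon_scaled _ _ _ (3 * (C + ip W W + K))); first by lra.
move=> e e0.
have [n [nx nt nK]] : exists n, [/\
    grad_nrm2 (fun i z => (ddx i xi \_ Q) z - chi n z.2 * ddx i xi z) < e,
    ip (fun z => (ddt xi \_ Q) z - chi n z.2 * ddt xi z)
       (fun z => (ddt xi \_ Q) z - chi n z.2 * ddt xi z) < e &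
    ip W (fun z => 'D_1 (chi n) z.2 * xi z) ^+ 2 <= K * e].
  have := hK e e0; near \oo => n => _; exists n; split; near: n.
  - exact: (cvgr_lt _ cxs _ e0).
  - exact: (cvgr_lt _ ct _ e0).
  - exact: hK.
have Cn := C01_chi n Cxi; have Ln := C01_L2 Cn; have Ldn i := ddx_L2 i Cn.
have CC := C1_chi n; have C1xi := C01_C1 Cxi.
have Fn := hF _ Cn; rewrite (intQ_ddt w Cn) ddt_cut// in Fn.
have [Wn gn] := W_space_C01 hP Cn.
have [Wxi gxi] := W_pair_space hP (W_pair_cylinder hP CxiT).
have [Wd gd] := W_space_lin hP (-1) Wn Wxi.
have gle : grad_nrm2 (grad0 P (fun z => -1 * (chi n z.2 * xi z) + xi z)) <= e.
  apply: (le_trans _ (ltW nx)); rewrite le_eqVlt; apply/orP; left; apply/eqP.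
  apply: eq_bigr => i _; have L1 := grad0_L2 hP i Wd.
  have L2' : L2V (fun z => (ddx i xi \_ Q) z - chi n z.2 * ddx i xi z).
    apply: L2B; first exact: L2_indic.
    by have := Ldn i; rewrite ddx_cut.
  have ae : ae_eq vol setT (grad0 P (fun z => -1 * (chi n z.2 * xi z) + xi z) i)
      (fun z => (ddx i xi \_ Q) z - chi n z.2 * ddx i xi z).
    apply: filterS3 (gd i) (gn i) (gxi i) => z h1 h2 h3 _.
    by rewrite h1// h2// h3// ddx_cut// mulN1r addrC.
  by rewrite (ip_ae L1 L2' L1 ae) ipC (ip_ae L1 L2' L2' ae).
have f1 := FC _ Wd; rewrite (Fl (-1) _ _ Wn Wxi) in f1.
have Lchit : L2V (fun z => chi n z.2 * ddt xi z).
  have [Ct _] := C1_time_comp CC (m := m).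
  apply: (L2_bmul (M := 1)) => //.
    exact: continuous_measurable_prod (C1_continuous Ct).
  by move=> z; have /andP[h1 h2] := chi01 n z.2; rewrite ger0_norm.
have Lq : L2V (fun z => 'D_1 (chi n) z.2 * xi z).
  have := L2B (C01_derive_L2 ((0, 1) : V) Cn) Lchit; congr L2; apply/funext => z.
  by have := congr1 (fun f => f z) (ddt_cut CC C1xi); rewrite /ddt /= => ->; ring.
rewrite ipDr// -/F in Fn.
have E : ip W (ddt xi) = ip W (ddt xi \_ Q).
  apply: eq_Rintegral => z _; rewrite /W !patchE; case: ifPn => // _.
  by rewrite !mul0r.
have LdQ := L2_indic mQ Ldt.
have t1 := ip_cauchy_schwarz LW (L2B LdQ Lchit).
rewrite ipBr// in t1.
set x := ip W (fun z => chi n z.2 * ddt xi z) in Fn t1.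
set y := ip W (fun z => 'D_1 (chi n) z.2 * xi z) in Fn nK.
set N := ip _ _ in nt t1.
have {}t1 : (ip W (ddt xi \_ Q) - x) ^+ 2 <= ip W W * e.
  by apply: (le_trans t1); rewrite ler_wpM2l// ltW.
have {}f1 : (- 1 * F (fun z => chi n z.2 * xi z) + F xi) ^+ 2 <= C * e.
  by apply: (le_trans f1); rewrite ler_wpM2l.
have -> : F xi + ip W (ddt xi) = (- 1 * F (fun z => chi n z.2 * xi z) + F xi) +
    (ip W (ddt xi \_ Q) - x) - y.
  by rewrite Fn E; ring.
set p1 := - 1 * _ + _ in f1 *; set p2 := ip _ _ - x in t1 *.
have := sqr_ge0 (p1 - p2); have := sqr_ge0 (p1 + y); have := sqr_ge0 (p2 + y).
lra.
Unshelve. all: by end_near. Qed.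

End trace_one_sided.

(** * The velocity field: boundedness, continuity, measurability *)

Section velocity_field.
Context {R : realType} {m : nat} (P : interface_problem R m).
Hypothesis hP : standing_assumptions P.
Local Notation V := ('rV[R]_m * R)%type.
Local Notation Vm := ('rV[R]_m * measurableTypeR R)%type.
Local Notation vol := (@vol R m).
Local Notation ip := (ip vol).
Local Notation L2V := (L2 vol setT).
Local Notation T := (horizon P).
Local Notation Q := (QT P).
Local Notation v := (velocity P).
Implicit Types (w f xi : V -> R) (g : 'I_m -> V -> R).

Lemma closure_Omega_compact : compact (closure (Omega P)).
Proof.
have [r [r0 Or]] := Omega_ball hP.
pose A : set 'rV[R]_m := [set x | forall i, `[- r, r]%classic (x ord0 i)].
have cA : compact A.
  by apply: (@rV_compact R m (fun i => `[- r, r]%classic)) => i; exact: segment_compact.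
have clA : closed A by apply: compact_closed => //; exact: norm_hausdorff.
apply: (subclosed_compact _ cA); first exact: closed_closure.
have AE : closure A = A by rewrite {2}((closure_id A).1 clA).
rewrite -AE; apply: closure_subset => x /Or/(mx_ball_rV _ _ r0) h i; have := h i.
by rewrite mxE sub0r normrN ltr_norml /= in_itv/= => /andP[/ltW -> /ltW ->].
Qed.

Lemma coord_le_norm n (x : 'rV[R]_n) i : `|x ord0 i| <= `|x|.
Proof.
have [->|x0] := eqVneq x 0; first by rewrite mxE normr0.
apply/ler_addgt0Pr => e e0; have e1 : 0 < `|x| + e by rewrite addr_gt0// normr_gt0.
have : ball (0 : 'rV[R]_n) (`|x| + e) x.
  by rewrite -ball_normE /ball_ /= sub0r normrN ltrDl.
by move=> /(mx_ball_rV _ _ e1)/(_ i); rewrite mxE sub0r normrN => /ltW.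
Qed.

(** At fixed time the bound comes from compactness of the closure of $\Omega$; it persists,
    increased by 1, at nearby times, and $[0,T]$ is compact. *)
Lemma velocity_pderiv_bounded (I : seq 'I_m) : (size I <= 2)%N ->
  exists M, forall z, Q z -> `|pderiv I (fun y => v (y, z.2)) z.1| <= M.
Proof.
move=> I2; have [vC vc] := velocity_regular hP.
have b1 s : 0 <= s <= T -> exists M, forall x, Omega P x ->
    `|pderiv I (fun y => v (y, s)) x| <= M.
  move=> sT; have [_ _ /(_ I I2)[g gc gE]] := vC s sT.
  have cg : compact (g @` closure (Omega P)).
    by apply: continuous_compact => //; exact: closure_Omega_compact.
  have [M [_ hM]] := compact_bounded cg; exists (`|M| + 1) => x Ox.
  rewrite -gE//; apply: hM; first by rewrite ltr_pwDr// ler_norm.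
  by exists x => //; exact: subset_closure.
have K : compact (`[0, T]%classic : set R) by exact: segment_compact.
have H t : `[0, T]%classic t -> \forall x' \near t & i \near +oo,
    0 <= x' <= T -> forall x, Omega P x -> `|pderiv I (fun y => v (y, x')) x| <= i.
  rewrite /= in_itv/= => tT; have [M hM] := b1 t tT.
  have [d d0 hd] := vc t tT 1 ltr01.
  exists (ball t d, [set i | M + 1 <= i]).
    split; first exact: nbhsx_ballx.
    by exists (M + 1); split; [exact: num_real|move=> ? /ltW].
  move=> [t' i] [/= tt' Mi] t'T x Ox; apply: le_trans Mi.
  have h1 := hM x Ox.
  have h2 : `|pderiv I (fun y => v (y, t')) x - pderiv I (fun y => v (y, t)) x| <= 1.
    by apply: hd => //; rewrite distrC.
  have := ler_normD (pderiv I (fun y => v (y, t')) x - pderiv I (fun y => v (y, t)) x)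
     (pderiv I (fun y => v (y, t)) x).
  by rewrite subrK; lra.
have [M [_ hM]] := (@compact_near_coveringP R `[0, T]%classic).1 K R (pinfty_nbhs R)
  (fun M t => 0 <= t <= T -> forall x, Omega P x ->
    `|pderiv I (fun y => v (y, t)) x| <= M) _ H.
exists (M + 1) => z [zT Oz].
have tT : 0 <= z.2 <= T by have /andP[/ltW -> /ltW ->] := zT.
by apply: (hM (M + 1)); rewrite ?ltrDl /= ?in_itv.
Qed.

(** Joint continuity: continuity in space at a fixed time, combined with continuity in time that is
    uniform in space. *)
Lemma velocity_continuous z : Q z -> {for z, continuous v}.
Proof.
case: z => x s [sT Ox]; have [vC vc] := velocity_regular hP.
have sT' : 0 <= s <= T by have /andP[/ltW -> /ltW ->] := sT.
apply/cvgrPdist_le => e e0.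
have e20 : 0 < e / 2 by rewrite divr_gt0.
have [d d0 hd] := vc s sT' _ e20.
have [_ [vd _] _] := vC s sT'.
have := differentiable_continuous (vd x Ox) => /cvgrPdist_le/(_ _ e20) cx.
have cO : \forall y \near x, Omega P y by exact: open_nbhs_nbhs (conj (Omega_open hP) Ox).
have ct : \forall t \near s, `|t - s| < d /\ 0 < t < T.
  have /andP[s0 sT0] := sT.
  near=> t; split.
    by rewrite distrC; near: t; exact: nbhsx_ballx.
  by apply/andP; split; near: t; [exact: lt_nbhsr|exact: lt_nbhsl].
exists ([set y | `|v (x, s) - v (y, s)| <= e / 2 /\ Omega P y],
        [set t | `|t - s| < d /\ 0 < t < T]).
  by split => //; apply: filterI.
move=> [y t] [/= [h1 Oy] [td tT]].
have tT' : 0 <= t <= T by have /andP[/ltW -> /ltW ->] := tT.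
have h2 := hd t tT' td [::] isT y Oy; rewrite /= in h2.
have := ler_normB (v (x, s) - v (y, s)) (v (y, t) - v (y, s)).
have -> : v (x, s) - v (y, s) - (v (y, t) - v (y, s)) = v (x, s) - v (y, t).
  by rewrite opprB addrA subrK.
lra.
Unshelve. all: by end_near. Qed.

Definition vel (i : 'I_m) : V -> R := (fun z => v z ord0 i) \_ Q.

Lemma measurable_vel i : measurable_fun (setT : set Vm) (vel i).
Proof.
have mQ := measurable_QT hP; apply/(measurable_restrictT _ mQ).
apply: (measurability _ (RGenOpens.measurableE R)) => _ [_ [a [b ->]] <-].
apply: open_measurable_prod; rewrite openE => z [Qz /= zab]; rewrite /interior.
have cvi : {for z, continuous (fun z => v z ord0 i)}.
  apply: (@continuous_comp _ _ _ v (fun x : 'rV[R]_m => x ord0 i)).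
    exact: velocity_continuous.
  exact: coord_continuous.
apply: filterI; first by apply: open_nbhs_nbhs; split => //; exact: QT_open.
apply: cvi; apply: open_nbhs_nbhs; split => //; exact: itv_open.
Qed.

Lemma vel_bounded : exists2 M, 0 <= M & forall i z, `|vel i z| <= M.
Proof.
have [M hM] := @velocity_pderiv_bounded [::] isT; exists `|M| => // i z.
rewrite /vel patchE; case: ifPn => [/set_mem Qz|_]; last by rewrite normr0.
apply: (le_trans (coord_le_norm _ _)); apply: (le_trans _ (ler_norm M)).
by have := hM z Qz; case: z Qz.
Qed.

Lemma L2_vel i : L2V (vel i).
Proof.
have [M M0 hM] := vel_bounded; have mQ := measurable_QT hP.
have LQ := L2Z M (L2_cst_indic mQ (QT_finite hP)).
apply: (L2_le (measurable_vel i) LQ) => z; rewrite indicE.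
have [Qz|nQz] := boolP (z \in Q).
  by rewrite mulr1 (le_trans (hM _ _))// ler_norm.
by rewrite /vel patchE (negbTE nQz) normr0.
Qed.

Definition vdot g : V -> R := fun z => \sum_(i < m) vel i z * g i z.

Lemma L2_vdot g : (forall i, L2V (g i)) -> L2V (vdot g).
Proof.
move=> Lg; have [M M0 hM] := vel_bounded; apply: L2_sum => i.
exact: (L2_bmul (measurable_vel i) (hM i)).
Qed.

Lemma ip_sum_le (I : Type) (s : seq I) (f : I -> V -> R) : (forall i, L2V (f i)) ->
  ip (fun z => \sum_(i <- s) f i z) (fun z => \sum_(i <- s) f i z) <=
  2 ^+ size s * \sum_(i <- s) ip (f i) (f i).
Proof.
move=> Lf; elim: s => [|i s ih].
  rewrite big_nil mulr0 [leLHS](_ : _ = 0)//; under eq_fun do rewrite big_nil.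
  exact: ip0l.
rewrite big_cons /=; under eq_fun do rewrite big_cons.
apply: (le_trans (ipDle (Lf i) (L2_sum s Lf))).
have p : 1 <= 2 ^+ size s :> R by rewrite exprn_ege1// ler1n.
have := ip_ge0 vol (f i); rewrite exprS; nra.
Qed.

Lemma vdot_le : exists2 K, 0 <= K &
  forall g, (forall i, L2V (g i)) -> ip (vdot g) (vdot g) <= K * grad_nrm2 g.
Proof.
have [M M0 hM] := vel_bounded.
exists (2 ^+ size (index_enum 'I_m) * M ^+ 2) => [|g Lg].
  by rewrite mulr_ge0 ?exprn_ge0.
have Lvg i : L2V (fun z => vel i z * g i z) := L2_bmul (measurable_vel i) (hM i) (Lg i).
apply: (le_trans (ip_sum_le _ Lvg)); rewrite -[leRHS]mulrA ler_wpM2l ?exprn_ge0//.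
rewrite /grad_nrm2 mulr_sumr; apply: ler_sum => i _.
have := ip_le_ip (L2_measurable (Lvg i)) (L2Z M (Lg i)).
rewrite ipZl ?ipZr//; last exact: L2Z.
rewrite mulrA -expr2; apply => z.
by rewrite !normrM ler_wpM2r// (le_trans (hM _ _))// ler_norm.
Qed.

End velocity_field.

(** * Skew symmetry of the convection term *)

Section velocity_skew.
Context {R : realType} {m : nat} (P : interface_problem R m).
Hypothesis hP : standing_assumptions P.
Local Notation V := ('rV[R]_m * R)%type.
Local Notation Vm := ('rV[R]_m * measurableTypeR R)%type.
Local Notation vol := (@vol R m).
Local Notation ip := (ip vol).
Local Notation L2V := (L2 vol setT).
Local Notation T := (horizon P).
Local Notation Q := (QT P).
Local Notation v := (velocity P).
Implicit Types (w f xi : V -> R) (g : 'I_m -> V -> R).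

Let dv (i : 'I_m) (z : V) : R := ('D_(unit_vec i) (fun y => v (y, z.2)) z.1) ord0 i.

Lemma is_derive_velocity i z : Q z ->
  is_derive z ((unit_vec i, 0) : V) (fun z => v z ord0 i) (dv i z).
Proof.
case: z => x t [/= tT Ox]; have [vC _] := velocity_regular hP.
have tT' : 0 <= t <= T by have /andP[/ltW -> /ltW ->] := tT.
have [_ [vd _] _] := vC t tT'.
have d1 : derivable (fun y => v (y, t)) x (unit_vec i) := diff_derivable (vd x Ox).
have d2 : derivable (fun y => v (y, t) ord0 i) x (unit_vec i).
  exact: (derivable_mxP _ _ _).1 d1 ord0 i.
have E : (fun h : R => h^-1 *: (((fun z : V => v z ord0 i) \o shift (x, t)) (h *: ((unit_vec i, 0) : V)) - v (x, t) ord0 i)) =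
   (fun h : R => h^-1 *: (((fun y => v (y, t) ord0 i) \o shift x) (h *: unit_vec i) - v (x, t) ord0 i)).
  apply/funext => h; congr (_ *: (v _ ord0 i - _)); congr pair.
  by rewrite /= scaler0 add0r.
split; first by rewrite /derivable E.
rewrite /derive E /dv /= (derive_mx d1) mxE; reflexivity.
Qed.

(** As $\nabla\cdot\mathbf v=0$, the integrand is $\sum_i\partial_i(v_i\xi)$, and each term
    integrates to 0 by [Rintegral_derive]. *)
Lemma vel_integral_eq0 xi : C01 Q xi -> \sum_(i < m) ip (vel P i) (ddx i xi) = 0.
Proof.
move=> Cxi; have Lxi := C01_L2 Cxi; have Ldxi i := ddx_L2 i Cxi.
have [M M0 hM] := vel_bounded hP; have [Mx [Mx0 hMx]] := C01_bounded Cxi.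
have [r hr] := C01_radius Cxi.
have [K [cK KQ] xi0] := Cxi.2.
have dx0 i z : ~ Q z -> ddx i xi z = 0.
  exact: (@C01_derive_off _ _ _ xi (unit_vec i, 0) Cxi).
pose f i (z : V) := v z ord0 i * xi z.
have fE i z : f i z = vel P i z * xi z.
  have [Qz|nQz] := pselect (Q z); first by rewrite /f /vel patchE mem_set.
  by rewrite /f (C01_off Cxi nQz) !mulr0.
pose df i z := v z ord0 i * ddx i xi z + dv i z * xi z.
have Df i z : is_derive z ((unit_vec i, 0) : V) (f i) (df i z).
  have [Qz|nQz] := pselect (Q z).
    have h1 := is_derive_velocity i Qz.
    have h2 : is_derive z ((unit_vec i, 0) : V) xi (ddx i xi z).
      by split => //; exact: (C1_derivable (C01_C1 Cxi)).
    have := is_deriveM h1 h2; congr is_derive.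
    by rewrite /df; congr (_ + _); rewrite [LHS]mulrC.
  have nK : ~ K z by move=> /KQ.
  (* Off [QT] the field [v] is arbitrary, but there [f i] vanishes in a whole neighbourhood of [z],
     because the complement of the support is open. *)
  have near0 : \forall y \near z, f i y = 0.
    have : open (~` K).
      by apply: closed_openC; apply: compact_closed => //; exact: norm_hausdorff.
    rewrite openE => /(_ z nK); apply: filterS => y /xi0 h.
    by rewrite /f h mulr0.
  have -> : df i z = 0.
    by rewrite /df (C01_off Cxi nQz) mulr0 (dx0 i z nQz) mulr0 addr0.
  apply: (@near_eq_is_derive _ _ _ (cst 0)) => //.
  by apply: filterS near0 => y ->.
have bdv i : exists M', 0 <= M' /\ forall z, Q z -> `|dv i z| <= M'.
  have [M' hM'] := @velocity_pderiv_bounded _ _ _ hP [:: i] isT.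
  exists `|M'|; split => // z Qz; apply: (le_trans (coord_le_norm _ _)).
  exact: (le_trans (hM' z Qz) (ler_norm _)).
have H i : \int[vol]_z df i z = 0 /\ vol.-integrable setT (EFin \o df i).
  have [M' [M'0 hM']] := bdv i; have [N [N0 hN]] := C01_derive_bounded ((unit_vec i, 0) : V) Cxi.
  have DfE : 'D_((unit_vec i, 0) : V) (f i) = df i.
    by apply/funext => z; case: (Df i z).
  have mf : measurable_fun (setT : set Vm) (f i).
    rewrite (_ : f i = (fun z => vel P i z * xi z)); last exact/funext.
    by apply: measurable_funM; [exact: measurable_vel|case: Lxi].
  have fb z : `|f i z| <= M * Mx + (M * N + M' * Mx).
    rewrite fE normrM; have := ler_pM (normr_ge0 _) (normr_ge0 _) (hM i z) (hMx z).
    have := mulr_ge0 M0 N0; have := mulr_ge0 M'0 Mx0; lra.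
  have f0 z : r <= `|z| -> f i z = 0 by move=> /hr h; rewrite /f h mulr0.
  have dfb z : `|'D_((unit_vec i, 0) : V) (f i) z| <= M * Mx + (M * N + M' * Mx).
    have -> : 'D_((unit_vec i, 0) : V) (f i) z = df i z by case: (Df i z).
    rewrite /df; have := mulr_ge0 M0 Mx0; have := mulr_ge0 M0 N0.
    have := mulr_ge0 M'0 Mx0.
    have [Qz|nQz] := pselect (Q z); last first.
      by rewrite (C01_off Cxi nQz) mulr0 (dx0 i z nQz) mulr0 addr0 normr0; lra.
    have := ler_normD (v z ord0 i * ddx i xi z) (dv i z * xi z).
    have := ler_pM (normr_ge0 _) (normr_ge0 _) (hM i z) (hN z).
    have := ler_pM (normr_ge0 _) (normr_ge0 _) (hM' z Qz) (hMx z).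
    by rewrite /vel patchE mem_set// !normrM -/(ddx i xi z); lra.
  have dd z : derivable (f i) z ((unit_vec i, 0) : V) by case: (Df i z).
  split; first by rewrite -DfE; exact: (Rintegral_derive mf fb f0 dd dfb).
  by rewrite -DfE; exact: (integrable_derive mf f0 dd dfb).
have [E1 _] := Rintegral_sum (index_enum 'I_m) (fun i => (H i).2).
have [E2 _] := Rintegral_sum (index_enum 'I_m) (fun i => L2_mul (L2_vel hP i) (Ldxi i)).
rewrite /ip -E2; transitivity (\int[vol]_z \sum_(i < m) df i z); last first.
  by rewrite E1 big1// => i _; case: (H i).
apply: eq_Rintegral => z _; have [Qz|nQz] := pselect (Q z); last first.
  rewrite !big1// => i _; rewrite ?/df (dx0 i z nQz) mulr0//.
  by rewrite (C01_off Cxi nQz) mulr0 addr0.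
have [zT Oz] := Qz; have tT : 0 <= z.2 <= T by have /andP[/ltW -> /ltW ->] := zT.
rewrite /df big_split/= -mulr_suml.
have := velocity_div_free hP Oz tT; rewrite /divergence => h.
rewrite [X in _ + X * _](_ : _ = 0) ?mul0r ?addr0; last by rewrite -[RHS]h; apply: eq_bigr.
by apply: eq_bigr => i _; rewrite /vel patchE mem_set.
Qed.

Lemma ip_vdot g f : (forall i, L2V (g i)) -> L2V f ->
  ip (vdot P g) f = \sum_(i < m) ip (fun z => vel P i z * g i z) f.
Proof.
move=> Lg Lf; have [M M0 hM] := vel_bounded hP.
have Lvg i : L2V (fun z => vel P i z * g i z) := L2_bmul (measurable_vel hP i) (hM i) (Lg i).
have [E2 _] := Rintegral_sum (index_enum 'I_m) (fun i => L2_mul (Lvg i) Lf).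
by rewrite /ip -E2; apply: eq_Rintegral => z _; rewrite /vdot mulr_suml.
Qed.

(** The product rule turns the sum into [vel_integral_eq0] for the product of the two functions. *)
Lemma vdot_skew_C01 xi zeta : C01 Q xi -> C01 Q zeta ->
  ip (vdot P (fun i => ddx i xi)) zeta + ip (vdot P (fun i => ddx i zeta)) xi = 0.
Proof.
move=> Cxi Cz; have Lxi := C01_L2 Cxi; have Ldxi i := ddx_L2 i Cxi.
have Lz := C01_L2 Cz; have Ldz i := ddx_L2 i Cz.
have [M M0 hM] := vel_bounded hP.
have Lvx i : L2V (fun z => vel P i z * ddx i xi z) := L2_bmul (measurable_vel hP i) (hM i) (Ldxi i).
have Lvz i : L2V (fun z => vel P i z * ddx i zeta z) := L2_bmul (measurable_vel hP i) (hM i) (Ldz i).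
have Cxz := C01M (C01_C1 Cxi) Cz.
rewrite !ip_vdot// -big_split/= -[RHS](vel_integral_eq0 Cxz).
apply: eq_bigr => i _; rewrite /ip -RintegralD//; [|exact: L2_mul..].
apply: eq_Rintegral => z _; rewrite /ddx deriveM.
- by rewrite /GRing.scale /=; ring.
- exact: (C1_derivable (C01_C1 Cxi)).
- exact: (C1_derivable (C01_C1 Cz)).
Qed.

Let skew g0 w0 g w := ip (vdot P g) w0 + ip (vdot P g0) w.

(* [skew] is continuous in [(w, g)], so vanishing on [C_0^1] extends to [W]. *)
Let skew_density g0 w0 : L2V w0 -> (forall i, L2V (g0 i)) ->
  (forall xi, C01 Q xi -> skew g0 w0 (fun i => ddx i xi) xi = 0) ->
  forall w g, W_pair P w g -> skew g0 w0 g w = 0.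
Proof.
move=> Lw0 Lg0 H w g [Lw Lg _ Happ]; have [K K0 hK] := vdot_le hP.
pose A := ip w0 w0; pose B := ip (vdot P g0) (vdot P g0).
have A0 : 0 <= A by exact: ip_ge0.
have B0 : 0 <= B by exact: ip_ge0.
have LB := L2_vdot hP Lg0.
apply/eqP; rewrite -sqrf_eq0 eq_le sqr_ge0 andbT.
apply: (@le_epsilon_scaled _ _ _ (2 * K * A + 2 * B)).
  by have := mulr_ge0 K0 A0; lra.
move=> e e0; have [xi Cxi hxi] := Happ e e0.
have Lxi := C01_L2 Cxi; have Ldxi i := ddx_L2 i Cxi.
pose gd i (z : V) := g i z - ddx i xi z; pose wd z := w z - xi z.
have Lgd i : L2V (gd i) := L2B (Lg i) (Ldxi i); have Lwd : L2V wd := L2B Lw Lxi.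
have -> : skew g0 w0 g w = ip (vdot P gd) w0 + ip (vdot P g0) wd.
  rewrite -[LHS]subr0 -(H xi Cxi) /skew /wd ipBr//.
  have -> : vdot P gd = fun z => vdot P g z - vdot P (fun i => ddx i xi) z.
    apply/funext => z; rewrite /vdot -sumrB; apply: eq_bigr => i _.
    by rewrite /gd mulrBr.
  by rewrite ipBl//; [ring|exact: L2_vdot..].
have c1 := ip_cauchy_schwarz (L2_vdot hP Lgd) Lw0.
have c2 := ip_cauchy_schwarz LB Lwd.
have c3 := hK gd Lgd.
have c4 := ip_le_nrm2 wd gd; have c5 := grad_le_nrm2 wd gd.
have c6 : ip (vdot P gd) (vdot P gd) * ip w0 w0 <= K * e * A.
  by rewrite ler_wpM2r// (le_trans c3)// ler_wpM2l// (le_trans c5)// ltW.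
have c7 : ip (vdot P g0) (vdot P g0) * ip wd wd <= B * e.
  by rewrite ler_wpM2l// (le_trans c4)// ltW.
set x := ip _ w0 in c1 *; set y := ip _ wd in c2 *.
have := sqr_ge0 (x - y); lra.
Qed.

(** Density, used in one argument after the other. *)
Lemma vdot_skew w g w' g' : W_pair P w g -> W_pair P w' g' ->
  ip (vdot P g) w' + ip (vdot P g') w = 0.
Proof.
move=> Ww Ww'; have [Lw Lg _ _] := Ww; have [Lw' Lg' _ _] := Ww'.
apply: (skew_density Lw' Lg' _ Ww) => xi Cxi.
rewrite /skew addrC; have Lxi := C01_L2 Cxi; have Ldxi i := ddx_L2 i Cxi.
apply: (skew_density Lxi Ldxi _ Ww') => zeta Cz.
exact: vdot_skew_C01.
Qed.

End velocity_skew.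

(** * Completeness of $L^2$, with a geometric rate *)

Section riesz_fischer.
Context {d : measure_display} {X : measurableType d} {R : realType}.
Variable mu : {measure set X -> \bar R}.

Lemma fatou_bound (G : nat -> X -> \bar R) (c : \bar R) :
  (forall n, measurable_fun setT (G n)) -> (forall n x, (0 <= G n x)%E) ->
  (forall n, (\int[mu]_x G n x <= c)%E) ->
  (\int[mu]_x limn_einf (G ^~ x) <= c)%E.
Proof.
move=> mG G0 Gc; apply: (le_trans (fatou _ _ _ _)) => //.
rewrite limn_einf_lim; apply: lime_le; first exact: is_cvg_einfs.
apply: nearW => n; apply: (le_trans _ (Gc n)); apply: ereal_inf_lbound.
by exists n => /=.
Qed.

(** The sum of all [G n] has finite integral, hence is finite almost everywhere, and it dominates
    every term. *)
Lemma ae_bounded (G : nat -> X -> \bar R) :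
  (forall n, measurable_fun setT (G n)) -> (forall n x, (0 <= G n x)%E) ->
  (forall n, (\int[mu]_x G n x <= (2 ^- n)%:E)%E) ->
  exists B, [/\ measurable B, {ae mu, forall x, B x} &
    forall x, B x -> exists s : R, forall n, (G n x <= s%:E)%E].
Proof.
move=> mG G0 GI; pose S x := (\sum_(n <oo) G n x)%E.
have S0 x : (0 <= S x)%E by exact: nneseries_ge0.
have iS : (\int[mu]_x S x < +oo)%E.
  rewrite integral_nneseries//; apply: le_lt_trans (ltry 2).
  have := @cvg_geometric_eseries_half R 2 0; rewrite divr1 => /cvg_lim <-//.
  apply: lee_nneseries => [n _ _|n _]; first exact: integral_ge0.
  apply: (le_trans (GI n)); rewrite lee_fin addn1 natrX exprS invfM.
  by rewrite mulrA divff ?mul1r.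
have mS : measurable_fun setT S.
  exact: (ge0_emeasurable_sum (P := xpredT) (fun k x _ _ => G0 k x) (fun k _ => mG k)).
have iS' : mu.-integrable setT S.
  apply/integrableP; split => //.
  by under eq_integral do rewrite gee0_abs//.
exists [set x | S x < +oo]%E; split.
- rewrite -[X in measurable X]setTI; exact: emeasurable_fun_infty_o.
- apply: filterS (integrable_ae measurableT iS') => x /(_ I).
  by rewrite ge0_fin_numE.
- move=> x Sx; exists (fine (S x)) => n; rewrite fineK ?ge0_fin_numE//.
  have := @nneseries_lim_ge R (G ^~ x) xpredT 0 n.+1 (fun n _ _ => G0 n x).
  rewrite big_nat_recr//=; apply: le_trans.
  by rewrite leeDr// sume_ge0.
Qed.

(** The increments are at most $\sqrt s\,2^{-n}$ in absolute value, hence summable. *)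
Lemma dyadic_increments_cvg (u : nat -> R) (s : R) :
  (forall n, 4 ^+ n * (u n.+1 - u n) ^+ 2 <= s) -> cvgn u.
Proof.
move=> us; have s0 : 0 <= s by apply: le_trans (us 0%N); rewrite mul1r sqr_ge0.
have cd : cvgn (series (fun n => u n.+1 - u n)).
  apply: normed_cvg; apply: (@series_le_cvg _ _ (geometric (Num.sqrt s) 2^-1)).
  - by move=> n /=.
  - by move=> n /=; rewrite mulr_ge0 ?sqrtr_ge0// exprn_ge0// invr_ge0.
  - move=> n /=; rewrite exprVn ler_pdivlMr ?exprn_gt0//.
    rewrite -[X in _ * X]ger0_norm ?exprn_ge0// -normrM -sqrtr_sqr.
    apply: ler_wsqrtr; apply: le_trans (us n).
    by rewrite exprMn -exprM mulnC exprM mulrC (_ : 2 ^+ 2 = 4)//; ring.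
  - by apply: is_cvg_geometric_series; rewrite ger0_norm ?invr_ge0// invf_lt1 ?ltr1n.
have -> : u = (fun n => u 0%N + series (fun n => u n.+1 - u n) n).
  by apply/funext => n; rewrite seriesEnat/= telescope_sumr//; ring.
by apply: is_cvgD => //; exact: is_cvg_cst.
Qed.

Lemma ip_convex a b f g : L2 mu setT f -> L2 mu setT g ->
  0 <= a -> 0 <= b -> a + b = 1 ->
  ip mu (fun x => a * f x + b * g x) (fun x => a * f x + b * g x) <=
  a * ip mu f f + b * ip mu g g.
Proof.
move=> Lf Lg a0 b0 ab; have Lab := L2D (L2Z a Lf) (L2Z b Lg).
have h := mulr_ge0 (mulr_ge0 a0 b0) (ip_ge0 mu (fun x => f x - g x)).
rewrite ipBr ?ipBl// in h; last exact: L2B.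
rewrite ipDr ?ipDl//; try exact: L2Z.
rewrite !ipZl ?ipZr//; try exact: L2Z.
rewrite (ipC mu g f) in h *; move: h.
have -> : b = 1 - a by rewrite -ab addrC addKr.
by rewrite ipC; nra.
Qed.

(** The functions $4^n(f_{n+1}-f_n)^2$ have integrals at most $2^{-n}$, so they are bounded in $n$
    at almost every point and $f_n$ converges there. Fatou's lemma then carries the Cauchy bound to
    the limit with the same rate. *)
Lemma riesz_fischer (f : nat -> X -> R) : (forall n, L2 mu setT (f n)) ->
  (forall n k, (n <= k)%N ->
    ip mu (fun x => f k x - f n x) (fun x => f k x - f n x) <= 8 ^- n) ->
  exists2 h, L2 mu setT h & forall n,
    ip mu (fun x => h x - f n x) (fun x => h x - f n x) <= 8 ^- n.
Proof.
move=> Lf fC.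
have EI u : L2 mu setT u -> (\int[mu]_x (u x ^+ 2)%:E = (ip mu u u)%:E)%E.
  move=> [mu1 iu]; rewrite ip_sqr /Rintegral fineK//.
  exact: integrable_fin_num.
pose D n (x : X) := (4 ^+ n * (f n.+1 x - f n x) ^+ 2)%:E.
have D0 n x : (0 <= D n x)%E by rewrite lee_fin mulr_ge0 ?sqr_ge0 ?exprn_ge0.
have Ld n := L2B (Lf n.+1) (Lf n).
have mD n : measurable_fun setT (D n).
  apply/measurable_EFinP; apply: measurable_funM => //.
  by apply: measurable_funX; exact: L2_measurable (Ld n).
have [B [mB aeB DB]] : exists B, [/\ measurable B, {ae mu, forall x, B x} &
    forall x, B x -> exists s : R, forall n, (D n x <= s%:E)%E].
  apply: ae_bounded => // n; under eq_integral do rewrite /D EFinM.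
  have [_ iD] := Ld n.
  rewrite integralZl// EI// -EFinM lee_fin.
  apply: le_trans (ler_wpM2l _ (fC _ _ (leqnSn n))) _; first exact: exprn_ge0.
  rewrite -expr_div_n -exprVn (_ : 4 / 8 = 2^-1)//; by field.
(* Replacing [f n] by 0 off the good set [B] makes the sequence converge everywhere, so its limit is
   measurable. *)
pose g n : X -> R := (f n) \_ B.
have Lg n : L2 mu setT (g n) by exact: L2_indic.
have gcv x : cvgn (g ^~ x).
  have [Bx|nBx] := pselect (B x); last first.
    rewrite (_ : g ^~ x = cst 0); first exact: is_cvg_cst.
    by apply/funext => n; rewrite /g patchE memNset.
  rewrite (_ : g ^~ x = f ^~ x); last by apply/funext => n; rewrite /g patchE mem_set.
  have [s hs] := DB x Bx; apply: (@dyadic_increments_cvg _ s) => n.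
  by rewrite -lee_fin; exact: hs.
pose h : X -> R := fun x => limn (g ^~ x).
have mh : measurable_fun setT h.
  apply: (measurable_fun_cvg (h := g)) => [n|x _]; first exact: L2_measurable (Lg n).
  exact: gcv.
have hb n : (\int[mu]_x ((h x - g n x) ^+ 2)%:E <= (8 ^- n)%:E)%E.
  have := @fatou_bound (fun k x => ((g (n + k)%N x - g n x) ^+ 2)%:E) (8 ^- n)%:E.
  have -> : (\int[mu]_x limn_einf (fun k => ((g (n + k)%N x - g n x) ^+ 2)%:E) =
     \int[mu]_x ((h x - g n x) ^+ 2)%:E)%E.
    apply: eq_integral => x _.
    have hc : ((g (n + k)%N x - g n x) ^+ 2)%:E @[k --> \oo] -->
        ((h x - g n x) ^+ 2)%:E.
      have hk : g (n + k)%N x @[k --> \oo] --> h x.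
        exact: (cvg_comp _ _ (cvg_addnl n) (gcv x)).
      apply: cvg_EFin; first exact: nearW.
      have h1 : (g (n + k)%N x - g n x) @[k --> \oo] --> h x - g n x.
        apply: cvgB; [exact: hk|exact: (cvg_cst (g n x))].
      exact: (cvgM h1 h1).
    by rewrite is_cvg_limn_einfE ?(cvg_lim _ hc)//; apply/cvg_ex; eexists; exact: hc.
  apply.
  - move=> k; apply/measurable_EFinP/measurable_funX.
    exact: L2_measurable (L2B (Lg _) (Lg _)).
  - by move=> k x; rewrite lee_fin sqr_ge0.
  - move=> k; rewrite EI ?lee_fin; last exact: L2B.
    apply: le_trans (fC _ _ (leq_addr k n)); apply: ip_le_ip.
    + exact: L2_measurable (L2B (Lg _) (Lg _)).
    + exact: L2B.
    + move=> x; rewrite /g !patchE; case: ifPn => // _.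
      by rewrite subrr normr0.
have Lh : L2 mu setT h.
  have L0 : L2 mu setT (fun x => h x - g 0%N x).
    have m0 : measurable_fun setT (fun x => h x - g 0%N x).
      by apply: measurable_funB => //; exact: L2_measurable (Lg _).
    split => //; apply/integrableP; split; first exact/measurable_EFinP/measurable_funX.
    apply: le_lt_trans (ltry (8 ^- 0)); apply: le_trans (hb 0%N).
    by under eq_integral do rewrite gee0_abs ?lee_fin ?sqr_ge0//.
  by have := L2D L0 (Lg 0%N); under eq_fun do rewrite subrK.
exists h => // n; have Lhn := L2B Lh (Lf n).
rewrite -lee_fin -EI//; apply: le_trans (hb n).
have mhn : measurable_fun setT (fun x => h x - g n x) by exact: L2_measurable (L2B Lh (Lg n)).
rewrite le_eqVlt; apply/orP; left; apply/eqP; apply: ae_eq_integral => //.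
- exact/measurable_EFinP/measurable_funX/L2_measurable/Lhn.
- exact/measurable_EFinP/measurable_funX.
- by apply: filterS aeB => x Bx _; rewrite /g patchE mem_set.
Qed.
End riesz_fischer.

Lemma le0_geometric {R : realType} (a K : R) : (forall n, a <= K * 2 ^- n) -> a <= 0.
Proof.
move=> h; rewrite leNgt; apply/negP => a0.
have := h (Num.truncn (K / a)).+1; rewrite leNgt => /negP; apply.
rewrite ltr_pdivrMr ?exprn_gt0// mulrC -ltr_pdivrMr//.
apply: (lt_le_trans (Num.Theory.truncnS_gt _)).
by rewrite -natrX ler_nat ltnW// ltn_expl.
Qed.

(** * Energy estimate on thin time strips *)

Section energy.
Context {R : realType} {m : nat} (P : interface_problem R m).
Hypothesis hP : standing_assumptions P.
Local Notation V := ('rV[R]_m * R)%type.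
Local Notation Vm := ('rV[R]_m * measurableTypeR R)%type.
Local Notation vol := (@vol R m).
Local Notation ip := (ip vol).
Local Notation L2V := (L2 vol setT).
Local Notation T := (horizon P).
Local Notation Q := (QT P).
Implicit Types (w f xi : V -> R) (g : 'I_m -> V -> R) (F : (V -> R) -> R).

Definition strip (s h : R) : set V := [set z | s < z.2 <= s + h].

Lemma measurable_strip s h : measurable (strip s h : set Vm).
Proof.
rewrite (_ : strip s h = setT `*` `]s, (s + h)]%classic); first exact: measurableX.
by apply/seteqP; split => z; rewrite /strip /= in_itv/= => // -[].
Qed.

Variables (w : V -> R) (g : 'I_m -> V -> R) (C : R).
Hypotheses (Wg : W_pair P w g) (C0 : 0 <= C)
  (Cw : forall phi g' h, W_pair P phi g' -> 0 < h ->
    ip w (fun z => shiftt (- h) phi z - phi z) ^+ 2 <= C * h ^+ 2 * grad_nrm2 g').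

Lemma shifted_product_bound q gq s h : W_pair P q gq -> 0 <= s -> 0 < h ->
  ip q (fun z => shiftt h (shiftt s w) z - shiftt s w z) ^+ 2 <=
  C * h ^+ 2 * grad_nrm2 gq.
Proof.
move=> Wq s0 h0; have [Lq Lgq q0 _] := Wq; have [Lw Lg w0 _] := Wg.
have Lf := L2_shiftt (- s) Lq.
pose f := shiftt (- s) q; pose f' := f \_ Q.
have -> : ip q (fun z => shiftt h (shiftt s w) z - shiftt s w z) =
          ip w (fun z => shiftt (- h) f z - f z).
  have Ls := L2_shiftt s Lw.
  rewrite ipBr//; last exact: L2_shiftt.
  rewrite ipBr//; last exact: L2_shiftt.
  rewrite shifttD ![ip q _]ipC.
  rewrite !(ip_shiftt_adj _ Lw Lq).
  by rewrite /f shifttD opprD.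
(* All shifts now act on the test function. Replacing [f] by its restriction to [QT] changes
   nothing: [w] vanishes after $T$, the backward shift reads [f] only at earlier times, and before
   $T$ the two agree because [q] vanishes at times $t\le0$. *)
have -> : ip w (fun z => shiftt (- h) f z - f z) =
          ip w (fun z => shiftt (- h) f' z - f' z).
  apply: eq_Rintegral => z _; have [Qz|/w0[-> _]] := pselect (Q z); last by rewrite !mul0r.
  have E z' : z'.2 < T -> f z' = f' z'.
    move=> zT; rewrite /f' patchE; case: ifPn => // /negP nQ; rewrite /f shifttE.
    apply: (proj1 (q0 _ _)) => -[/= /andP[h1 _] h2].
    by apply: nQ; apply: mem_set; split=> //; apply/andP; split; lra.
  by rewrite !shifttE !E//=; case: Qz => /andP[_ zT] _; lra.
have := Cw (W_pair_shiftt hP (- s) Wq) h0 => /le_trans; apply.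
apply: ler_wpM2l; first by rewrite mulr_ge0 ?sqr_ge0.
exact: grad_nrm2_ext_shiftt.
Qed.

(** A discrete form of $\frac{d}{dt}\|u\|^2=2\langle\partial_tu,u\rangle$ for the increment
    $u=w(\cdot+d)-w$. Shift $u$ by $s$ and restrict it to $Q_T$ to get $q\in W$. Then
    $\|q(\cdot+h)-q\|^2=-2\int q\,(q(\cdot+h)-q)$: the left side controls $u$ on the strip, and the
    right side consists of two increments of $w$ tested with $q$, each at most $h\sqrt{CG}$. *)
Lemma energy_estimate s d h : 0 <= s -> 0 <= d -> 0 < h ->
  ip ((fun z => shiftt d w z - w z) \_ (strip s h))
     ((fun z => shiftt d w z - w z) \_ (strip s h)) <=
  h * (4 * Num.sqrt (C * grad_nrm2 (fun i z => shiftt d (g i) z - g i z))).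
Proof.
move=> s0 d0 h0; have [Lw Lg w0 _] := Wg.
set G := grad_nrm2 _; have G0 : 0 <= G by exact: grad_nrm2_ge0.
pose u z := shiftt d w z - w z; rewrite -/u.
have Lu : L2V u by apply: L2B => //; exact: L2_shiftt.
have Lgu i : L2V (fun z => shiftt d (g i) z - g i z) by apply: L2B => //; exact: L2_shiftt.
pose r := shiftt s u; have Lr : L2V r by exact: L2_shiftt.
pose q := r \_ Q.
pose gq i := shiftt s (fun z => shiftt d (g i) z - g i z) \_ Q.
have Wq : W_pair P q gq.
  have := W_pair_lin (-1) (W_pair_shiftt hP s Wg) (W_pair_shiftt hP (s + d) Wg).
  congr W_pair.
    apply/funext => z; rewrite /q /r /u !patchE; case: (z \in Q); last by rewrite mulr0 addr0.
    rewrite !shifttE /= (addrA z.2); ring.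
  apply/funext => i; apply/funext => z; rewrite /gq !patchE; case: (z \in Q); last by rewrite mulr0 addr0.
  rewrite !shifttE /= (addrA z.2); ring.
have [Lq Lgq q0 _] := Wq; have Lqh := L2_shiftt h Lq.
have gqG : grad_nrm2 gq <= G by exact: grad_nrm2_ext_shiftt.
have rq z : 0 < z.2 -> r z = q z.
  move=> z0; rewrite /q patchE; case: ifPn => // /negP nQ.
  rewrite /r /u !shifttE /= !(proj1 (w0 _ _)) ?subr0// => -[/andP[/= h1 h2] h3];
    by apply: nQ; apply: mem_set; split=> //; apply/andP; split; lra.
have Ld := L2B Lqh Lq.
have -> : ip (u \_ (strip s h)) (u \_ (strip s h)) =
          ip (q \_ (strip 0 h)) (q \_ (strip 0 h)).
  have Ls := L2_indic (measurable_strip s h) Lu.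
  rewrite -(ip_shiftt s Ls Ls); rewrite (_ : shiftt s _ = q \_ (strip 0 h))//.
  apply/funext => z; rewrite shifttE !patchE.
  rewrite (_ : ((z.1, z.2 + s) \in strip s h) = (z \in strip 0 h)); last first.
    by apply/idP/idP => /set_mem /andP[/= h1 h2]; apply/mem_set/andP; split => /=; lra.
  by case: ifPn => // /set_mem /andP[h1 _]; rewrite -rq// /r shifttE.
(* For $-h<t\le0$ the function [q] is 0 while its shift by [h] runs through the strip. *)
have Le : ip (q \_ (strip 0 h)) (q \_ (strip 0 h)) <=
    ip (fun z => shiftt h q z - q z) (fun z => shiftt h q z - q z).
  have Ls := L2_indic (measurable_strip 0 h) Lq.
  rewrite -(ip_shiftt h Ls Ls); apply: ip_le_ip => //.
    exact: L2_measurable (L2_shiftt h Ls).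
  move=> z; rewrite !shifttE patchE; case: ifPn => [/set_mem /andP[/= h1 h2]|_]; last first.
    by rewrite normr0.
  rewrite [q z](_ : _ = 0) ?subr0//; apply: (proj1 (q0 _ _)) => -[/andP[/= h3 _] _].
  lra.
apply: (le_trans Le).
have -> : ip (fun z => shiftt h q z - q z) (fun z => shiftt h q z - q z) =
    - 2 * ip q (fun z => shiftt h q z - q z).
  rewrite ipBr// ![ip (fun z => _ - _) _]ipC !ipBr// (ip_shiftt h Lq Lq) [ip (shiftt h q) q]ipC.
  by ring.
have -> : ip q (fun z => shiftt h q z - q z) =
   ip q (fun z => shiftt h (shiftt (s + d) w) z - shiftt (s + d) w z) -
   ip q (fun z => shiftt h (shiftt s w) z - shiftt s w z).
  rewrite -ipBr//; try by apply: L2B; do ?apply: L2_shiftt.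
  apply: eq_Rintegral => z _; have [Qz|/q0[-> _]] := pselect (Q z); last by rewrite !mul0r.
  congr (_ * _); have z0 : 0 < z.2 by case: Qz => /andP[].
  rewrite -rq// shifttE -rq/=; last by rewrite addr_gt0.
  rewrite /r /u !shifttE/=.
  rewrite (_ : z.2 + h + (s + d) = z.2 + h + s + d) ?addrA//; ring.
have b1 := shifted_product_bound Wq (addr_ge0 s0 d0) h0.
have b2 := shifted_product_bound Wq s0 h0.
have toabs x : x ^+ 2 <= C * h ^+ 2 * grad_nrm2 gq -> `|x| <= h * Num.sqrt (C * G).
  move=> hx; rewrite -(@ger0_norm _ h) ?(ltW h0)// -sqrtr_sqr -[`|h|]sqrtr_sqr.
  rewrite -sqrtrM ?sqr_ge0//; apply: ler_wsqrtr; apply: (le_trans hx).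
  rewrite [leRHS]mulrCA [leRHS]mulrA; apply: ler_wpM2l => //.
  by rewrite mulr_ge0 ?sqr_ge0.
have := toabs _ b1; have := toabs _ b2.
rewrite !ler_norml => /andP[? ?] /andP[? ?]; lra.
Qed.

End energy.

(** * Functions on lines in the direction of time *)

Section sections.
Context {R : realType} {m : nat}.
Local Notation V := ('rV[R]_m * R)%type.
Local Notation Vm := ('rV[R]_m * measurableTypeR R)%type.
Local Notation vol := (@vol R m).
Local Notation L2V := (L2 vol setT).
Local Notation mux := (lebesgue_rV m).
Local Notation mut := (@lebesgue_measure R).
Implicit Types u w : V -> R.

Lemma measurable_Rintegral_section d (Z : measurableType d) (f : Z * measurableTypeR R -> R) :
  measurable_fun setT f -> measurable_fun setT (fun z => \int[mut]_t f (z, t)).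
Proof.
move=> mf; apply: (measurableT_comp (f := fine)); first exact: fine_measurable.
have mE : measurable_fun setT (EFin \o f) by exact/measurable_EFinP.
have hF (g : Z * measurableTypeR R -> \bar R) : measurable_fun setT g ->
    (forall z, (0 <= g z)%E) -> measurable_fun setT (fun z => \int[mut]_t g (z, t))%E.
  by move=> mg g0; exact: (@measurable_fun_fubini_tonelli_F _ _ _ _ R mut g mg g0).
have hp := hF _ (measurable_funepos mE) (fun z => funepos_ge0 _ z).
have hn := hF _ (measurable_funeneg mE) (fun z => funeneg_ge0 _ z).
have := emeasurable_funB hp hn; apply: eq_measurable_fun => z _.
by rewrite [RHS]integralE; congr (_ - _)%E; apply: eq_integral => t _; rewrite /= ?funeposE ?funenegE.
Qed.

Lemma vol_tonelli1 (f : V -> \bar R) : measurable_fun (setT : set Vm) f ->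
  (forall z, (0 <= f z)%E) ->
  (\int[vol]_z f z = \int[mux]_x \int[mut]_t f (x, t))%E.
Proof.
by move=> mf f0; exact: (@fubini_tonelli1 _ _ _ _ R mux mut f mf f0).
Qed.

(* Square integrable on space-time, and also on each line in the direction of time. *)
Definition L2_lines u : Prop :=
  L2V u /\ forall x, L2 mut setT (fun t => u (x, t)).

Lemma L2_linesB u w : L2_lines u -> L2_lines w -> L2_lines (fun z => u z - w z).
Proof. by move=> [Lu lu] [Lw lw]; split => [|x]; exact: L2B. Qed.

Lemma L2_shift (s : R) (f : R -> R) : L2 mut setT f -> L2 mut setT (fun t => f (t + s)).
Proof.
move=> [mf intf]; split; last exact: (@integrable_shift R s (fun t => f t ^+ 2)).
by apply: (measurableT_comp (f := f) mf); exact: measurable_funD.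
Qed.

Lemma L2_lines_shiftt s u : L2_lines u -> L2_lines (shiftt s u).
Proof.
move=> [Lu lu]; split => [|x]; first exact: L2_shiftt.
under eq_fun do rewrite shifttE/=.
exact: (L2_shift s (lu x)).
Qed.

(** By Tonelli the lines of infinite norm lie over a null set of points [x]; there the function is
    set to 0. Time averages are then meaningful for every [x]. *)
Lemma L2_lines_repr w : L2V w -> exists w', [/\ L2_lines w',
  forall x, (forall t, w' (x, t) = w (x, t)) \/ (forall t, w' (x, t) = 0) &
  {ae mux, forall x, forall t, w' (x, t) = w (x, t)}].
Proof.
move=> Lw; have [mw iw] := Lw.
pose I x := (\int[mut]_t (w (x, t) ^+ 2)%:E)%E.
have m2 : measurable_fun (setT : set Vm) (fun z => (w z ^+ 2)%:E).
  exact/measurable_EFinP/measurable_funX.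
have p2 (z : V) : (0 <= (w z ^+ 2)%:E)%E by rewrite lee_fin sqr_ge0.
have mI : measurable_fun setT I.
  exact: (@measurable_fun_fubini_tonelli_F _ _ _ _ R mut (fun z => (w z ^+ 2)%:E) m2 p2).
have I0 x : (0 <= I x)%E by exact: integral_ge0.
have iI : mux.-integrable setT I.
  apply/integrableP; split => //.
  under eq_integral do rewrite gee0_abs//.
  rewrite /I -(vol_tonelli1 m2 p2); have /integrableP[_] := iw.
  by under eq_integral do rewrite gee0_abs//.
pose A := [set x | I x < +oo]%E.
have mA : measurable A by rewrite -[A]setTI; exact: emeasurable_fun_infty_o.
have aeA : {ae mux, forall x, A x}.
  apply: filterS (integrable_ae measurableT iI) => x /(_ Logic.I).
  by rewrite ge0_fin_numE.
pose w' := w \_ (A `*` setT).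
have Lw' : L2V w' by apply: L2_indic => //; exact: measurableX.
have aew : {ae mux, forall x, forall t, w' (x, t) = w (x, t)}.
  by apply: filterS aeA => x Ax t; rewrite /w' patchE mem_set.
exists w'; split => //.
- split => // x; have [Ax|nAx] := pselect (A x).
    rewrite (_ : (fun t => _) = (fun t => w (x, t))); last first.
      by apply/funext => t; rewrite /w' patchE mem_set.
    have mx : measurable_fun setT (fun t : measurableTypeR R => w (x, t)).
      apply: (measurableT_comp mw); apply: measurable_fun_pair => //.
    split => //; apply/integrableP; split; first exact/measurable_EFinP/measurable_funX.
    by under eq_integral do rewrite gee0_abs//.
  rewrite (_ : (fun t => _) = (fun=> 0)); first exact: L20.
  by apply/funext => t; rewrite /w' patchE memNset// => -[].
- move=> x; have [Ax|nAx] := pselect (A x); [left|right] => t.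
    by rewrite /w' patchE mem_set.
  by rewrite /w' patchE memNset// => -[].
Qed.

End sections.

(** * Averages in time *)

Section averages.
Context {R : realType} {m : nat}.
Local Notation V := ('rV[R]_m * R)%type.
Local Notation Vm := ('rV[R]_m * measurableTypeR R)%type.
Local Notation vol := (@vol R m).
Local Notation L2V := (L2 vol setT).
Local Notation mux := (lebesgue_rV m).
Local Notation mut := (@lebesgue_measure R).
Implicit Types u w : V -> R.

Let I (h : R) : set (measurableTypeR R) := `]0, h]%classic.

Let mI h : measurable (I h). Proof. exact: measurable_itv. Qed.

Let volI h : 0 < h -> mut (I h) = h%:E.
Proof. by move=> h0; rewrite lebesgue_measure_itv/= lte_fin h0 oppr0 adde0. Qed.

Let L2I h : 0 < h -> L2 mut setT (\1_(I h)).
Proof. by move=> h0; apply: L2_cst_indic => //; rewrite [X in (X < _)%E]volI// ltry. Qed.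

Let ipI h : 0 < h -> ip mut (\1_(I h)) (\1_(I h)) = h.
Proof.
move=> h0; have -> : ip mut (\1_(I h) : R -> R) (\1_(I h)) = \int[mut]_t (\1_(I h) t).
  by apply: eq_Rintegral => t _; rewrite indicE; case: (_ \in _); rewrite ?mulr1 ?mulr0.
by rewrite /Rintegral integral_indic// setIT [X in fine X]volI.
Qed.

Definition avg (h : R) u (x : 'rV[R]_m) : R :=
  h^-1 * ip mut (\1_(I h)) (fun t => u (x, t)).

Lemma measurable_avg h u : measurable_fun (setT : set Vm) u ->
  measurable_fun setT (avg h u).
Proof.
move=> mu; apply: measurable_funM => //.
apply: (measurable_Rintegral_section (f := fun z : Vm => \1_(I h) z.2 * u z)).
apply: measurable_funM => //.
have mi : measurable_fun setT (\1_(I h) : measurableTypeR R -> R) by exact: measurable_indic.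
exact: (measurableT_comp mi (@measurable_snd _ _ _ _)).
Qed.

Lemma avg_sqr_le h u x : 0 < h -> L2_lines u ->
  (avg h u x) ^+ 2 <= h^-1 * ip mut (fun t => (u \_ (strip 0 h)) (x, t))
                                    (fun t => (u \_ (strip 0 h)) (x, t)).
Proof.
move=> h0 [_ lu].
have E t : (u \_ (strip 0 h)) (x, t) = ((fun t => u (x, t)) \_ (I h)) t.
  rewrite !patchE (_ : ((x, t) \in strip 0 h) = (t \in I h))//.
  by apply/idP/idP => /set_mem /= H; apply/mem_set; move: H;
    rewrite /strip /I /= in_itv/= add0r.
under eq_fun do rewrite E.
have LI := L2_indic (mI h) (lu x); rewrite /avg.
rewrite (_ : ip mut (\1_(I h)) (fun t => u (x, t)) =
  ip mut (\1_(I h)) ((fun t => u (x, t)) \_ (I h))); last first.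
  apply: eq_Rintegral => t _; rewrite patchE indicE.
  by case: (t \in I h); rewrite ?mul0r.
rewrite exprMn expr2 -mulrA ler_pM2l ?invr_gt0//.
rewrite ler_pdivrMl//; apply: (le_trans (ip_cauchy_schwarz (L2I h0) LI)).
by rewrite ipI.
Qed.

(** Cauchy-Schwarz on $(0,h]$ for each [x], then Tonelli. *)
Lemma avg_L2 h u : 0 < h -> L2_lines u -> L2 mux setT (avg h u) /\
  ip mux (avg h u) (avg h u) <= h^-1 * ip vol (u \_ (strip 0 h)) (u \_ (strip 0 h)).
Proof.
move=> h0 lu; have [Lu ux] := lu; have ma := measurable_avg h (L2_measurable Lu).
have Ls := L2_indic (measurable_strip 0 h) Lu; set us := _ \_ _ in Ls *.
have h10 : 0 <= h^-1 by rewrite invr_ge0 ltW.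
have ms : measurable_fun (setT : set Vm) (fun z => (us z ^+ 2)%:E).
  by apply/measurable_EFinP/measurable_funX; case: Ls.
have p2 (z : V) : (0 <= (us z ^+ 2)%:E)%E by rewrite lee_fin sqr_ge0.
have bd : (\int[mux]_x ((avg h u x) ^+ 2)%:E <= (h^-1 * ip vol us us)%:E)%E.
  rewrite EFinM ip_EFin// (vol_tonelli1 ms p2) -ge0_integralZl//; last 2 first.
  - exact: (@measurable_fun_fubini_tonelli_F _ _ _ _ R mut (fun z => (us z ^+ 2)%:E) ms p2).
  - by move=> x _; apply: integral_ge0.
  apply: ge0_le_integral => //.
  - by move=> x _; rewrite lee_fin sqr_ge0.
  - exact/measurable_EFinP/measurable_funX.
  - apply: emeasurable_funM => //.
    exact: (@measurable_fun_fubini_tonelli_F _ _ _ _ R mut (fun z => (us z ^+ 2)%:E) ms p2).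
  move=> x _; have := avg_sqr_le x h0 lu; rewrite -lee_fin => /le_trans; apply.
  rewrite EFinM lee_wpmul2l//.
  have Lx : L2 mut setT (fun t => us (x, t)).
    have := L2_indic (mI h) (ux x); congr L2; apply/funext => t; rewrite /us !patchE.
    rewrite (_ : ((x, t) \in strip 0 h) = (t \in I h))//.
    by apply/idP/idP => /set_mem /= H; apply/mem_set; move: H;
      rewrite /strip /I /= in_itv/= add0r.
  rewrite ip_sqr /Rintegral fineK//.
  by apply: integrable_fin_num => //; case: Lx.
have La : L2 mux setT (avg h u).
  split => //; apply/integrableP; split; first exact/measurable_EFinP/measurable_funX.
  under eq_integral do rewrite gee0_abs ?lee_fin ?sqr_ge0//.
  by apply: le_lt_trans bd _; rewrite ltry.
split => //; rewrite -lee_fin; apply: le_trans bd.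
rewrite ip_sqr /Rintegral fineK//; apply: integrable_fin_num => //.
by case: La.
Qed.

Lemma avgB h u u' : 0 < h -> L2_lines u -> L2_lines u' ->
  avg h (fun z => u z - u' z) = (fun x => avg h u x - avg h u' x).
Proof.
move=> h0 [_ lu] [_ lu']; apply/funext => x.
by rewrite /avg ipBr// ?mulrBr//; exact: L2I.
Qed.

(** $(0,(k+1)h]$ is the disjoint union of $(0,kh]$ and a translate of $(0,h]$, so the average is a
    convex combination. The half-open intervals make the partition exact. *)
Lemma avg_split h k u : 0 < h -> (0 < k)%N -> L2_lines u ->
  avg (k.+1%:R * h) u = (fun x => k.+1%:R^-1 *
    (k%:R * avg (k%:R * h) u x + avg h (shiftt (k%:R * h) u) x)).
Proof.
move=> h0 k0 lu; apply/funext => x; have [_ ux] := lu.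
have kh0 : 0 < k%:R * h by rewrite mulr_gt0 ?ltr0n.
have [_ lsx] := L2_lines_shiftt (k%:R * h) lu.
rewrite /avg.
set c := k%:R * h in kh0 lsx *.
have LIc : L2 mut setT (fun t => \1_(I h) (t - c)) := L2_shift (- c) (L2I h0).
have -> : ip mut (\1_(I h)) (fun t => shiftt c u (x, t)) =
    ip mut (fun t => \1_(I h) (t - c)) (fun t => u (x, t)).
  rewrite -[RHS](@Rintegral_shift R c _ (L2_mul LIc (ux x))).
  by apply: eq_Rintegral => t _; rewrite addrK shifttE.
have -> : ip mut (\1_(I (k.+1%:R * h))) (fun t => u (x, t)) =
  ip mut (\1_(I c)) (fun t => u (x, t)) +
  ip mut (fun t => \1_(I h) (t - c)) (fun t => u (x, t)).
  rewrite -ipDl//; last exact: L2I.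
  apply: eq_Rintegral => t _; congr (_ * _).
  rewrite (_ : k.+1%:R * h = c + h); last by rewrite -natr1 mulrDl mul1r.
  rewrite !indicE /I !mem_setE !in_itv/= subr_gt0 lerBlDl.
  have [t1|t1] := ltP 0 t; have [t2|t2] := lerP t c; rewrite ?add0r ?addr0//=.
  - by rewrite (le_trans t2) ?lerDl ?(ltW h0)//= addr0.
  - by exfalso; lra.
rewrite /c.
have h0' : h != 0 by rewrite gt_eqF.
have k0' : k%:R != 0 :> R by rewrite pnatr_eq0 -lt0n.
have k1 : k.+1%:R != 0 :> R by rewrite pnatr_eq0.
by field; rewrite h0' k0' nat1r k1.
Qed.

End averages.

(** * Averages over short intervals approximate the function *)

Section vol_sigma_finite.
Context {R : realType} (m : nat).
Local Notation Vm := ('rV[R]_m * measurableTypeR R)%type.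

(** The same measure under a second name, to carry the sigma-finite structure that Tonelli's theorem
    on space-time times a time axis requires. *)
Definition volume : set Vm -> \bar R := @vol R m.

HB.instance Definition _ := Measure.copy volume (@vol R m).

Let volume_sigma_finite : sigma_finite setT volume.
Proof.
have /sigma_finiteP[F [FT ndF Foo]] := sigma_finiteT (@lebesgue_rV R m).
have /sigma_finiteP[G [GT ndG Goo]] := sigma_finiteT (@lebesgue_measure R).
exists (fun k => F k `*` G k).
  apply/esym; rewrite -subTset => z _.
  have [i _ Fi] : (\bigcup_i F i) z.1 by rewrite -FT.
  have [j _ Gj] : (\bigcup_i G i) z.2 by rewrite -GT.
  exists (maxn i j) => //; split.
    by move: Fi; exact/subsetPset/ndF/leq_maxl.
  by move: Gj; exact/subsetPset/ndG/leq_maxr.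
move=> k; have [mF Fk] := Foo k; have [mG Gk] := Goo k; split.
  exact: measurableX.
by rewrite /volume /vol /= product_measure1E// lte_mul_pinfty// ge0_fin_numE.
Qed.

HB.instance Definition _ := Measure_isSigmaFinite.Build _ _ _ volume
  volume_sigma_finite.

End vol_sigma_finite.

Section average_close.
Context {R : realType} {m : nat}.
Local Notation V := ('rV[R]_m * R)%type.
Local Notation Vm := ('rV[R]_m * measurableTypeR R)%type.
Local Notation vol := (@vol R m).
Local Notation ipt := (ip (@lebesgue_measure R)).
Local Notation ip := (ip vol).
Local Notation L2V := (L2 vol setT).
Local Notation mut := (@lebesgue_measure R).
Implicit Types u w : V -> R.

Definition avg_diff (h : R) w (z : V) : R := avg h (shiftt z.2 w) z.1 - w z.

Variables (w : V -> R) (h e : R).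
Hypotheses (h0 : 0 < h) (lw : L2_lines w)
  (we : forall s, 0 <= s <= h ->
    ip (fun z => shiftt s w z - w z) (fun z => shiftt s w z - w z) <= e).

Let I : set (measurableTypeR R) := `]0, h]%classic.

Let mI : measurable I. Proof. exact: measurable_itv. Qed.

Let volI : mut I = h%:E.
Proof. by rewrite lebesgue_measure_itv/= lte_fin h0 oppr0 adde0. Qed.

Let Ioo : (mut I < +oo)%E.
Proof. by rewrite volI ltry. Qed.

Let L2I : L2 mut setT (\1_I).
Proof. exact: L2_cst_indic mI Ioo. Qed.

Let K (p : Vm * measurableTypeR R) : R := \1_I p.2 * (w (p.1.1, p.1.2 + p.2) - w p.1).

Let mK : measurable_fun setT K.
Proof.
have [[mw _] _] := lw.
apply: measurable_funM.
  have mi : measurable_fun setT (\1_I : measurableTypeR R -> R) by exact: measurable_indic.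
  exact: (measurableT_comp mi (@measurable_snd _ _ _ _)).
apply: measurable_funB; last exact: (measurableT_comp mw measurable_fst).
apply: (measurableT_comp mw); apply: measurable_fun_pair.
  exact: (measurableT_comp measurable_fst measurable_fst).
apply: measurable_funD; last exact: measurable_snd.
exact: (measurableT_comp measurable_snd measurable_fst).
Qed.

Let ipI : ipt (\1_I) (\1_I) = h.
Proof.
have -> : ipt (\1_I : R -> R) (\1_I) = \int[mut]_t (\1_I t).
  by apply: eq_Rintegral => t _; rewrite indicE; case: (_ \in _); rewrite ?mulr1 ?mulr0.
by rewrite /Rintegral integral_indic// setIT [X in fine X]volI.
Qed.

Let indic_sqr t : \1_I t * \1_I t = \1_I t :> R.
Proof. by rewrite indicE; case: (t \in I); rewrite ?mulr1 ?mulr0. Qed.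

Let k (z : V) (s : R) : R := \1_I s * (w (z.1, z.2 + s) - w z).

Let kE z : k z = (fun s => shiftt z.2 w (z.1, s) - w z * \1_I s) \_ I.
Proof.
apply/funext => s; rewrite patchE shifttE /= /k indicE (addrC s).
by case: (s \in I); rewrite ?mul0r// mul1r mulr1.
Qed.

Let LK z : L2 mut setT (k z).
Proof.
have [_ lsx] := L2_lines_shiftt z.2 lw.
by rewrite kE; apply: L2_indic => //; apply: L2B; [exact: lsx|exact: L2Z].
Qed.

Let IK (z : V) : ipt (\1_I) (k z) = h * avg_diff h w z.
Proof.
have [_ lsx] := L2_lines_shiftt z.2 lw.
rewrite /avg_diff /avg mulrBr mulVKf ?gt_eqF//.
have -> : h * w z = ipt (\1_I) (fun s => w z * \1_I s).
  by rewrite ipZr// ipI mulrC.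
rewrite -ipBr//; last exact: L2Z.
apply: eq_Rintegral => s _; rewrite kE patchE indicE.
by case: (s \in I); rewrite ?mul0r.
Qed.

Lemma measurable_avg_diff : measurable_fun (setT : set Vm) (avg_diff h w).
Proof.
have -> : avg_diff h w = (fun z => h^-1 * \int[mut]_s K (z, s)).
  apply/funext => z; rewrite (_ : \int[mut]_s K (z, s) = ipt (\1_I) (k z)).
    by rewrite IK mulKf// gt_eqF.
  by apply: eq_Rintegral => s _; rewrite /k mulrA indic_sqr.
by apply: measurable_funM => //; exact: measurable_Rintegral_section mK.
Qed.

Let avg_diff_sqr z : ((avg_diff h w z ^+ 2)%:E <=
  h^-1%:E * \int[mut]_s (K (z, s) ^+ 2)%:E)%E.
Proof.
have -> : (\int[mut]_s (K (z, s) ^+ 2)%:E = (ipt (k z) (k z))%:E)%E.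
  rewrite ip_sqr /Rintegral fineK//; apply: integrable_fin_num => //.
  by case: (LK z).
rewrite -EFinM lee_fin ler_pdivlMl// -(ler_pM2l h0) mulrA -expr2 -exprMn -IK.
by apply: (le_trans (ip_cauchy_schwarz L2I (LK z))); rewrite ipI.
Qed.

(** The error is the mean over $s\in(0,h]$ of $w(\cdot+s)-w$. By Cauchy-Schwarz its square is at
    most the mean of the squares, and exchanging the integrals leaves the hypothesis on single
    shifts. *)
Lemma avg_close : (\int[vol]_z (avg_diff h w z ^+ 2)%:E <= e%:E)%E.
Proof.
have mK2 : measurable_fun setT (fun p => (K p ^+ 2)%:E).
  exact/measurable_EFinP/measurable_funX.
have K20 p : (0 <= (K p ^+ 2)%:E)%E by rewrite lee_fin sqr_ge0.
have mF : measurable_fun setT (fun z : Vm => \int[mut]_s (K (z, s) ^+ 2)%:E)%E.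
  exact: (@measurable_fun_fubini_tonelli_F _ _ _ _ R mut _ mK2 K20).
have h10 : (0 <= h^-1%:E)%E by rewrite lee_fin invr_ge0 ltW.
have F0 z : (0 <= \int[mut]_s (K (z, s) ^+ 2)%:E)%E by exact: integral_ge0.
apply: (@le_trans _ _ (\int[vol]_z (h^-1%:E * \int[mut]_s (K (z, s) ^+ 2)%:E))%E).
  apply: ge0_le_integral => //.
  - by move=> z _; rewrite lee_fin sqr_ge0.
  - by apply/measurable_EFinP; apply: measurable_funX; exact: measurable_avg_diff.
  - exact: emeasurable_funM.
rewrite ge0_integralZl//.
have := @fubini_tonelli _ _ _ _ R (@volume R m) mut _ mK2 K20.
rewrite /volume => ->.
rewrite muleC lee_pdivrMr//.
apply: (@le_trans _ _ (\int[mut]_s (e * \1_I s)%:E)%E).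
  apply: ge0_le_integral => //.
  - by move=> s _; apply: integral_ge0.
  - exact: (@measurable_fun_fubini_tonelli_G _ _ _ _ R (@volume R m) _ mK2 K20).
  - by apply/measurable_EFinP; apply: measurable_funM => //; exact: measurable_indic.
  move=> s _; have [Is|nIs] := pselect (I s); last first.
    rewrite integral0_eq ?lee_fin ?indicE ?memNset ?mulr0// => z _.
    by rewrite /K indicE memNset// mul0r expr0n.
  rewrite indicE mem_set// mulr1.
  have sh : 0 <= s <= h by move: Is; rewrite /I /= in_itv/= => /andP[/ltW -> ->].
  have [Lw _] := lw; have Ld := L2B (L2_shiftt s Lw) Lw.
  have := we sh; rewrite -lee_fin (ip_EFin Ld); apply: le_trans.
  rewrite le_eqVlt; apply/orP; left; apply/eqP; apply: eq_integral => z _.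
  by rewrite /K indicE mem_set// mul1r shifttE.
under eq_integral do rewrite EFinM.
rewrite integralZl//; last first.
  have := integrable_cst_indic 1 mI Ioo; apply: eq_integrable => // t _ /=.
  by rewrite mul1r.
by rewrite integral_indic// setIT [X in (_ * X)%E]volI.
Qed.

End average_close.

(** * Estimates on averages, uniform in time *)

Section uniform_averages.
Context {R : realType} {m : nat}.
Local Notation V := ('rV[R]_m * R)%type.
Local Notation Vm := ('rV[R]_m * measurableTypeR R)%type.
Local Notation vol := (@vol R m).
Local Notation ipx := (ip (lebesgue_rV m)).
Local Notation ip := (ip vol).
Local Notation L2V := (L2 vol setT).
Local Notation mux := (lebesgue_rV m).
Local Notation mut := (@lebesgue_measure R).

Lemma shiftt_strip t s h (u : V -> R) :
  (shiftt t u) \_ (strip s h) = shiftt t (u \_ (strip (t + s) h)).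
Proof.
apply/funext => z; rewrite shifttE !patchE shifttE.
congr (if _ then _ else _); apply/idP/idP => /set_mem /andP[/= h1 h2];
  by apply/mem_set/andP; split => /=; lra.
Qed.

Variable w : V -> R.
Hypothesis lw : L2_lines w.

Let du d : V -> R := fun z => shiftt d w z - w z.

Let Y h t := avg h (shiftt t w).

Let LY h t : 0 < h -> L2 mux setT (Y h t).
Proof. by move=> h0; case: (avg_L2 h0 (L2_lines_shiftt t lw)). Qed.

Variables (d0 e : R).
Hypothesis we : forall d s h, 0 <= d <= d0 -> 0 <= s -> 0 < h ->
  ip (du d \_ (strip s h)) (du d \_ (strip s h)) <= h * e.

(** The difference of the two averages is the average of an increment over a strip of width [h]; the
    factor [h] of the energy estimate cancels the $h^{-1}$ of [avg_L2], so the bound does not depend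
    on [h]. *)
Lemma avg_shift_le h t d : 0 < h -> 0 <= t -> 0 <= d <= d0 ->
  ipx (fun x => Y h (t + d) x - Y h t x) (fun x => Y h (t + d) x - Y h t x) <= e.
Proof.
move=> h0 t0 dd.
have ld : L2_lines (du d) by apply: L2_linesB => //; exact: L2_lines_shiftt.
have -> : (fun x => Y h (t + d) x - Y h t x) = avg h (shiftt t (du d)).
  rewrite -avgB//; try exact: L2_lines_shiftt.
  congr avg; apply/funext => z; rewrite !shifttE /du shifttE /=.
  by rewrite addrA.
have [_ h1] := avg_L2 h0 (L2_lines_shiftt t ld); apply: (le_trans h1).
rewrite ler_pdivrMl// shiftt_strip addr0.
have [Ld _] := ld; have Ls := L2_indic (measurable_strip t h) Ld.
by rewrite (ip_shiftt t Ls Ls); exact: we.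
Qed.

(** Induction along [avg_split]. Each new difference is a convex combination of the previous one and
    of a shift of the short average, so by convexity of the squared norm the bound [e] does not
    accumulate. *)
Lemma avg_multiple_le h t k : 0 < h -> 0 <= t -> 0 <= e -> k.+1%:R * h <= d0 ->
  ipx (fun x => Y (k.+1%:R * h) t x - Y h t x)
      (fun x => Y (k.+1%:R * h) t x - Y h t x) <= e.
Proof.
move=> h0 t0 e0; elim: k => [|k ih] kh.
  rewrite mul1r (_ : (fun x => _) = (fun=> 0)); last by apply/funext => x; rewrite subrr.
  by rewrite ip0l.
have k0 : 0 < k.+1%:R * h by rewrite mulr_gt0.
have kd : k.+1%:R * h <= d0.
  by apply: le_trans kh; rewrite ler_pM2r// ler_nat.
have -> : (fun x => Y (k.+2%:R * h) t x - Y h t x) =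
    (fun x => (k.+1%:R / k.+2%:R) * (Y (k.+1%:R * h) t x - Y h t x) +
      k.+2%:R^-1 * (Y h (t + k.+1%:R * h) x - Y h t x)).
  apply/funext => x; rewrite {1}/Y avg_split//; last exact: L2_lines_shiftt.
  rewrite shifttD (addrC _ t) -/(Y _ _) -/(Y _ _).
  have n2 : k.+2%:R != 0 :> R by rewrite pnatr_eq0.
  have -> : k.+1%:R = k.+2%:R - 1 :> R by rewrite -[k.+2%:R]natr1 addrK.
  by field.
have Lk := LY t k0; have Lh := LY t h0; have Lt := LY (t + k.+1%:R * h) h0.
have E : k.+1%:R / k.+2%:R + k.+2%:R^-1 = 1 :> R.
  by rewrite -[X in _ + X]mul1r -mulrDl natr1 divff ?pnatr_eq0.
apply: le_trans (ip_convex (L2B Lk Lh) (L2B Lt Lh) _ _ E) _ => //.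
have kd' : 0 <= k.+1%:R * h <= d0 by rewrite (ltW k0).
have h1 := ih kd; have h2 := avg_shift_le h0 t0 kd'.
apply: le_trans (lerD (ler_wpM2l _ h1) (ler_wpM2l _ h2)) _ => //.
by rewrite -mulrDl E mul1r.
Qed.

End uniform_averages.

(** * Convergence of the averages at every time *)

Section trace_exists.
Context {R : realType} {m : nat} (P : interface_problem R m).
Hypothesis hP : standing_assumptions P.
Local Notation V := ('rV[R]_m * R)%type.
Local Notation Vm := ('rV[R]_m * measurableTypeR R)%type.
Local Notation vol := (@vol R m).
Local Notation ipx := (ip (lebesgue_rV m)).
Local Notation ip := (ip vol).
Local Notation L2V := (L2 vol setT).
Local Notation mux := (lebesgue_rV m).
Local Notation mut := (@lebesgue_measure R).
Local Notation T := (horizon P).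
Local Notation Q := (QT P).

Let du (w : V -> R) d : V -> R := fun z => shiftt d w z - w z.

Lemma equicontinuity w g F : W_pair P w g -> W_dual P F -> one_sided P w F (-1) ->
  forall e, 0 < e -> exists2 d0, 0 < d0 & forall d, 0 <= d -> d < d0 ->
    ip (du w d) (du w d) <= e /\
    forall s h, 0 <= s -> 0 < h ->
      ip (du w d \_ (strip s h)) (du w d \_ (strip s h)) <= h * e.
Proof.
move=> Wg DF osF e e0; have [Lw Lg w0 _] := Wg.
have [C C0 HC] : exists2 C, 0 <= C & forall phi g' h, W_pair P phi g' -> 0 < h ->
    ip w (fun z => shiftt (- h) phi z - phi z) ^+ 2 <= C * h ^+ 2 * grad_nrm2 g'.
  have sg1 : (-1) ^+ 2 = 1 :> R by rewrite sqrrN expr1n.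
  have [C C0 HC] := one_sided_bound hP Lw (fun z nz => proj1 (w0 z nz)) DF osF sg1.
  by exists C => // phi g' h Wphi h0; rewrite -mulN1r; exact: HC.
(* If the increment of the pair has squared norm $N\le e'$, then $4\sqrt{CN}\le e$, as
   [energy_estimate] demands. *)
pose e' := Num.min e ((e / 4) ^+ 2 / (C + 1)).
have C1 : 0 < C + 1 by rewrite ltr_wpDl.
have e'0 : 0 < e' by rewrite lt_min e0 divr_gt0// exprn_gt0// divr_gt0.
have [d0 d00 hd] := nrm2_shift_cvg Wg e'0; exists d0 => // d dp dd.
have := hd d dp dd; set N := nrm2 _ _ => /ltW; rewrite le_min => /andP[N1 N2].
split; first exact: le_trans (ip_le_nrm2 _ _) N1.
move=> s h s0 h0; apply: (le_trans (energy_estimate hP Wg C0 HC s0 dp h0)).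
rewrite ler_pM2l// -ler_pdivlMl// (_ : 4^-1 * e = e / 4); last exact: mulrC.
rewrite -[leRHS]ger0_norm ?divr_ge0 ?(ltW e0)// -sqrtr_sqr; apply: ler_wsqrtr.
have N3 := le_trans (grad_le_nrm2 _ _ : _ <= N) N2.
apply: (le_trans (ler_wpM2l C0 N3)); rewrite mulrCA ler_piMr ?sqr_ge0//.
by rewrite ler_pdivrMr// mul1r lerDl.
Qed.

Section limit.
Variable w : V -> R.
Hypotheses (lw : L2_lines w) (w0 : forall z, ~ Q z -> w z = 0)
  (we : forall e, 0 < e -> exists2 d0, 0 < d0 & forall d, 0 <= d -> d < d0 ->
    ip (du w d) (du w d) <= e /\
    forall s h, 0 <= s -> 0 < h ->
      ip (du w d \_ (strip s h)) (du w d \_ (strip s h)) <= h * e).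

Let Y h t := avg h (shiftt t w).

(** Taking powers of two with nondecreasing exponents makes each step an integer multiple of all
    later ones, which [avg_multiple_le] needs to compare averages. *)
Lemma averaging_steps : exists h : nat -> R, [/\ forall n, 0 < h n,
  forall n d, 0 <= d -> d <= h n -> ip (du w d) (du w d) <= 8 ^- n,
  forall n d s r, 0 <= d <= h n -> 0 <= s -> 0 < r ->
    ip (du w d \_ (strip s r)) (du w d \_ (strip s r)) <= r * 8 ^- n &
  forall n k, (n <= k)%N -> exists j, h n = j.+1%:R * h k].
Proof.
have e0 n : 0 < 8 ^- n :> R by rewrite invr_gt0 exprn_gt0.
have /choice[M hM] : forall n, exists M : nat, forall d, 0 <= d -> d <= 2 ^- M ->
    ip (du w d) (du w d) <= 8 ^- n /\
    forall s h, 0 <= s -> 0 < h ->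
      ip (du w d \_ (strip s h)) (du w d \_ (strip s h)) <= h * 8 ^- n.
  move=> n; have [d0 d00 hd] := we (e0 n); exists (Num.truncn d0^-1).+1 => d dp dd.
  apply: hd => //; apply: (le_lt_trans dd).
  rewrite invf_plt ?posrE ?exprn_gt0//.
  apply: (lt_le_trans (Num.Theory.truncnS_gt _)).
  by rewrite -natrX ler_nat ltnW// ltn_expl.
(* Partial sums are monotone and still dominate [M]. *)
pose N n := (\sum_(i < n.+1) M i)%N.
have MN n : (M n <= N n)%N by rewrite /N big_ord_recr leq_addl.
have NN : {homo N : n k / (n <= k)%N}.
  apply: homo_leq => [//|a b c|n]; first exact: leq_trans.
  by rewrite /N [leqRHS]big_ord_recr leq_addr.
have NM n : 2 ^- N n <= 2 ^- M n :> R.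
  by rewrite lef_pV2 ?posrE ?exprn_gt0// ler_weXn2l// ler1n.
exists (fun n => 2 ^- N n); split.
- by move=> n; rewrite invr_gt0 exprn_gt0.
- by move=> n d d0 dh; case: (hM n d d0 (le_trans dh (NM n))).
- move=> n d s r /andP[d0 dh] s0 r0.
  by case: (hM n d d0 (le_trans dh (NM n))) => _; apply.
- move=> n k nk; exists (2 ^ (N k - N n)).-1.
  have -> : 2 ^+ N k = 2 ^+ (N k - N n) * 2 ^+ N n :> R by rewrite -exprD subnK// NN.
  by rewrite prednK ?expn_gt0// natrX invfM mulrA divff ?mul1r// expf_neq0.
Qed.

(** At each $t\ge0$ the averages at scales [h n] are Cauchy at a rate that does not depend on [t];
    [riesz_fischer] supplies the limit [y t] and keeps the rate. *)
Lemma limit_of_averages : exists (h : nat -> R) (y : R -> 'rV[R]_m -> R), [/\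
  forall n, 0 < h n,
  forall n d, 0 <= d <= h n -> ip (du w d) (du w d) <= 8 ^- n,
  forall n t d, 0 <= t -> 0 <= d <= h n ->
    ipx (fun x => Y (h n) (t + d) x - Y (h n) t x)
        (fun x => Y (h n) (t + d) x - Y (h n) t x) <= 8 ^- n &
  forall t, 0 <= t -> L2 mux setT (y t) /\ forall n,
    ipx (fun x => y t x - Y (h n) t x) (fun x => y t x - Y (h n) t x) <= 8 ^- n].
Proof.
have [h [h0 h1 h2 h3]] := averaging_steps; exists h.
have LY n t : L2 mux setT (Y (h n) t).
  by have [] := avg_L2 (h0 n) (L2_lines_shiftt t lw).
have /choice[y hy] : forall t, exists y, 0 <= t -> L2 mux setT y /\ forall n,
    ipx (fun x => y x - Y (h n) t x) (fun x => y x - Y (h n) t x) <= 8 ^- n.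
  move=> t; have [t0|nt] := pselect (0 <= t); last by exists (fun=> 0) => /nt.
  have [n k nk|y Ly hy] := @riesz_fischer _ _ _ mux (fun n => Y (h n) t) (LY ^~ t); last first.
    by exists y.
  have [j hj] := h3 n k nk.
  have e0 : 0 <= 8 ^- n :> R by rewrite invr_ge0 exprn_ge0.
  have hj' : j.+1%:R * h k <= h n by rewrite hj.
  have := avg_multiple_le lw (h2 n) (h0 k) t0 e0 hj'; rewrite -hj.
  by rewrite ip_subC.
exists y; split => //.
- by move=> n d /andP[]; exact: h1.
- by move=> n t d t0 dh; exact: (avg_shift_le lw (h2 n) (h0 n) t0 dh).
Qed.

End limit.
End trace_exists.

(** * The continuous representative and its zero value at the horizon *)

Section trace_at_horizon.
Context {R : realType} {m : nat} (P : interface_problem R m).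
Hypothesis hP : standing_assumptions P.
Local Notation V := ('rV[R]_m * R)%type.
Local Notation Vm := ('rV[R]_m * measurableTypeR R)%type.
Local Notation vol := (@vol R m).
Local Notation ipx := (ip (lebesgue_rV m)).
Local Notation ipt := (ip (@lebesgue_measure R)).
Local Notation ip := (ip vol).
Local Notation L2V := (L2 vol setT).
Local Notation mux := (lebesgue_rV m).
Local Notation mut := (@lebesgue_measure R).
Local Notation T := (horizon P).
Local Notation Q := (QT P).

Let mO : measurable (Omega P).
Proof. exact: open_measurable_rV (Omega_open hP). Qed.

Lemma Rintegral_Omega_le f : L2 mux setT f -> \int[mux]_(x in Omega P) (f x ^+ 2) <= ipx f f.
Proof.
move=> Lf; rewrite Rintegral_mkcond.
rewrite (_ : \int[mux]_x _ = ipx (f \_ (Omega P)) (f \_ (Omega P))); last first.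
  rewrite ip_sqr; apply: eq_Rintegral => x _; rewrite !patchE.
  by case: ifPn => // _; rewrite expr0n.
apply: ip_le_ip => //; first exact: L2_measurable (L2_indic mO Lf).
by move=> x; rewrite patchE; case: ifPn => // _; rewrite normr0.
Qed.

(** The limit [y] of the averages is the representative: it is continuous as a uniform limit of
    uniformly continuous averages, it agrees with [p] at almost every time by [avg_close], and it
    vanishes at $T$ because the averages from $T$ on see only the extension by 0. *)
Lemma trace_at_horizon p F : W_space P p -> W_dual P F ->
  one_sided P (p \_ Q) F (-1) -> has_trace P p T (fun=> 0).
Proof.
move=> Wp DF osF; have Wg := W_space_pair hP Wp; have T0 := horizon_gt0 hP.
have [Lp Lg p0 _] := Wg.
have [w [lw wp aew]] := L2_lines_repr Lp.
have w0 z : ~ Q z -> w z = 0.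
  by case: z => x t nQ; have [->|->//] := wp x; rewrite (proj1 (p0 _ nQ)).
have dup d z : `|shiftt d w z - w z| <= `|shiftt d (p \_ Q) z - (p \_ Q) z|.
  case: z => x t; rewrite !shifttE /=.
  by have [E|E] := wp x; rewrite !E// subr0 normr0.
have [Lw _] := lw.
have Ldu (f : V -> R) d : L2V f -> L2V (fun z => shiftt d f z - f z).
  by move=> Lf; apply: L2B => //; exact: L2_shiftt.
have we e : 0 < e -> exists2 d0, 0 < d0 & forall d, 0 <= d -> d < d0 ->
    ip (fun z => shiftt d w z - w z) (fun z => shiftt d w z - w z) <= e /\
    forall s h, 0 <= s -> 0 < h ->
      ip ((fun z => shiftt d w z - w z) \_ (strip s h))
         ((fun z => shiftt d w z - w z) \_ (strip s h)) <= h * e.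
  move=> e0; have [d0 d00 hd] := equicontinuity hP Wg DF osF e0.
  exists d0 => // d dp dd; have [h1 h2] := hd d dp dd; split.
    apply: (le_trans _ h1); apply: ip_le_ip; last exact: dup.
      exact: L2_measurable (Ldu _ _ Lw).
    exact: Ldu.
  move=> s h s0 h0; apply: (le_trans _ (h2 s h s0 h0)); apply: ip_le_ip.
  - exact: L2_measurable (L2_indic (measurable_strip s h) (Ldu _ _ Lw)).
  - exact: L2_indic (measurable_strip s h) (Ldu _ _ Lp).
  - move=> z; rewrite !patchE; case: ifPn => // _; exact: dup.
have pow82 n : 8 ^- n <= 2 ^- n :> R.
  by rewrite lef_pV2 ?posrE ?exprn_gt0// lerXn2r ?nnegrE// ler_nat.
have [h [y [h0 hsh hY hy]]] := limit_of_averages lw we.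
pose Y n t := avg (h n) (shiftt t w).
have LY n t : L2 mux setT (Y n t).
  by have [] := avg_L2 (h0 n) (L2_lines_shiftt t lw).
exists y; split.
- move=> t /andP[t0 _]; have [[my iy] _] := hy t t0; split.
    exact: measurable_funTS.
  by apply: integrableS iy.
- move=> t /andP[t0 _] e e0.
  (* $10=2+4+4$: two applications of [ipDle] to the path from $y(r)$ through the two averages to
     $y(t)$. *)
  have [n hn] : exists n, 10 * 8 ^- n < e :> R.
    exists (Num.truncn (10 / e)).+1; rewrite ltr_pdivrMr ?exprn_gt0//.
    rewrite mulrC -ltr_pdivrMr//; apply: (lt_le_trans (Num.Theory.truncnS_gt _)).
    by rewrite -natrX ler_nat ltnW// ltn_expl.
  exists (h n) => // r /andP[r0 _] rt.
  have [Lr yr] := hy r r0; have [Lt yt] := hy t t0.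
  apply: (le_lt_trans (Rintegral_Omega_le (L2B Lr Lt))); apply: le_lt_trans hn.
  have hrt : ipx (fun x => Y n r x - Y n t x) (fun x => Y n r x - Y n t x) <= 8 ^- n.
    have [tr|rt'] := leP t r.
      have -> : r = t + (r - t) by rewrite addrC subrK.
      apply: hY => //; rewrite subr_ge0 tr/=; apply: ltW.
      by rewrite -[r - t]ger0_norm ?subr_ge0.
    rewrite ip_subC; have -> : t = r + (t - r) by rewrite addrC subrK.
    apply: hY => //; rewrite subr_ge0 ltW//=; apply: ltW.
    by rewrite -[t - r]ger0_norm ?subr_ge0 ?ltW// distrC.
  have b1 := ipDle (L2B Lr (LY n r)) (L2D (L2B (LY n r) (LY n t)) (L2B (LY n t) Lt)).
  have b2 := ipDle (L2B (LY n r) (LY n t)) (L2B (LY n t) Lt).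
  have b3 := yr n; have b4 := yt n; rewrite ip_subC in b4.
  have E : (fun x => (y r x - Y n r x) + ((Y n r x - Y n t x) + (Y n t x - y t x)))
    = (fun x => y r x - y t x) by apply/funext => x; ring.
  rewrite E in b1; rewrite -/(Y n r) in b3; rewrite -/(Y n t) in b4.
  lra.
- pose G n (t : R) := (\int[mux]_x (avg_diff (h n) w (x, t) ^+ 2)%:E)%E.
  have mad n := measurable_avg_diff (h0 n) lw.
  have mad2 n : measurable_fun (setT : set Vm) (fun z => (avg_diff (h n) w z ^+ 2)%:E).
    exact/measurable_EFinP/measurable_funX.
  have ad0 n (z : V) : (0 <= (avg_diff (h n) w z ^+ 2)%:E)%E by rewrite lee_fin sqr_ge0.
  have G0 n t : (0 <= G n t)%E by exact: integral_ge0.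
  have mG n : measurable_fun (setT : set (measurableTypeR R)) (G n).
    exact: (measurable_int_slice (mad2 n) (ad0 n)).
  have IG n : (\int[mut]_t G n t <= (8 ^- n)%:E)%E.
    rewrite -(vol_tonelli (mad2 n) (ad0 n)).
    exact: (avg_close (h0 n) lw (hsh n)).
  (* The weight leaves integrals at most $2^{-n}$, so [ae_bounded] gives, for almost every $t$, a
     bound $s\,2^{-n}$ on [G n t], the squared distance in $L^2(\Omega)$ from the average to the
     slice of [w]. *)
  pose G' n t := ((2 ^+ n)%:E * G n t)%E.
  have mG' n : measurable_fun (setT : set (measurableTypeR R)) (G' n).
    by apply: emeasurable_funM.
  have G'0 n t : (0 <= G' n t)%E by rewrite mule_ge0// lee_fin exprn_ge0.
  have IG' n : (\int[mut]_t G' n t <= (2 ^- n)%:E)%E.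
    rewrite ge0_integralZl ?lee_fin ?exprn_ge0//.
    apply: le_trans (lee_wpmul2l _ (IG n)) _; first by rewrite lee_fin exprn_ge0.
    rewrite -EFinM lee_fin -expr_div_n -exprVn lerXn2r ?nnegrE//; lra.
  have [B [_ aeB hB]] := ae_bounded mG' G'0 IG'.
  apply: negligibleS aeB; apply: subsetC => t Bt tT.
  have [s hs] := hB t Bt; have t0 : 0 <= t by case/andP: tT => /ltW.
  have Gs n : (G n t <= (s * 2 ^- n)%:E)%E.
    have := hs n; rewrite /G' muleC -lee_pdivlMr ?exprn_gt0//.
  have [Lt yt] := hy t t0.
  have mt n : measurable_fun setT (fun x => avg_diff (h n) w (x, t)).
    exact: measurable_slice (mad n).
  have Ld n : L2 mux setT (fun x => avg_diff (h n) w (x, t)).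
    split => //; apply/integrableP; split; first exact/measurable_EFinP/measurable_funX.
    under eq_integral do rewrite gee0_abs ?lee_fin ?sqr_ge0//.
    exact: le_lt_trans (Gs n) (ltry _).
  have Gip n : ipx (fun x => avg_diff (h n) w (x, t)) (fun x => avg_diff (h n) w (x, t))
      <= s * 2 ^- n.
    rewrite -lee_fin; apply: le_trans (Gs n).
    rewrite ip_sqr /Rintegral fineK//; apply: integrable_fin_num => //.
    by case: (Ld n).
  have Ewt n : (fun x => w (x, t)) = (fun x => Y n t x - avg_diff (h n) w (x, t)).
    by apply/funext => x; rewrite /avg_diff /= /Y; ring.
  have Lwt : L2 mux setT (fun x => w (x, t)) by rewrite (Ewt 0%N); exact: L2B.
  have Lyw := L2B Lt Lwt.
  have yw : ipx (fun x => y t x - w (x, t)) (fun x => y t x - w (x, t)) <= 0.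
    apply: (@le0_geometric _ _ (2 + 2 * s)) => n.
    have E : (fun x => (y t x - Y n t x) + avg_diff (h n) w (x, t)) =
             (fun x => y t x - w (x, t)).
      by apply/funext => x; rewrite /avg_diff /= /Y; ring.
    have := ipDle (L2B Lt (LY n t)) (Ld n); rewrite E => /le_trans; apply.
    have := yt n; rewrite -/(Y n t); have := Gip n; have := pow82 n; lra.
  have yw0 : ae_eq mux setT (fun x => y t x - w (x, t)) (fun=> 0).
    by apply: ip_eq0 => //; apply/eqP; rewrite eq_le yw ip_ge0.
  apply: filterS2 yw0 aew => x /(_ Logic.I) h1 h2 Ox.
  move/eqP: h1; rewrite subr_eq0 => /eqP ->.
  by rewrite h2 patchE mem_set.
- have [LT yT] := hy T (ltW T0).
  have Y0 n : Y n T = (fun=> 0).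
    apply/funext => x; rewrite /Y /avg.
    rewrite (_ : ipt _ _ = ipt (fun=> 0) (fun=> 0)); first by rewrite ip0l mulr0.
    apply: eq_Rintegral => s _; rewrite mul0r indicE; have [s0|_] := boolP (s \in _).
      rewrite shifttE w0 ?mulr0// => -[/andP[_ /=]].
      by move: s0; rewrite inE/= in_itv/= => /andP[s0 _]; lra.
    by rewrite mul0r.
  have : ipx (y T) (y T) <= 0.
    apply: (@le0_geometric _ _ 1) => n; rewrite mul1r; apply: le_trans (pow82 n).
    have := yT n; rewrite -/(Y n T) Y0.
    by under eq_fun do rewrite subr0.
  move=> y0; have y0' : ae_eq mux setT (y T) (fun=> 0).
    by apply: ip_eq0 => //; apply/eqP; rewrite eq_le y0 ip_ge0.
  by apply: filterS y0' => x /(_ Logic.I).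
Qed.
End trace_at_horizon.

(** * Smooth functions in $U_0$ that are free at the final time *)

Section smooth_states.
Context {R : realType} {m : nat} (P : interface_problem R m).
Hypothesis hP : standing_assumptions P.
Local Notation V := ('rV[R]_m * R)%type.
Local Notation Vm := ('rV[R]_m * measurableTypeR R)%type.
Local Notation vol := (@vol R m).
Local Notation ipx := (ip (lebesgue_rV m)).
Local Notation ip := (ip vol).
Local Notation L2V := (L2 vol setT).
Local Notation mux := (lebesgue_rV m).
Local Notation mut := (@lebesgue_measure R).
Local Notation T := (horizon P).
Local Notation Q := (QT P).

Lemma L2_W_dual f : L2V f -> W_dual P (fun phi => ip f (phi \_ Q)).
Proof.
move=> Lf; have [C C0 HC] := W_pair_poincare hP.
apply: (bound_W_dual hP (C := ip f f * C)); first by rewrite mulr_ge0 ?ip_ge0.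
- move=> c w1 w2 W1 W2; have L1 := W_space_L2 hP W1; have L2' := W_space_L2 hP W2.
  rewrite -ipZr// -ipDr//; last exact: L2Z.
  congr ip; apply/funext => z; rewrite !patchE; case: ifPn => // _.
  by rewrite mulr0 addr0.
- move=> w Ww; have Lw := W_space_L2 hP Ww.
  apply: (le_trans (ip_cauchy_schwarz Lf Lw)); rewrite -mulrA.
  rewrite ler_wpM2l ?ip_ge0//; exact: HC (W_space_pair hP Ww).
Qed.

Variable psi : V -> R.
Hypothesis Cpsi : C01 (cylinder P [set t | 0 < t]) psi.

Let CpsiT : C01 (cylinder P setT) psi.
Proof. by apply: C01_sub Cpsi => z []. Qed.

Lemma C01_cylinder_W_space : W_space P psi /\
  forall i, ae_eq vol setT (grad0 P psi i) (ddx i psi \_ Q).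
Proof. exact: W_pair_space (W_pair_cylinder hP CpsiT). Qed.

Lemma C01_cylinder_time_deriv :
  is_time_deriv P psi (fun phi => ip (ddt psi) (phi \_ Q)).
Proof.
split; first exact: L2_W_dual (C01_derive_L2 _ Cpsi).
move=> xi Cxi; rewrite (intQ_ddt _ Cxi) (ext_id (C01_off Cxi)).
have -> : ip (psi \_ Q) (ddt xi) = ip psi (ddt xi).
  apply: eq_Rintegral => z _; rewrite patchE; case: ifPn => // /negP nQ.
  by rewrite /ddt (@C01_derive_off _ _ _ xi (0, 1) Cxi) ?mul0r ?mulr0// => /mem_set.
have Cxi' : C01 (cylinder P setT) xi by apply: C01_sub Cxi => z [].
by rewrite /ddt (C01_ibp (0, 1) CpsiT Cxi') opprK.
Qed.

Let OmegaV : {M : R | 0 <= M /\ forall (f : 'rV[R]_m -> R) c, measurable_fun setT f -> 0 <= c ->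
  (forall x, `|f x| <= c * \1_(Omega P) x) -> L2 mux setT f /\ ipx f f <= c ^+ 2 * M}.
Proof.
have mO : measurable (Omega P) := open_measurable_rV (Omega_open hP).
have Ooo := Omega_finite hP; have LO := L2_cst_indic mO Ooo.
exists (fine (mux (Omega P))); split; first exact: fine_ge0.
move=> f c mf c0 fc.
have fc' x : `|f x| <= `|c * \1_(Omega P) x| by apply: (le_trans (fc x)); exact: ler_norm.
split; first exact: L2_le mf (L2Z c LO) fc'.
apply: (le_trans (ip_le_ip mf (L2Z c LO) fc')).
rewrite ipZl ?ipZr//; last exact: L2Z.
have -> : ipx (\1_(Omega P)) (\1_(Omega P)) = \int[mux]_x (\1_(Omega P) x).
  by apply: eq_Rintegral => t _; rewrite indicE; case: (_ \in _); rewrite ?mulr1 ?mulr0.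
by rewrite /Rintegral integral_indic// setIT mulrA -expr2.
Qed.

(** The slices themselves are the continuous representative: they are Lipschitz in time uniformly in
    space, and zero at time 0 since the support lies at positive times. As [psi] need not vanish at
    $T$, such functions detect the final trace of the adjoint. *)
Lemma C01_cylinder_U0 : U0_space P psi.
Proof.
have [Wpsi _] := C01_cylinder_W_space.
split; first by split => //; eexists; exact: C01_cylinder_time_deriv.
have mO : measurable (Omega P) := open_measurable_rV (Omega_open hP).
have [M [M0 hM]] := OmegaV.
have [B [B0 hB]] := C01_bounded Cpsi.
have [D [D0 hD]] := C01_derive_bounded ((0, 1) : V) Cpsi.
have Lpsi := C01_L2 Cpsi.
have mpsi t : measurable_fun setT (fun x => psi (x, t)).
  exact: measurable_slice (L2_measurable Lpsi).
have off x t : ~ Omega P x -> psi (x, t) = 0.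
  by move=> nO; rewrite (C01_off Cpsi)// => -[].
have lip x t r : `|psi (x, r) - psi (x, t)| <= D * `|r - t|.
  wlog tr : r t / t <= r => [H|].
    by have [/H//|/ltW/H] := leP t r; rewrite distrC [`|t - r|]distrC.
  have dp z : derivable psi z ((0, 1) : V).
    by apply: C1_derivable; exact: C01_C1 Cpsi.
  have h0 : 0 <= r - t by rewrite subr_ge0.
  have := line_lipschitz (x, t) dp hD h0; rewrite (ger0_norm h0).
  rewrite (_ : (x, t) + (r - t) *: ((0, 1) : V) = (x, r))//.
  congr pair; rewrite /= ?scaler0 ?addr0//.
  by rewrite [_ *: 1]mulr1 addrC subrK.
have bd t : L2 mux setT (fun x => psi (x, t)).
  have [|//] := hM _ B (mpsi t) B0 _ => x.
  rewrite indicE; have [_|] := boolP (x \in Omega P); first by rewrite mulr1.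
  by move=> /negP nO; rewrite off ?normr0 ?mulr0// => /mem_set.
exists (fun t x => psi (x, t)); split.
- move=> t _; have [mt it] := bd t; split; first exact: measurable_funTS.
  by apply: integrableS it.
- move=> t _ e e0.
  exists (Num.sqrt (e / (D ^+ 2 * M + 1))).
    by rewrite sqrtr_gt0 divr_gt0// ltr_wpDl// mulr_ge0// sqr_ge0.
  move=> r _ rt.
  have [|||Ld bnd] := hM (fun x => psi (x, r) - psi (x, t)) (D * `|r - t|).
  - exact: measurable_funB.
  - exact: mulr_ge0.
  - move=> x; rewrite indicE; have [_|] := boolP (x \in Omega P); first by rewrite mulr1.
    by move=> /negP nO; rewrite !off ?subr0 ?normr0 ?mulr0// => /mem_set.
  apply: (le_lt_trans (Rintegral_Omega_le hP Ld)); apply: (le_lt_trans bnd).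
  have DM : 0 < D ^+ 2 * M + 1 by rewrite ltr_wpDl// mulr_ge0// sqr_ge0.
  have : `|r - t| ^+ 2 < e / (D ^+ 2 * M + 1).
    rewrite -[ltRHS]sqr_sqrtr ?divr_ge0 ?(ltW e0) ?(ltW DM)//.
    by rewrite ltrXn2r// ?nnegrE ?sqrtr_ge0.
  rewrite ltr_pdivlMr// => h; apply: (le_lt_trans _ h).
  by rewrite exprMn mulrAC mulrC ler_wpM2l ?sqr_ge0// lerDl.
- by apply: aeW => t _; apply: aeW.
- by apply: aeW => x _ /=; rewrite (C01_off Cpsi)// => -[_ /=]; rewrite ltxx.
Qed.
End smooth_states.

(** * Regularity of the adjoint *)

Section adjoint_regularity.
Context {R : realType} {m : nat} (P : interface_problem R m).
Hypothesis hP : standing_assumptions P.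
Local Notation V := ('rV[R]_m * R)%type.
Local Notation Vm := ('rV[R]_m * measurableTypeR R)%type.
Local Notation vol := (@vol R m).
Local Notation ip := (ip vol).
Local Notation L2V := (L2 vol setT).
Local Notation T := (horizon P).
Local Notation Q := (QT P).
Implicit Types (u w p phi psi : V -> R) (F G : (V -> R) -> R).

Lemma W_dualD F G : W_dual P F -> W_dual P G -> W_dual P (fun phi => F phi + G phi).
Proof.
move=> [Fl [C FC]] [Gl [D GD]]; split.
  by move=> c w1 w2 W1 W2; rewrite (Fl c _ _ W1 W2) (Gl c _ _ W1 W2); ring.
exists (C + D) => w Ww; rewrite mulrDl (le_trans (ler_normD _ _))//.
by rewrite lerD ?FC ?GD.
Qed.

Lemma W_dualN F : W_dual P F -> W_dual P (fun phi => - F phi).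
Proof.
move=> [Fl [C FC]]; split; last by exists C => w Ww; rewrite normrN; exact: FC.
by move=> c w1 w2 W1 W2; rewrite (Fl c _ _ W1 W2); ring.
Qed.

Lemma W_dual_sum (I : Type) (s : seq I) (F : I -> (V -> R) -> R) :
  (forall i, W_dual P (F i)) -> W_dual P (fun phi => \sum_(i <- s) F i phi).
Proof.
move=> DF; elim: s => [|i s ih].
  under eq_fun do rewrite big_nil; split; first by move=> *; ring.
  by exists 0 => w _; rewrite mul0r normr0.
by under eq_fun do rewrite big_cons; exact: W_dualD.
Qed.

Lemma grad_W_dual f i : L2V f -> W_dual P (fun phi => ip f (grad0 P phi i)).
Proof.
move=> Lf; apply: (bound_W_dual hP (ip_ge0 vol f)).
- move=> c w1 w2 W1 W2; have L1 := grad0_L2 hP i W1; have L2' := grad0_L2 hP i W2.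
  have [Wl gl] := W_space_lin hP c W1 W2; have Ll := grad0_L2 hP i Wl.
  rewrite -ipZr// -ipDr//; last exact: L2Z.
  rewrite ipC [RHS]ipC; exact: ip_ae Ll (L2D (L2Z c L1) L2') Lf (gl i).
- move=> w Ww; have Lg := grad0_L2 hP i Ww.
  apply: (le_trans (ip_cauchy_schwarz Lf Lg)); rewrite ler_wpM2l ?ip_ge0//.
  rewrite /grad_nrm2 (bigD1 i)//= lerDl sumr_ge0// => j _; exact: ip_ge0.
Qed.

Lemma W_form_sym w w' : W_form P w w' = W_form P w' w.
Proof.
apply: eq_Rintegral => z _; congr (_ * _); apply: eq_bigr => i _; exact: mulrC.
Qed.

Lemma W_form_W_dual w : W_space P w -> W_dual P (fun phi => W_form P w phi).
Proof.
move=> Ww; have Lk i := L2_kappa hP (grad0_L2 hP i Ww).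
have [Sl [C SC]] := W_dual_sum (index_enum 'I_m) (fun i => grad_W_dual i (Lk i)).
have E phi : W_space P phi -> W_form P w phi =
    \sum_(i <- index_enum 'I_m) ip (fun z => kappa P z * grad0 P w i z) (grad0 P phi i).
  by move=> Wphi; rewrite W_formE.
split; last by exists C => phi Wphi; rewrite E//; exact: SC.
move=> c w1 w2 W1 W2; have [Wl _] := W_space_lin hP c W1 W2.
by rewrite (E _ Wl) (E _ W1) (E _ W2); exact: (Sl c _ _ W1 W2).
Qed.

Lemma form_integral (c : R) u phi : W_space P u -> W_space P phi ->
  intQ P (fun z => c * (dotp (velocity P z) (wgrad P u z) * phi z) +
                 kappa P z * dotp (wgrad P u z) (wgrad P phi z)) =
  c * ip (vdot P (grad0 P u)) (phi \_ Q) + W_form P u phi.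
Proof.
move=> Wu Wphi; have Lphi := W_space_L2 hP Wphi.
have Lv : L2V (vdot P (grad0 P u)) := L2_vdot hP (fun i => grad0_L2 hP i Wu).
have Lk i := L2_kappa hP (grad0_L2 hP i Wu).
have [Es Is] := Rintegral_sum (index_enum 'I_m)
  (fun i => L2_mul (Lk i) (grad0_L2 hP i Wphi)).
rewrite W_formE// -Es -ipZl//.
rewrite -RintegralD//; last by apply: L2_mul => //; exact: L2Z.
rewrite /intQ Rintegral_mkcond; apply: eq_Rintegral => z _.
rewrite patchE /=; case: ifPn => [Qz|nQz].
  rewrite [(phi \_ Q) z]patchE Qz mulrA; congr (c * _ * _ + _).
    by apply: eq_bigr => i _; rewrite /grad0 /vel !patchE Qz.
  by rewrite /dotp mulr_sumr; apply: eq_bigr => i _; rewrite /grad0 !patchE Qz mulrA.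
rewrite [(phi \_ Q) z]patchE (negbTE nQz) mulr0 big1 ?addr0// => i _.
by rewrite /grad0 !patchE (negbTE nQz) mulr0.
Qed.

Lemma form_aE u phi : W_space P u -> W_space P phi ->
  form_a P u phi = time_deriv P u phi + ip (vdot P (grad0 P u)) (phi \_ Q) + W_form P u phi.
Proof.
move=> Wu Wphi; rewrite /form_a -addrA; congr (_ + _).
have := form_integral 1 Wu Wphi; rewrite mul1r => <-.
by apply: eq_Rintegral => z _; rewrite mul1r.
Qed.

Lemma form_a'E p phi : W_space P p -> W_space P phi ->
  form_a' P p phi =
  - time_deriv P p phi - ip (vdot P (grad0 P p)) (phi \_ Q) + W_form P p phi.
Proof.
move=> Wp Wphi; rewrite /form_a' -addrA; congr (_ + _).
have := form_integral (-1) Wp Wphi; rewrite mulN1r => <-.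
by apply: eq_Rintegral => z _; rewrite mulN1r.
Qed.

(** The equation is solved for the time derivative: [F] is what it dictates, and the skew symmetry
    of convection moves the gradient from [psi] to [p]. Test functions in $C_0^1(Q_T)$ show that [F]
    is the time derivative; those that reach $T$ give one-sidedness, hence the zero final trace. *)
Lemma adjoint_regularity p f : W_space P p -> L2Q P f ->
  (forall psi, U0_space P psi -> form_a P psi p = intQ P (fun z => f z * psi z)) ->
  UT_space P p.
Proof.
move=> Wp /(L2V_ext hP) Lf H.
have Lv : L2V (vdot P (grad0 P p)) := L2_vdot hP (fun i => grad0_L2 hP i Wp).
pose F phi := W_form P p phi -
  ip (fun z => (f \_ Q) z + vdot P (grad0 P p) z) (phi \_ Q).
have DF : W_dual P F.
  apply: W_dualD; first exact: W_form_W_dual.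
  by apply: W_dualN; apply: L2_W_dual => //; exact: L2D.
have FE psi : C01 (cylinder P [set t | 0 < t]) psi -> F psi = - ip (p \_ Q) (ddt psi).
  move=> Cpsi; have Upsi := C01_cylinder_U0 hP Cpsi; have [[Wpsi _] _] := Upsi.
  have Lpsi := W_space_L2 hP Wpsi.
  have := H psi Upsi; rewrite form_aE// intQ_mul.
  rewrite (time_deriv_unique hP (C01_cylinder_time_deriv hP Cpsi) Wp).
  have sk := vdot_skew hP (W_space_pair hP Wpsi) (W_space_pair hP Wp).
  rewrite /F ipDl// (W_form_sym psi) (ipC vol (p \_ Q)); lra.
have tF : is_time_deriv P p F.
  split => // xi Cxi; rewrite (intQ_ddt _ Cxi); apply: FE.
  by apply: C01_sub Cxi => z [/andP[h _] ?]; split.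
have osF : one_sided P (p \_ Q) F (-1).
  move=> xi h Cxi h0; apply: FE.
  have Cxi' : C01 (cylinder P [set t | 0 < t < T]) xi by rewrite -QT_cylinder.
  apply: C01_shiftt_cylinder Cxi' => t /= /andP[h1 _]; lra.
split; first by split => //; exists F.
exact: (trace_at_horizon hP Wp DF osF).
Qed.

End adjoint_regularity.

(** * Adjointness of the two forms and uniqueness for the optimality system *)

Section optimality.
Context {R : realType} {m : nat} (P : interface_problem R m).
Hypothesis hP : standing_assumptions P.
Local Notation V := ('rV[R]_m * R)%type.
Local Notation vol := (@vol R m).
Local Notation ip := (ip vol).
Local Notation L2V := (L2 vol setT).
Local Notation T := (horizon P).
Local Notation Q := (QT P).
Implicit Types (u w p phi psi : V -> R) (F G : (V -> R) -> R).

Lemma W_dual0 F : W_dual P F -> F (fun=> 0) = 0.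
Proof.
move=> [Fl _]; have W0 := W_space0 hP; have := Fl 1 _ _ W0 W0.
rewrite (_ : (fun z : V => 1 * 0 + 0) = fun=> 0); last by apply/funext => z; ring.
lra.
Qed.

Lemma U0_one_sided psi : U0_space P psi ->
  one_sided P (psi \_ Q) (time_deriv P psi) 1.
Proof.
move=> [Upsi tr] xi h Cxi h0; have T0 := horizon_gt0 hP.
apply: (@trace_time_deriv _ _ _ hP 1 0 0 [set t | t < T]) => //.
- by rewrite lexx ltW.
- by move=> t; rewrite mul1r addr0 subr0.
- by rewrite normr1.
- by move=> t /= ->; rewrite mul1r addr0 andbT.
- by move=> t /andP[t0 _]; rewrite mul1r addr0.
have Cxi' : C01 (cylinder P [set t | 0 < t < T]) xi by rewrite -QT_cylinder.
apply: C01_shiftt_cylinder Cxi' => t /= /andP[_ h1]; lra.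
Qed.

Lemma UT_one_sided p : UT_space P p ->
  one_sided P (p \_ Q) (time_deriv P p) (-1).
Proof.
move=> [Up tr] xi h Cxi h0; have T0 := horizon_gt0 hP.
apply: (@trace_time_deriv _ _ _ hP (-1) T T [set t | 0 < t]) => //.
- by rewrite lexx ltW.
- by move=> t; rewrite distrC mulN1r addrC.
- by rewrite normrN normr1.
- move=> t /= -> /=; lra.
- move=> t /andP[_ tT]; lra.
have Cxi' : C01 (cylinder P [set t | 0 < t < T]) xi by rewrite -QT_cylinder.
apply: C01_shiftt_cylinder Cxi' => t /= /andP[h1 _]; lra.
Qed.

(** Shifting [p] forward against [psi] is the same as shifting [psi] backward against [p]. So both
    sides are limits of one sequence of difference quotients; the zero traces at opposite ends
    provide the two one-sided properties. *)
Lemma time_deriv_adjoint psi p : U0_space P psi -> UT_space P p ->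
  time_deriv P psi p = - time_deriv P p psi.
Proof.
move=> U0 UT; have [Upsi _] := U0; have [Up _] := UT.
have [Wpsi _] := Upsi; have [Wp _] := Up.
have [Lpsi _ psi0 _] := W_space_pair hP Wpsi; have [Lp _ p0 _] := W_space_pair hP Wp.
have [Dpsi _] := time_derivP Upsi; have [Dp _] := time_derivP Up.
have sg1 : 1 ^+ 2 = 1 :> R by rewrite expr1n.
have sgN1 : (-1) ^+ 2 = 1 :> R by rewrite sqrrN expr1n.
have c1 := diffq_cvg hP Lpsi (fun z nz => proj1 (psi0 z nz)) Dpsi (U0_one_sided U0) sg1 Wp.
have c2 := diffq_cvg hP Lp (fun z nz => proj1 (p0 z nz)) Dp (UT_one_sided UT) sgN1 Wpsi.
have E : (fun n => diffq (psi \_ Q) 1 n (p \_ Q)) =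
         (fun n => diffq (p \_ Q) (-1) n (psi \_ Q)).
  apply/funext => n; rewrite /diffq; congr (_ * _).
  rewrite !ipBr//; try exact: L2_shiftt.
  by rewrite [in RHS]ipC mulN1r (ip_shiftt_adj _ Lpsi Lp) opprK mul1r [ip (p \_ Q) _]ipC.
rewrite E in c1.
have : -1 * time_deriv P psi p = - (-1) * time_deriv P p psi by exact: cvg_unique c1 c2.
lra.
Qed.

Lemma form_adjoint psi p : U0_space P psi -> UT_space P p ->
  form_a P psi p = form_a' P p psi.
Proof.
move=> U0 UT; have [[Wpsi _] _] := U0; have [[Wp _] _] := UT.
rewrite (form_aE hP Wpsi Wp) (form_a'E hP Wp Wpsi) (time_deriv_adjoint U0 UT).
rewrite (W_form_sym _ psi p).
have := vdot_skew hP (W_space_pair hP Wpsi) (W_space_pair hP Wp); lra.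
Qed.

Lemma form_a_W_dual u : U_space P u -> W_dual P (form_a P u).
Proof.
move=> Uu; have [Wu _] := Uu; have [Du _] := time_derivP Uu.
have Lv : L2V (vdot P (grad0 P u)) := L2_vdot hP (fun i => grad0_L2 hP i Wu).
have [Sl [C SC]] := W_dualD (W_dualD Du (L2_W_dual hP Lv)) (W_form_W_dual hP Wu).
split; last by exists C => phi Wphi; rewrite form_aE//; exact: SC.
move=> c w1 w2 W1 W2; have [Wl _] := W_space_lin hP c W1 W2.
rewrite (form_aE hP Wu Wl) (form_aE hP Wu W1) (form_aE hP Wu W2).
exact: (Sl c _ _ W1 W2).
Qed.

Lemma W_form_eqQ0 w phi : W_space P w -> W_space P phi -> eqQ P w (fun=> 0) ->
  W_form P w phi = 0.
Proof.
move=> Ww Wphi /eqQ_ext ae; have W0 := W_space0 hP.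
rewrite W_form_sym -(W_dual0 (W_form_W_dual hP Wphi)).
apply: (W_dual_ae hP (W_form_W_dual hP Wphi) Ww W0) => i.
have [Hw _] := Ww; have [H0 _] := W0.
exact: (is_wgrad_unique hP (wgradP Hw) (wgradP H0) ae
  (W_space_L2 hP Ww) (W_space_L2 hP W0)).
Qed.

(** The lower bound on $\kappa$ kills the gradient, and the Poincaré inequality then kills the
    function. *)
Lemma W_form_le0 w : W_space P w -> W_form P w w <= 0 -> eqQ P w (fun=> 0).
Proof.
move=> Ww h; have /andP[h1 _] := W_form_bounds hP Ww.
have k0 := kmin_gt0 hP.
have g0 : grad_nrm2 (grad0 P w) <= 0.
  by have := le_trans h1 h; rewrite pmulr_rle0.
have [C C0 HC] := W_pair_poincare hP.
have := HC _ _ (W_space_pair hP Ww) => h2.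
have h3 : ip (w \_ Q) (w \_ Q) = 0.
  apply/eqP; rewrite eq_le ip_ge0 andbT; apply: (le_trans h2).
  by rewrite mulr_ge0_le0.
apply/eqQ_ext; have := ip_eq0 (W_space_L2 hP Ww) h3.
by apply: filterS => z hz /hz ->; rewrite patchE; case: ifP.
Qed.

Lemma W_formBB w w' : W_space P w -> W_space P w' ->
  W_space P (fun z => -1 * w' z + w z) /\
  W_form P (fun z => -1 * w' z + w z) (fun z => -1 * w' z + w z) =
  W_form P w w - W_form P w w' - W_form P w' w + W_form P w' w'.
Proof.
move=> W1 W2; have [Wd _] := W_space_lin hP (-1) W2 W1; split => //.
have [l1 _] := W_form_W_dual hP W1; have [l2 _] := W_form_W_dual hP W2.
have [ld _] := W_form_W_dual hP Wd.
have e1 := l1 (-1) _ _ W2 W1; have e2 := l2 (-1) _ _ W2 W1.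
have ed := ld (-1) _ _ W2 W1.
set d := (fun z => -1 * w' z + w z) in e1 e2 ed *.
rewrite ed (W_form_sym P d w') (W_form_sym P d w) e1 e2.
have key (a b c e : R) : -1 * (-1 * a + b) + (-1 * c + e) = e - c - b + a by ring.
exact: key.
Qed.

End optimality.

(** First identity minus the second and third plus the fourth. Here [u], [s], [d] stand for
    $\overline u$, $u^*$, $u_d$ in $L^2$ products, and [pp], [ps], [sp], [qq] for the energy
    products of $\overline p$ and $p^*$; the terms with the datum cancel. *)
Lemma saddle_sum {R : realFieldType} (k uu us su ss du ds pp ps sp qq : R) :
  uu - du + k * pp = 0 -> su - du + k * ps = 0 ->
  us - ds + k * sp = 0 -> ss - ds + k * qq = 0 ->
  uu - us - (su - ss) + k * (pp - ps - sp + qq) = 0.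
Proof. by lra. Qed.

Theorem theorem3p1 (R : realType) (m : nat) (P : interface_problem R m)
    (hP : standing_assumptions P)
    (ud : 'rV[R]_m * R -> R) (hud : L2Q P ud) (eta : R) (heta : 0 < eta)
    (ubar pbar : 'rV[R]_m * R -> R)
    (hubar : U0_space P ubar) (hpbar : W_space P pbar)
    (hA : forall phi psi, W_space P phi -> U0_space P psi ->
      form_A P eta ubar pbar phi psi = intQ P (fun z => ud z * psi z)) :
  UT_space P pbar /\
  forall (fstar : ('rV[R]_m * R -> R) -> R) (ustar pstar zstar : 'rV[R]_m * R -> R),
    is_minimizer P ud eta fstar ->
    U0_space P ustar -> UT_space P pstar ->
    (forall phi, W_space P phi -> form_a P ustar phi = fstar phi) ->
    (forall phi, W_space P phi ->
      form_a' P pstar phi = intQ P (fun z => (ustar z - ud z) * phi z)) ->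
    is_riesz P fstar zstar ->
    eqQ P (fun z => pstar z + eta * zstar z) (fun=> 0) ->
    eqQ P ubar ustar /\ eqQ P pbar pstar.
Proof.
have W0 := W_space0 hP; have [Ubar _] := hubar; have [Wubar _] := Ubar.
have Lud := (L2V_ext hP ud).1 hud; have Lubar := W_space_L2 hP Wubar.
(* Adjoint equation: test with $\varphi=0$. *)
have Ebar psi : U0_space P psi -> form_a P psi pbar =
    intQ P (fun z => (ubar z - ud z) * psi z).
  move=> Upsi; have [[Wpsi _] _] := Upsi; have Lpsi := W_space_L2 hP Wpsi.
  have := hA _ psi W0 Upsi; rewrite /form_A (W_dual0 hP (form_a_W_dual hP Ubar)).
  rewrite (W_dual0 hP (W_form_W_dual hP hpbar)) !intQ_mul extB (ipBl Lubar Lud Lpsi).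
  have key (f i j : R) : 0 + eta^-1 * 0 + i - f = j -> f = i - j by lra.
  exact: key.
(* State equation: test with $\psi=\overline u$ and remove the adjoint part by [Ebar]. *)
have Sbar phi : W_space P phi -> form_a P ubar phi + eta^-1 * W_form P pbar phi = 0.
  move=> Wphi; have := Ebar _ hubar; have := hA _ ubar Wphi hubar; rewrite /form_A.
  rewrite !intQ_mul extB (ipBl Lubar Lud Lubar).
  have key (a b f i j : R) : a + b + i - f = j -> f = i - j -> a + b = 0 by lra.
  exact: key.
have UTbar : UT_space P pbar.
  apply: (adjoint_regularity hP hpbar _ Ebar).
  by apply/(L2V_ext hP); rewrite extB; exact: L2B.
split => // fstar ustar pstar zstar _ Ustar UTstar Sstar Estar [Wz Rz] opt.
have [[Wustar _] _] := Ustar; have [[Wpstar _] _] := UTstar.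
have Lustar := W_space_L2 hP Wustar.
have Sstar' phi : W_space P phi -> form_a P ustar phi + eta^-1 * W_form P pstar phi = 0.
  move=> Wphi; have [WX _] := W_space_lin hP eta Wz Wpstar.
  have X0 : eqQ P (fun z => eta * zstar z + pstar z) (fun=> 0).
    by apply: filterS opt => z hz /hz; rewrite addrC.
  have := W_form_eqQ0 hP WX Wphi X0; have [l _] := W_form_W_dual hP Wphi.
  rewrite W_form_sym (l eta _ _ Wz Wpstar) (W_form_sym _ phi zstar) (W_form_sym _ phi pstar).
  rewrite Sstar// -Rz// => h.
  by apply: (mulfI (lt0r_neq0 heta)); rewrite mulr0 mulrDr mulVKf ?gt_eqF.
(* Each state equation is tested with each adjoint; the adjoint equations then turn all four values
   of [form_a] into $L^2$ products. *)
have e1 := Sbar _ hpbar; have e2 := Sbar _ Wpstar.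
have e3 := Sstar' _ hpbar; have e4 := Sstar' _ Wpstar.
rewrite (Ebar _ hubar) in e1; rewrite (form_adjoint hP hubar UTstar) (Estar _ Wubar) in e2.
rewrite (Ebar _ Ustar) in e3; rewrite (form_adjoint hP Ustar UTstar) (Estar _ Wustar) in e4.
rewrite intQ_mul extB (ipBl Lubar Lud Lubar) in e1.
rewrite intQ_mul extB (ipBl Lustar Lud Lubar) in e2.
rewrite intQ_mul extB (ipBl Lubar Lud Lustar) in e3.
rewrite intQ_mul extB (ipBl Lustar Lud Lustar) in e4.
have Ld := L2B Lubar Lustar.
have [Wd EW] := W_formBB hP hpbar Wpstar.
set d := fun z => -1 * pstar z + pbar z in Wd EW.
have k0 : 0 <= W_form P d d.
  have /andP[h _] := W_form_bounds hP Wd; apply: le_trans h.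
  by rewrite mulr_ge0 ?(ltW (kmin_gt0 hP)) ?grad_nrm2_ge0.
have u0 := ip_ge0 (@vol R m) (fun z => (ubar \_ (QT P)) z - (ustar \_ (QT P)) z).
(* The alternating sum of the four identities is $\|\overline u-u^*\|^2+\eta^{-1}\|\overline
   p-p^*\|_W^2=0$; both terms are nonnegative, so both vanish. *)
have sum0 : ip (@vol R m) (fun z => (ubar \_ (QT P)) z - (ustar \_ (QT P)) z)
     (fun z => (ubar \_ (QT P)) z - (ustar \_ (QT P)) z) + eta^-1 * W_form P d d = 0.
  rewrite (ipBl Lubar Lustar Ld) (ipBr Lubar Lustar Lubar) (ipBr Lubar Lustar Lustar) EW.
  exact: saddle_sum e1 e2 e3 e4.
have k1 : 0 <= eta^-1 * W_form P d d by rewrite mulr_ge0 ?invr_ge0 ?(ltW heta).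
have [z0 d0] : ip (@vol R m) (fun z => (ubar \_ (QT P)) z - (ustar \_ (QT P)) z)
    (fun z => (ubar \_ (QT P)) z - (ustar \_ (QT P)) z) = 0 /\ W_form P d d <= 0.
  move/eqP: sum0; rewrite paddr_eq0// => /andP[/eqP z0 /eqP W00].
  by split; [exact: z0|rewrite -(pmulr_rle0 _ (_ : 0 < eta^-1)) ?W00 ?invr_gt0].
split.
  apply/eqQ_ext; have := ip_eq0 Ld z0; apply: filterS => z hz /hz /eqP.
  by rewrite subr_eq0 => /eqP.
have := W_form_le0 hP Wd d0; apply: filterS => z hz /hz.
by rewrite /d mulN1r addrC => /eqP; rewrite subr_eq0 => /eqP.
Qed.
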